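(* Let $\alpha\ge 0$ and let $a,b>0$. Then there exists a constant $C>0$ (independent of $f$) such that for all $f\in L^2_\alpha(\mathbb{K})$, $$\big\|\,|(x,t)|^a f\,\big\|_{\alpha,2}^{\frac{2b}{a+2b}}\ \Big\|\big(2(2m+\alpha+1)\lambda\big)^{b}\,\mathcal{F}_{LB}(f)\Big\|_{\gamma_\alpha,2}^{\frac{a}{a+2b}}\ \ge\ C\,\|f\|_{\alpha,2}.$$ (The norms on the left-hand side may be infinite.)
   Context: Fix $\alpha\ge 0$. Let $\mathbb{K}=[0,+\infty)\times[0,+\infty)$, with points $(x,t)$, and $\widehat{\mathbb{K}}=[0,+\infty)\times\mathbb{N}$ (with $0\in\mathbb{N}$), with points $(\lambda,m)$. Measures and norms: $dm_\alpha(x,t)=\frac{1}{\pi\Gamma(\alpha+1)}x^{2\alpha+1}t^{2\alpha}\,dx\,dt$ on $\mathbb{K}$. $L^p_\alpha(\mathbb{K})$ denotes $L^p(\mathbb{K},m_\alpha)$ with norm $\|\cdot\|_{\alpha,p}$. The measure $\gamma_\alpha$ on $\widehat{\mathbb{K}}$ is given by $$\int_{\widehat{\mathbb{K}}} g\,d\gamma_\alpha=\frac{1}{2^{2\alpha-1}\Gamma(\alpha+\frac12)}\sum_{m=0}^\infty L_m^\alpha(0)\int_0^{+\infty} g(\lambda,m)\,\lambda^{3\alpha+1}\,d\lambda ,$$ and $L^p_{\gamma_\alpha}(\widehat{\mathbb{K}})$ denotes $L^p(\widehat{\mathbb{K}},\gamma_\alpha)$ with norm $\|\cdot\|_{\gamma_\alpha,p}$.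 Homogeneous norm: $|(x,t)|=(x^4+4t^2)^{1/4}$. Laguerre-Bessel transform: for $(\lambda,m)\in\widehat{\mathbb{K}}$ put $\varphi_{(\lambda,m)}(x,t)=j_{\alpha-\frac12}(\lambda t)\,\mathcal{L}_m^\alpha(\lambda x^2)$, where $j_\nu(z)=\Gamma(\nu+1)\sum_{k\ge0}\frac{(-1)^k}{k!\,\Gamma(\nu+k+1)}(z/2)^{2k}$ is the normalized Bessel function, $\mathcal{L}_m^\alpha(z)=e^{-z/2}L_m^\alpha(z)/L_m^\alpha(0)$, and $L_m^\alpha$ is the Laguerre polynomial of degree $m$ and order $\alpha$. For $f\in L^1_\alpha(\mathbb{K})$, $$\mathcal{F}_{LB}(f)(\lambda,m)=\int_{\mathbb{K}}f(x,t)\,\varphi_{(\lambda,m)}(x,t)\,dm_\alpha(x,t).$$ On $L^2_\alpha(\mathbb{K})$, $\mathcal{F}_{LB}$ denotes the unique continuous extension from $L^1_\alpha(\mathbb{K})\cap L^2_\alpha(\mathbb{K})$ to an operator $L^2_\alpha(\mathbb{K})\to L^2_{\gamma_\alpha}(\widehat{\mathbb{K}})$. In $\|(2(2m+\alpha+1)\lambda)^b\mathcal{F}_{LB}(f)\|_{\gamma_\alpha,2}$ the norm is that of the function $(\lambda,m)\mapsto(2(2m+\alpha+1)\lambda)^b\mathcal{F}_{LB}(f)(\lambda,m)$. *)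

(* Defs.v *)
From HB Require Import structures.
From mathcomp Require Import all_boot all_order all_algebra.
From mathcomp Require Import complex.
From mathcomp Require Import all_classical all_reals all_analysis measurable_realfun.
Import Order.TTheory GRing.Theory Num.Theory.
Import numFieldNormedType.Exports.

Set Implicit Arguments.
Unset Strict Implicit.
Unset Printing Implicit Defensive.

Local Open Scope classical_set_scope.
Local Open Scope ring_scope.

Section weighted_measure.
Context d (T : measurableType d) (R : realType).
Variables (mu : {measure set T -> \bar R}) (w : T -> R).
Hypotheses (w0 : forall x, 0 <= w x) (mw : measurable_fun [set: T] w).

(* The measure w(x) dmu(x). The proof arguments are not used in the value; they
   let canonical inference find the measure structure. *)
Definition mweighted of (forall x, 0 <= w x) & measurable_fun [set: T] w :=
  fun A : set T => (\int[mu]_(x in A) (w x)%:E)%E.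

Let mweighted_set0 : mweighted w0 mw set0 = 0%E.
Proof. exact: integral_set0. Qed.

Let mweighted_ge0 A : (0 <= mweighted w0 mw A)%E.
Proof. by apply: integral_ge0 => x _; rewrite lee_fin. Qed.

Let mweighted_sigma_additive : semi_sigma_additive (mweighted w0 mw).
Proof.
apply: semi_sigma_additive_nng_induced; first exact/measurable_EFinP.
by move=> x; rewrite lee_fin.
Qed.

HB.instance Definition _ := isMeasure.Build _ _ _ (mweighted w0 mw)
  mweighted_set0 mweighted_ge0 mweighted_sigma_additive.

End weighted_measure.

(* Measurability and integrability of R[i]-valued functions are taken on real
   and imaginary parts; the L^p norm is that of the modulus. *)
Section complex_Lp.
Context d (T : measurableType d) (R : realType).
Variable mu : {measure set T -> \bar R}.

Definition cLnorm (p : \bar R) (f : T -> R[i]) : \bar R :=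
  Lnorm mu p (fun x => (Normc.normc (f x))%:E).

Definition cLfun (p : \bar R) : set (T -> R[i]) :=
  [set f | [/\ measurable_fun [set: T] (fun x => complex.Re (f x)),
               measurable_fun [set: T] (fun x => complex.Im (f x)) &
               (cLnorm p f < +oo)%E]].

Definition cintegral (f : T -> R[i]) : R[i] :=
  Complex (\int[mu]_x complex.Re (f x)) (\int[mu]_x complex.Im (f x)).

End complex_Lp.

Section special_functions.
Context {R : realType}.

(* Only used for s > 0, where Euler's integral converges. *)
Definition Gamma (s : R) : R :=
  \int[lebesgue_measure]_(u in `]0%R, +oo[) (u `^ (s - 1) * expR (- u)).

Lemma Gamma_ge0 (s : R) : 0 <= Gamma s.
Proof.
apply: Rintegral_ge0 => u _.
by rewrite mulr_ge0 ?powR_ge0 ?expR_ge0.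
Qed.

(* j_nu, only used for nu >= -1/2, where every Gamma argument is positive *)
Definition bessel_j (nu z : R) : R :=
  Gamma (nu + 1) * limn (series (fun k : nat =>
    (-1) ^+ k / (k`!%:R * Gamma (nu + k%:R + 1)) * (z / 2) ^+ (2 * k))).

(* L_m^alpha(z) =
     \sum_(k <= m) (alpha + k + 1) ... (alpha + m) / (k! (m - k)!) (-z)^k *)
Definition laguerre (alpha : R) (m : nat) : {poly R} :=
  \poly_(k < m.+1) ((-1) ^+ k * (\prod_(k <= i < m) (alpha + i%:R + 1))
                    / (k`!%:R * (m - k)`!%:R)).

Definition laguerre_fun (alpha : R) (m : nat) (z : R) : R :=
  expR (- (z / 2)) * (laguerre alpha m).[z] / (laguerre alpha m).[0].

Lemma laguerre0_ge0 (alpha : {nonneg R}) m : 0 <= (laguerre alpha%:num m).[0].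
Proof.
rewrite horner_coef0 coef_poly ltn0Sn expr0 mul1r.
by rewrite mulr_ge0 ?invr_ge0// prodr_ge0.
Qed.

End special_functions.

HB.instance Definition _ (R : realType) :=
  @Measure_isSigmaFinite.Build _ nat R (@counting nat R)
    (sigma_finite_counting R).

(* Functions on K = [0, +oo[ x [0, +oo[ (resp. on K^ = [0, +oo[ x nat) are
   represented by functions on R * R (resp. R * nat); the measures below vanish
   outside K (resp. K^), so that the values taken there are irrelevant. *)
Section laguerre_bessel.
Context {R : realType} (alpha : {nonneg R}).
Local Notation a := (alpha%:num).
Local Notation leb := (@lebesgue_measure R).
Local Notation RM := (measurableTypeR R).

Definition K_space : set (R * R) := `[0, +oo[ `*` `[0, +oo[.
Definition Khat_space : set (R * nat) := `[0, +oo[ `*` [set: nat].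

Definition m_weight (z : R * R) : R :=
  (pi * Gamma (a + 1))^-1 * z.1 `^ (2 * a + 1) * z.2 `^ (2 * a) * \1_K_space z.

Lemma m_weight_ge0 z : 0 <= m_weight z.
Proof.
by rewrite !mulr_ge0 ?powR_ge0 ?invr_ge0 ?mulr_ge0 ?pi_ge0 ?Gamma_ge0.
Qed.

Lemma measurable_m_weight : measurable_fun [set: RM * RM] m_weight.
Proof.
apply: measurable_funM; last by apply: measurable_indic; exact: measurableX.
apply: measurable_funM.
  apply: measurable_funM => //.
  exact: (measurableT_comp (measurable_powR _)).
exact: (measurableT_comp (measurable_powR _)).
Qed.

Definition m_alpha : {measure set (RM * RM) -> \bar R} :=
  mweighted (leb \x leb)%E
    m_weight_ge0 measurable_m_weight.

Definition gamma_weight (w : R * nat) : R :=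
  (2 `^ (2 * a - 1) * Gamma (a + 2^-1))^-1 * (laguerre a w.2).[0]
    * w.1 `^ (3 * a + 1) * \1_Khat_space w.

Lemma gamma_weight_ge0 w : 0 <= gamma_weight w.
Proof.
by rewrite !mulr_ge0 ?powR_ge0 ?invr_ge0 ?mulr_ge0 ?powR_ge0 ?Gamma_ge0 ?laguerre0_ge0.
Qed.

Lemma measurable_gamma_weight : measurable_fun [set: RM * nat] gamma_weight.
Proof.
apply: measurable_funM; last by apply: measurable_indic; exact: measurableX.
apply: measurable_funM; last exact: (measurableT_comp (measurable_powR _)).
apply: measurable_funM => //.
exact: (@measurableT_comp _ _ _ _ _ _ (fun m : nat => (laguerre a m).[0])).
Qed.

Definition gamma_alpha : {measure set (RM * nat) -> \bar R} :=
  mweighted (leb \x @counting nat R)%E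
    gamma_weight_ge0 measurable_gamma_weight.

Definition hom_norm (z : R * R) : R := (z.1 ^+ 4 + 4 * z.2 ^+ 2) `^ 4^-1.

Definition LB_kernel (w : R * nat) (z : R * R) : R :=
  bessel_j (a - 2^-1) (w.1 * z.2) * laguerre_fun a w.2 (w.1 * z.1 ^+ 2).

Definition LB_transform1 (f : R * R -> R[i]) (w : R * nat) : R[i] :=
  cintegral m_alpha (fun z => f z * (LB_kernel w z)%:C%C).

(* T is a continuous extension of the transform from L^1 /\ L^2 to an operator
   L^2(m_alpha) -> L^2(gamma_alpha). The density of L^1 /\ L^2 in L^2 makes it
   unique up to gamma_alpha-null sets. *)
Definition is_LB_extension (T : (R * R -> R[i]) -> R * nat -> R[i]) : Prop :=
  [/\ (forall f : R * R -> R[i], cLfun m_alpha 2%:E f -> cLfun gamma_alpha 2%:E (T f)),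
      (forall f : R * R -> R[i], cLfun m_alpha 2%:E f -> forall e : R, 0 < e ->
         exists2 r : R, 0 < r & forall g : R * R -> R[i], cLfun m_alpha 2%:E g ->
           (cLnorm m_alpha 2%:E (fun z => (g z - f z)%R) < r%:E)%E ->
           (cLnorm gamma_alpha 2%:E (fun w => (T g w - T f w)%R) < e%:E)%E) &
      (forall f : R * R -> R[i], cLfun m_alpha 1%:E f -> cLfun m_alpha 2%:E f ->
         {ae gamma_alpha, forall w, T f w = LB_transform1 f w})].

(* the transform on L^2(m_alpha); the default value is never used, since an
   extension exists by the Plancherel theorem *)
Definition LB_transform : (R * R -> R[i]) -> R * nat -> R[i] :=
  xget (fun _ _ => 0) is_LB_extension.

End laguerre_bessel.

(* Main.v *)
(* The inequality follows from a Plancherel estimate and from the concentration of the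
   transform. Gaussians exp(-c x^2 - d t^2) have explicit transforms, and the negative
   binomial series shows that on their linear span F_LB is a multiple of an isometry.
   The span being dense in L^1 /\ L^2 for both norms at once, the L^2 norms of f and of
   its transform are comparable, and the extension to L^2 exists by Riesz-Fischer.
   On {(2(2m+alpha+1) lambda) <= rho^2} x {|(x,t)| <= r} with rho r <= 1 the kernel is
   bounded, so by Cauchy-Schwarz the part of f in the ball contributes to the low
   frequencies at most C (rho r)^(6 alpha + 4) ||f||^2, which is absorbed if rho r is a
   small constant. The other parts are controlled by the weights, so that
   ||f||^2 <= C (r^(-2a) || |(x,t)|^a f ||^2 + r^(4b) || (2(2m+alpha+1) lambda)^b F f ||^2)
   for all r > 0, and it remains to optimise in r. *)

(* Squared norms are compared only up to constants. Factors such as 4, 16 and 64 in front of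
   [plancherel_const] record how often (u + v)^2 <= 2 (u^2 + v^2) replaces the triangle inequality.
   Approximation must hold in L^1 and L^2 simultaneously: for each fixed frequency the kernel is
   bounded, so L^1 convergence gives pointwise convergence of the transforms, while L^2 convergence
   feeds the exact formula for Gaussian sums; Fatou's lemma joins the two. [LB_transform] is a
   chosen extension, known only through its continuity and its almost everywhere values on L^1 /\
   L^2; truncations to balls transfer the estimates to it. A kernel bound independent of the degree
   m is proved only for low frequencies paired with a ball, which dictates the absorption argument.
   Since 0 times infinity is 0 in the extended reals, the case of a vanishing weighted norm is
   settled separately, by showing that f vanishes almost everywhere. *)
From HB Require Import structures.
Require Import Defs.
From mathcomp Require Import all_boot all_order all_algebra.
From mathcomp Require Import complex ring lra.
From mathcomp Require Import all_classical all_reals all_analysis measurable_realfun.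
Import Order.TTheory GRing.Theory Num.Theory.
Import numFieldNormedType.Exports.
Import HBSimple HBNNSimple.

Set Implicit Arguments.
Unset Strict Implicit.
Unset Printing Implicit Defensive.

Local Open Scope classical_set_scope.
Local Open Scope ring_scope.

(** * Integration with respect to weighted measures *)

Section integral_mweighted.
Local Open Scope ereal_scope.
Context d (T : measurableType d) (R : realType).
Variables (mu : {measure set T -> \bar R}) (w : T -> R).
Hypotheses (w0 : forall x, (0 <= w x)%R) (mw : measurable_fun [set: T] w).
Let nu : {measure set T -> \bar R} := mweighted mu w0 mw.

Let mwE : measurable_fun [set: T] (EFin \o w).
Proof. exact/measurable_EFinP. Qed.

Lemma integral_mweighted_indic (E : set T) : measurable E ->
  \int[nu]_x (\1_E x)%:E = \int[mu]_x ((\1_E x)%:E * (w x)%:E).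
Proof.
move=> mE; rewrite integral_indic// setIT /nu /mweighted /=.
rewrite [LHS]integral_mkcond; apply: eq_integral => x _.
rewrite patchE indicE; case: ifPn => xE; first by rewrite mul1e.
by rewrite mul0e.
Qed.

Lemma integral_mweighted_nnsfun (f : {nnsfun T >-> R}) :
  \int[nu]_x (f x)%:E = \int[mu]_x ((f x)%:E * (w x)%:E).
Proof.
under eq_integral => x _ do rewrite fimfunE -fsumEFin//.
under [RHS]eq_integral => x _ do rewrite fimfunE -fsumEFin//.
rewrite ge0_integral_fsum//; last 2 first.
- move=> r; exact/measurable_EFinP/measurableT_comp.
- by move=> r x _; rewrite EFinM nnfun_muleindic_ge0.
under [RHS]eq_integral.
  move=> x _; rewrite ge0_mule_fsuml; last first.
    by move=> r; rewrite EFinM nnfun_muleindic_ge0.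
  over.
rewrite ge0_integral_fsum//; last 2 first.
- move=> r; apply: emeasurable_funM => //.
  exact/measurable_EFinP/measurableT_comp.
- move=> r x _; apply: mule_ge0; last by rewrite lee_fin.
  by rewrite EFinM nnfun_muleindic_ge0.
apply: eq_fsbigr => r _.
have mr : measurable (f @^-1` [set r]) by [].
under eq_integral do rewrite EFinM.
rewrite (integralZl_indic_nnsfun nu)// integral_mweighted_indic//.
under [RHS]eq_integral do rewrite EFinM -muleA.
(* A negative r is not a value of the nonnegative f: the fibre is empty and both sides vanish. *)
have [r0|r0] := leP 0%R r.
  rewrite ge0_integralZl//.
  - by apply: emeasurable_funM => //; exact/measurable_EFinP.
  - by move=> x _; rewrite mule_ge0 ?lee_fin.
rewrite preimage_nnfun0//.
rewrite (_ : (fun x => _) = cst 0) ?integral0 ?mule0; last first.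
  by apply/funext => x; rewrite indicE in_set0 mul0e.
under eq_integral do rewrite indicE in_set0 mul0e mule0.
by rewrite integral0.
Qed.

(** Monotone convergence on both sides: multiplying by the finite nonnegative weight preserves the
    monotone approximation by simple functions. *)
Lemma ge0_integral_mweighted (f : T -> \bar R) :
  measurable_fun [set: T] f -> (forall x, 0 <= f x) ->
  \int[nu]_x f x = \int[mu]_x (f x * (w x)%:E).
Proof.
move=> mf f0.
pose g := nnsfun_approx measurableT mf.
have gf x : EFin \o g^~ x @ \oo --> f x by exact: cvg_nnsfun_approx.
transitivity (limn (fun n => \int[nu]_x (g n x)%:E)).
  rewrite -monotone_convergence//=; last 3 first.
  - by move=> n; exact/measurable_EFinP.
  - by move=> n x _; rewrite lee_fin.
  - by move=> x _ a b ab; rewrite lee_fin; exact/lefP/nd_nnsfun_approx.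
  by apply: eq_integral => x _; apply/esym/cvg_lim => //; exact: gf.
under eq_fun do rewrite integral_mweighted_nnsfun.
rewrite -monotone_convergence//=; last 3 first.
- by move=> n; apply: emeasurable_funM => //; exact/measurable_EFinP.
- by move=> n x _; rewrite mule_ge0 ?lee_fin.
- move=> x _ a b ab; rewrite lee_wpmul2r ?lee_fin//.
  exact/lefP/nd_nnsfun_approx.
apply: eq_integral => x _; apply/cvg_lim => //.
apply: cvgeZr => //; exact: gf.
Qed.

(** Multiplication by a nonnegative weight commutes with taking positive and negative parts. *)
Lemma integral_mweighted (f : T -> \bar R) : measurable_fun [set: T] f ->
  \int[nu]_x f x = \int[mu]_x (f x * (w x)%:E).
Proof.
move=> mf; rewrite [LHS]integralE [RHS]integralE.
rewrite !ge0_integral_mweighted//.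
- congr (_ - _); apply: eq_integral => x _.
  + by rewrite !funeposE maxe_pMl ?lee_fin// mul0e.
  + by rewrite !funenegE -mulNe maxe_pMl ?lee_fin// mul0e.
- exact: measurable_funeneg.
- exact: measurable_funepos.
Qed.

End integral_mweighted.

(** * Squared L^2 norms *)

Section L2.
Local Open Scope ereal_scope.
Context d (T : measurableType d) (R : realType).
Variable mu : {measure set T -> \bar R}.
Implicit Types f g h : T -> R.

(** Squared norms of real functions are used up to the final theorem: they add over real and
    imaginary parts and avoid square roots of extended reals. *)
Definition sqint f : \bar R := \int[mu]_x ((f x) ^+ 2)%:E.

Lemma sqint_ge0 f : 0 <= sqint f.
Proof. by apply: integral_ge0 => x _; rewrite lee_fin sqr_ge0. Qed.

Lemma measurable_sqr f : measurable_fun [set: T] f ->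
  measurable_fun [set: T] (fun x => ((f x) ^+ 2)%:E).
Proof. by move=> mf; exact/measurable_EFinP/measurable_funX. Qed.

Lemma le_sqint f g : measurable_fun [set: T] f -> measurable_fun [set: T] g ->
  (forall x, `|f x| <= `|g x|)%R -> sqint f <= sqint g.
Proof.
move=> mf mg fg; apply: ge0_le_integral => //.
- by move=> x _; rewrite lee_fin sqr_ge0.
- exact: measurable_sqr.
- exact: measurable_sqr.
- move=> x _; rewrite lee_fin -[leLHS]real_normK ?num_real//.
  by rewrite -[leRHS]real_normK ?num_real// lerXn2r// nnegrE.
Qed.

Lemma sqint_scale (c : R) f : measurable_fun [set: T] f ->
  sqint (fun x => c * f x)%R = (c ^+ 2)%:E * sqint f.
Proof.
move=> mf; rewrite -ge0_integralZl//; last 3 first.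
- exact: measurable_sqr.
- by move=> x _; rewrite lee_fin sqr_ge0.
- by rewrite lee_fin sqr_ge0.
by apply: eq_integral => x _; rewrite -EFinM exprMn.
Qed.

(** The substitute for the triangle inequality, from (u + v)^2 <= 2 (u^2 + v^2). The pointwise
    hypothesis on h covers sums, differences and cut-offs alike. *)
Lemma le_sqintD f g h : measurable_fun [set: T] f -> measurable_fun [set: T] g ->
  measurable_fun [set: T] h ->
  (forall x, `|h x| <= `|f x| + `|g x|)%R ->
  sqint h <= 2%:E * (sqint f + sqint g).
Proof.
move=> mf mg mh hfg.
rewrite -ge0_integralD//; last 4 first.
- by move=> x _; rewrite lee_fin sqr_ge0.
- exact: measurable_sqr.
- by move=> x _; rewrite lee_fin sqr_ge0.
- exact: measurable_sqr.
rewrite -ge0_integralZl//; last 2 first.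
- by apply: emeasurable_funD; exact: measurable_sqr.
- by move=> x _; rewrite adde_ge0 ?lee_fin ?sqr_ge0.
apply: ge0_le_integral => //.
- by move=> x _; rewrite lee_fin sqr_ge0.
- exact: measurable_sqr.
- apply: measurable_funeM; apply: emeasurable_funD; exact: measurable_sqr.
move=> x _; rewrite -EFinD -EFinM lee_fin -[leLHS]real_normK ?num_real//.
apply: (@le_trans _ _ ((`|f x| + `|g x|) ^+ 2)%R).
  by rewrite lerXn2r// nnegrE addr_ge0.
rewrite -[in leRHS](real_normK (num_real (f x))) -[in leRHS](real_normK (num_real (g x))).
set u := `|f x|%R; set v := `|g x|%R.
rewrite -subr_ge0 (_ : _ - _ = (u - v) ^+ 2)%R; last by ring.
exact: sqr_ge0.
Qed.

Lemma sqint_distC f g : sqint (fun x => f x - g x)%R = sqint (fun x => g x - f x)%R.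
Proof. by apply: eq_integral => x _; rewrite -sqrrN opprB. Qed.

Lemma le_sqint_dist f g h : measurable_fun [set: T] f -> measurable_fun [set: T] g ->
  measurable_fun [set: T] h ->
  sqint (fun x => f x - h x)%R <=
  2%:E * (sqint (fun x => f x - g x)%R + sqint (fun x => g x - h x)%R).
Proof.
move=> mf mg mh; apply: le_sqintD; do ? exact: measurable_funB.
by move=> x; rewrite (_ : f x - h x = (f x - g x) + (g x - h x))%R ?ler_normD//; ring.
Qed.

Lemma sqint_eq0 f : measurable_fun [set: T] f -> sqint f = 0 ->
  {ae mu, forall x, f x = 0%R}.
Proof.
move=> mf f0.
have := ae_eq_integral_abs mu measurableT (measurable_sqr mf).
move=> /iffLR H.
have : ae_eq mu [set: T] (fun x => ((f x) ^+ 2)%:E) (cst 0).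
  apply: H; rewrite -[RHS]f0; apply: eq_integral => x _.
  by rewrite gee0_abs// lee_fin sqr_ge0.
apply: filterS => x /(_ Logic.I) /= [] /eqP.
by rewrite sqrf_eq0 => /eqP.
Qed.

Lemma ae_eq_sqint f g : measurable_fun [set: T] f -> measurable_fun [set: T] g ->
  {ae mu, forall x, f x = g x} -> sqint f = sqint g.
Proof.
move=> mf mg fg; apply: ge0_ae_eq_integral => //.
- exact: measurable_sqr.
- exact: measurable_sqr.
- by move=> x _; rewrite lee_fin sqr_ge0.
- by move=> x _; rewrite lee_fin sqr_ge0.
- by apply: filterS fg => x -> _.
Qed.

(** Fatou's lemma for the squares, whose lower limit is almost everywhere the square of the
    limit. *)
Lemma sqint_fatou (F : nat -> T -> R) f (c : \bar R) :
  (forall n, measurable_fun [set: T] (F n)) -> measurable_fun [set: T] f ->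
  {ae mu, forall x, F n x @[n --> \oo] --> f x} ->
  (\forall n \near \oo, sqint (F n) <= c) -> sqint f <= c.
Proof.
move=> mF mf Ff Fc.
have H := @fatou _ _ _ mu _ measurableT (fun n x => (F n x ^+ 2)%:E)
  (fun n => measurable_sqr (mF n))
  (fun n x _ => ltac:(by rewrite lee_fin sqr_ge0)).
apply: (@le_trans _ _ (\int[mu]_x limn_einf (fun n => (F n x ^+ 2)%:E))).
  rewrite le_eqVlt; apply/orP; left; apply/eqP.
  apply: ae_eq_integral => //.
  - exact: measurable_sqr.
  - rewrite [X in measurable_fun _ X](_ : _ =
        (fun x => - limn_esup (-%E \o (fun n => (F n x ^+ 2)%:E)))); last first.
      by apply/funext => x; rewrite limn_esupN oppeK.
    apply: measurableT_comp => //; apply: measurable_fun_limn_esup => // n.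
    by apply: measurableT_comp => //; exact: measurable_sqr.
  apply: filterS Ff => x Fx _ /=.
  have : (F n x ^+ 2)%:E @[n --> \oo] --> (f x ^+ 2)%:E.
    by apply: cvg_EFin; [exact: nearW|apply: cvgM].
  by move=> h; rewrite is_cvg_limn_einfE; [exact/esym/cvg_lim|apply/cvg_ex; eexists; exact: h].
apply: (le_trans H).
apply: (@le_trans _ _ (limn_einf (fun=> c))).
  rewrite !limn_einf_lim; apply: lee_lim; [exact: is_cvg_einfs|exact: is_cvg_einfs|].
  case: Fc => N _ FN; exists N => // n /= Nn.
  apply: le_ereal_inf_tmp => _ [k /= nk <-].
  apply: ereal_inf_le; exists (sqint (F k)); last by apply: FN => /=; exact: leq_trans nk.
  by exists k.
rewrite is_cvg_limn_einfE; last exact: is_cvg_cst.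
by rewrite lim_cst.
Qed.

End L2.

(** * Termwise integration of series *)

Section integral_series.
Context d (T : measurableType d) (R : realType).
Variables (mu : {measure set T -> \bar R}) (D : set T).
Hypothesis mD : measurable D.

(** The sum of the absolute values is integrable by monotone convergence and dominates all partial
    sums, so dominated convergence applies. *)
Lemma integral_series_cvg (f : nat -> T -> R) (F : T -> R) :
  (forall n, measurable_fun D (f n)) ->
  (\sum_(0 <= k <oo) \int[mu]_(x in D) `|(f k x)%:E| < +oo)%E ->
  (forall x, D x -> series (f^~ x) n @[n --> \oo] --> F x) ->
  mu.-integrable D (EFin \o F) /\
  series (fun k => \int[mu]_(x in D) f k x) @ \oo --> \int[mu]_(x in D) F x.
Proof.
move=> mf fy fF.
have mabs n : measurable_fun D (fun x => `|(f n x)%:E|%E).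
  exact/measurableT_comp/measurable_EFinP.
pose g x := (\sum_(0 <= k <oo) `|(f k x)%:E|)%E.
have intg : (\int[mu]_(x in D) g x)%E =
    (\sum_(0 <= k <oo) \int[mu]_(x in D) `|(f k x)%:E|)%E.
  by apply: integral_nneseries.
have g0 x : (0 <= g x)%E by apply: nneseries_ge0.
have mg : measurable_fun D g by apply: ge0_emeasurable_sum.
have ig : mu.-integrable D g.
  apply/integrableP; split => //.
  under eq_integral do rewrite gee0_abs//.
  by rewrite intg.
have mS n : measurable_fun D (fun x => (series (f^~ x) n)%:E).
  by apply/measurable_EFinP; apply: measurable_sum => k; exact: mf.
have cS x : D x -> (series (f^~ x) n)%:E @[n --> \oo] --> (F x)%:E.
  by move=> Dx; apply: cvg_EFin; [exact: nearW|exact: fF].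
have mF : measurable_fun D (EFin \o F).
  by apply: (emeasurable_fun_cvg (fun n x => (series (f^~ x) n)%:E)).
have fg n x : (`|(f n x)%:E| <= g x)%E.
  apply: (@le_trans _ _ (\sum_(0 <= k < n.+1) `|(f k x)%:E|)%E).
    by rewrite big_nat_recr//= leeDr// sume_ge0.
  exact: nneseries_lim_ge.
have intf n : mu.-integrable D (EFin \o f n).
  apply: (le_integrable mD _ _ ig); first exact/measurable_EFinP.
  by move=> x _ /=; rewrite (gee0_abs (g0 x)); exact: fg.
have leS x n : (`|(series (f^~ x) n)%:E| <= g x)%E.
  apply: (@le_trans _ _ (\sum_(0 <= k < n) `|(f k x)%:E|)%E).
    by rewrite -[(series _ _)%:E]sumEFin; exact: lee_abs_sum.
  exact: nneseries_lim_ge.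
have [iF _ cF] := dominated_convergence mD mS mF (aeW _ cS) ig
  (aeW _ (fun x n _ => leS x n)).
split => //.
have Fe : (\int[mu]_(x in D) (EFin \o F) x)%E = (\int[mu]_(x in D) F x)%:E.
  by rewrite /Rintegral fineK//; exact: integrable_fin_num.
rewrite Fe in cF; move/fine_cvg : cF.
set v := (X in X @ \oo --> _ -> _).
rewrite (_ : series _ = v)//; apply/funext => n.
rewrite /v /=; apply/esym; rewrite /series/=.
under eq_integral do rewrite -sumEFin.
rewrite integral_sum// -sum_fine// => i _.
exact: (integrable_fin_num mD (intf i)).
Qed.

End integral_series.

(** * Almost everywhere limits of fast Cauchy sequences in L^2 *)

Section riesz_fischer.
Context d (T : measurableType d) (R : realType).
Variable mu : {measure set T -> \bar R}.

Lemma cvg_weighted_sqr_series (u : R^nat) :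
  cvgn (series (fun n => 2 ^+ n * (u n) ^+ 2)) -> cvgn (series u).
Proof.
move=> cu; apply: normed_cvg.
have cg : cvgn (series (fun n => (2^-1) ^+ n : R)).
  have := @is_cvg_geometric_series R 1 (2^-1).
  rewrite ger0_norm// => /(_ ltac:(by rewrite invf_lt1// ltr1n)).
  by congr (cvgn (series _)); apply/funext => n; rewrite /geometric/= mul1r.
apply: (@series_le_cvg _ _ (fun n => 2 ^+ n * (u n) ^+ 2 + (2^-1) ^+ n)).
- by move=> n; exact: normr_ge0.
- by move=> n /=; rewrite addr_ge0 ?exprn_ge0// mulr_ge0 ?sqr_ge0 ?exprn_ge0.
- move=> n /=; rewrite -[(u n) ^+ 2]real_normK ?num_real//.
  set v := `|u n|.
  have v0 : 0 <= v := normr_ge0 _.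
  have p0 : 0 < 2 ^+ n :> R by rewrite exprn_gt0.
  rewrite exprVn.
  rewrite -(ler_pM2l p0) mulrDr mulfV ?gt_eqF//.
  set q := (2 ^+ n : R).
  (* With q = 2^n this gives q v <= (q v)^2 + 1, that is v <= 2^n v^2 + 2^-n. *)
  have := sqr_ge0 (q * v - 2^-1).
  have : 0 <= q * v by rewrite mulr_ge0// ltW.
  by nra.
- rewrite (_ : series _ = series (fun n => 2 ^+ n * (u n) ^+ 2) + series (fun n => (2^-1) ^+ n)).
    exact: is_cvgD.
  by apply/funext => n; rewrite /series/= fctE -big_split.
Qed.

(** With increments of squared norm at most 8^-n, the integral of the sum of 2^n (F_(n+1) - F_n)^2
    is at most the sum of 4^-n. The weighted sum is thus finite almost everywhere, and there the
    telescoping series converges absolutely. *)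
Lemma riesz_fischer (F : nat -> T -> R) :
  (forall n, measurable_fun [set: T] (F n)) ->
  (forall n, sqint mu (fun x => F n.+1 x - F n x)%R <= ((8^-1) ^+ n)%:E)%E ->
  exists2 G : T -> R, measurable_fun [set: T] G &
    {ae mu, forall x, F n x @[n --> \oo] --> G x}.
Proof.
move=> mF dF.
pose h x := (\sum_(0 <= n <oo) (2 ^+ n * (F n.+1 x - F n x) ^+ 2)%:E)%E.
have mh n : measurable_fun [set: T] (fun x => (2 ^+ n * (F n.+1 x - F n x) ^+ 2)%:E).
  apply/measurable_EFinP; apply: measurable_funM => //.
  by apply: measurable_funX; exact: measurable_funB.
have ih : mu.-integrable [set: T] h.
  apply/integrableP; split.
    apply: ge0_emeasurable_sum => [n x _ _|n _]; last exact: mh.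
    by rewrite lee_fin mulr_ge0 ?sqr_ge0 ?exprn_ge0.
  under eq_integral => x _.
    rewrite gee0_abs; last by apply: nneseries_ge0 => n _ _; rewrite lee_fin mulr_ge0 ?sqr_ge0 ?exprn_ge0.
    over.
  rewrite integral_nneseries//; last by move=> n x _; rewrite lee_fin mulr_ge0 ?sqr_ge0 ?exprn_ge0.
  apply: (@le_lt_trans _ _ (\sum_(0 <= n <oo) ((4^-1) ^+ n)%:E)%E).
    apply: lee_nneseries => n _ => [_|].
      by apply: integral_ge0 => x _; rewrite lee_fin mulr_ge0 ?sqr_ge0 ?exprn_ge0.
    under eq_integral do rewrite EFinM.
    rewrite ge0_integralZl; [|exact: measurableT| |by move=> x _; rewrite lee_fin sqr_ge0
      |by rewrite lee_fin exprn_ge0]; last first.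
      by apply: measurable_sqr; exact: measurable_funB.
    rewrite (_ : 4^-1 = 2 * 8^-1 :> R); last by field.
    rewrite exprMn EFinM lee_wpmul2l ?lee_fin ?exprn_ge0//.
    exact: dF.
  have := @cvg_geometric_series R 1 (4^-1).
  rewrite ger0_norm// => /(_ ltac:(by rewrite invf_lt1// ltr1n)) cg.
  have -> : (\sum_(0 <= n <oo) ((4^-1) ^+ n)%:E)%E = (1 / (1 - 4^-1) : R)%:E.
    apply/cvg_lim => //.
    rewrite (_ : (fun n => _) = EFin \o series (geometric 1 (4^-1))).
      by apply: cvg_EFin => //; exact: nearW.
    apply/funext => n /=; rewrite /series/= sumEFin; congr EFin.
    by apply: eq_bigr => i _; rewrite mul1r.
  by rewrite ltry.
have aeF : {ae mu, forall x, cvgn (F^~ x)}.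
  have := integrable_ae measurableT ih.
  apply: filterS => x /(_ Logic.I) hx.
  have cs : cvgn (series (fun n => F n.+1 x - F n x)).
    apply: cvg_weighted_sqr_series.
    apply: nondecreasing_is_cvgn.
      apply/nondecreasing_seqP => n; rewrite /series/= big_nat_recr//= lerDl.
      by rewrite mulr_ge0 ?sqr_ge0 ?exprn_ge0.
    exists (fine (h x)) => _ [n _ <-].
    rewrite -lee_fin fineK// /series/= -sumEFin.
    by apply: nneseries_lim_ge => i _ _; rewrite lee_fin mulr_ge0 ?sqr_ge0 ?exprn_ge0.
  rewrite (_ : F^~ x = (fun n => F 0%N x + series (fun n => F n.+1 x - F n x) n)).
    by apply: is_cvgD => //; exact: is_cvg_cst.
  by apply/funext => n; rewrite /series/= telescope_sumr// addrC subrK.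
(* The upper limit is measurable and defined everywhere; [fine] sends its infinite values, which
   occur on a null set, to 0. *)
exists (fun x => fine (limn_esup (fun n => (F n x)%:E))).
  apply: measurableT_comp => //; apply: measurable_fun_limn_esup => // n.
  exact/measurable_EFinP.
apply: filterS aeF => x /cvg_ex[l Fl].
rewrite is_cvg_limn_esupE; last first.
  by apply/cvg_ex; exists l%:E; apply: cvg_EFin => //; exact: nearW.
rewrite (_ : limn _ = l%:E)//.
by apply/cvg_lim => //; apply: cvg_EFin => //; exact: nearW.
Qed.

End riesz_fischer.

(** * The Gamma function *)

Section positive_half_line.
Context {R : realType}.
Notation leb := (@lebesgue_measure R).
Implicit Types (f F : R -> R) (a b : R).

Lemma within_continuous_itv_pos f a b : 0 < a ->
  (forall x, 0 < x -> {for x, continuous f}) -> {within `[a, b], continuous f}.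
Proof.
move=> a0 cf; apply: continuous_in_subspaceT => x; rewrite inE/= in_itv/= => /andP[ax _].
by apply: cf; exact: lt_le_trans ax.
Qed.

Lemma derivable_oo_LRcontinuous_pos f a b : 0 < a -> a < b ->
  (forall x, 0 < x -> derivable f x 1) -> derivable_oo_LRcontinuous f a b.
Proof.
move=> a0 ab df.
have cf x : 0 < x -> {for x, continuous f}.
  by move=> x0; apply: differentiable_continuous; apply/derivable1_diffP; exact: df.
split.
- by move=> x; rewrite in_itv/= => /andP[ax _]; apply: df; exact: lt_trans ax.
- by apply: cvg_at_right_filter; exact: cf.
- by apply: cvg_at_left_filter; apply: cf; exact: lt_trans ab.
Qed.

Lemma continuous_powR_pos (r x : R) : 0 < x -> {for x, continuous (fun u => u `^ r)}.
Proof.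
move=> x0; apply: differentiable_continuous; apply/derivable1_diffP.
by apply: derivable_powR; rewrite in_itv/= x0.
Qed.

Lemma is_derive_powR (r x : R) : 0 < x ->
  is_derive x 1 (fun u => u `^ r) (r * x `^ (r - 1)).
Proof.
move=> x0; have x0' : x \in `]0, +oo[ by rewrite in_itv/= x0.
by split; [exact: derivable_powR|rewrite -derive1E powR_derive1].
Qed.

Lemma is_derive_expRN (x : R) : is_derive x 1 (fun u => expR (- u)) (- expR (- x)).
Proof.
by apply: is_derive_eq; rewrite mulrN1 /=.
Qed.

Lemma continuous_expRN (x : R) : {for x, continuous (fun u : R => expR (- u))}.
Proof.
apply: differentiable_continuous; apply/derivable1_diffP.
exact: (@ex_derive _ _ _ _ _ _ _ (is_derive_expRN x)).
Qed.

Lemma bigcup_itv_pos (a b : R^nat) : (forall n, 0 < a n) ->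
  a n @[n --> \oo] --> 0 -> b n @[n --> \oo] --> +oo ->
  \bigcup_n `[a n, b n]%classic = `]0, +oo[%classic.
Proof.
move=> a0 ca cb; apply/seteqP; split => x /=.
  by move=> [n _]; rewrite /= !in_itv/= andbT => /andP[ax _]; exact: lt_le_trans ax.
rewrite in_itv/= andbT => x0.
have [N _ /(_ N (leqnn N)) aN] : \forall n \near \oo, a n <= x <= b n.
  near=> n; apply/andP; split; near: n.
    move/cvgrPdist_le : ca => /(_ x x0); apply: filterS => n.
    by rewrite sub0r normrN gtr0_norm.
  by move/cvgryPge : cb; exact.
by exists N => //=; rewrite in_itv.
Unshelve. all: by end_near. Qed.

(** The integrand x^(s-1) exp(-x) may be singular at 0, so integration by parts and substitution are
    done on compact intervals inside ]0, +oo[ and passed to the limit by monotone convergence. *)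
Lemma cvg_integral_itv_pos f (a b : R^nat) : (forall n, 0 < a n) ->
  nonincreasing_seq a -> nondecreasing_seq b ->
  a n @[n --> \oo] --> 0 -> b n @[n --> \oo] --> +oo ->
  measurable_fun `](0:R), +oo[ f -> (forall x, 0 < x -> 0 <= f x) ->
  (\int[leb]_(x in `[a n, b n]) (f x)%:E @[n --> \oo] -->
   \int[leb]_(x in `]0%R, +oo[) (f x)%:E)%E.
Proof.
move=> a0 na nb ca cb mf f0.
have sub n : `[a n, b n]%classic `<=` `]0, +oo[%classic.
  by move=> x /=; rewrite !in_itv/= andbT => /andP[ax _]; exact: lt_le_trans ax.
rewrite -(@bigcup_itv_pos a b)//.
apply: ge0_nondecreasing_set_cvg_integral => //.
- move=> m n mn; apply/subsetPset => x /=; rewrite !in_itv/= => /andP[ax xb].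
  by rewrite (le_trans (na _ _ mn))//= (le_trans xb)//; exact: nb.
- move=> n; apply/measurable_EFinP; apply: measurable_funS mf => //.
- by move=> n x /sub; rewrite /= in_itv/= andbT lee_fin; exact: f0.
Qed.

End positive_half_line.

Section Gamma_function.
Context {R : realType}.
Notation leb := (@lebesgue_measure R).
Implicit Types s p x : R.

Let g s x : R := x `^ (s - 1) * expR (- x).

Let g_ge0 s x : 0 <= g s x.
Proof. by rewrite mulr_ge0 ?powR_ge0 ?expR_ge0. Qed.

Let mg s : measurable_fun [set: R] (g s).
Proof.
apply: measurable_funM; first exact: measurable_powR.
by apply: measurableT_comp => //.
Qed.

Let cg s x : 0 < x -> {for x, continuous (g s)}.
Proof. by move=> x0; apply: continuousM; [exact: continuous_powR_pos|exact: continuous_expRN]. Qed.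

Let an (n : nat) : R := n.+1%:R^-1.
Let bn (n : nat) : R := n.+1%:R.

(** Half of the exponential absorbs the power: x^s is at most 1 for x <= 1, and at most x^(k+1) <=
    2^(k+1) (k+1)! exp(x/2) for x > 1, with k an integer above s. *)
Lemma powR_expRN_bound s : 0 <= s -> exists2 C : R, 0 < C &
  forall x, 0 < x -> x `^ s * expR (- x) <= C * expR (- (x / 2)).
Proof.
move=> s0; have [k sk] : exists k : nat, s <= k%:R.
  by exists (Num.Def.archi_bound s); rewrite ltW// archi_boundP.
pose C : R := 1 + 2 ^+ k.+1 * k.+1`!%:R.
have C1 : 1 <= C by rewrite lerDl mulr_ge0// exprn_ge0.
exists C; first exact: lt_le_trans C1.
move=> x x0; rewrite [X in expR (- X)](splitr x) opprD expRD mulrA.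
apply: ler_wpM2r; first exact: expR_ge0.
rewrite expRN ler_pdivrMr ?expR_gt0//.
have [x1|x1] := leP x 1.
  apply: (@le_trans _ _ 1); first by rewrite -[leRHS](congr1 (fun f => f s) (@powR1 R)) ge0_ler_powR// nnegrE ltW.
  by rewrite -[leLHS]mulr1 ler_pM// -expR0 ler_expR divr_ge0// ltW.
apply: (@le_trans _ _ (x ^+ k.+1)).
  rewrite -powR_mulrn ?(ltW x0)//; apply: ler_powR; first exact: ltW.
  by rewrite (le_trans sk)// ler_nat.
have := @expR_ge1Dxn R (x / 2) k (divr_ge0 (ltW x0) (ler0n _ 2)).
rewrite expr_div_n => H.
have {}H : x ^+ k.+1 / 2 ^+ k.+1 / k.+1`!%:R <= expR (x / 2).
  by apply: le_trans H; rewrite lerDr.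
rewrite !ler_pdivrMr ?exprn_gt0 ?ltr0n ?fact_gt0// in H.
apply: (le_trans H); rewrite -mulrA [leRHS]mulrC ler_wpM2l ?expR_ge0//.
by rewrite mulrC lerDr.
Qed.

Let an_gt0 n : 0 < an n. Proof. by rewrite invr_gt0. Qed.
Let an_ni : nonincreasing_seq an.
Proof. by move=> m n mn; rewrite /an lef_pV2 ?posrE// ler_nat. Qed.
Let bn_nd : nondecreasing_seq bn.
Proof. by move=> m n mn; rewrite /bn ler_nat. Qed.
Let an0 : an n @[n --> \oo] --> 0.
Proof. exact: cvg_harmonic. Qed.
Let bny : bn n @[n --> \oo] --> +oo.
Proof. by rewrite /bn (cvg_shiftS (fun n => n%:R : R)); exact: cvgr_idn. Qed.

Let cvg_g s : (\int[leb]_(x in `[an n, bn n]) (g s x)%:E @[n --> \oo] -->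
   \int[leb]_(x in `]0%R, +oo[) (g s x)%:E)%E.
Proof.
by apply: cvg_integral_itv_pos => //; exact: measurable_funTS.
Qed.

Let ig s n : leb.-integrable `[an n, bn n] (EFin \o g s).
Proof.
apply: continuous_compact_integrable; first exact: segment_compact.
by apply: within_continuous_itv_pos => // x; exact: cg.
Qed.

(** Integration by parts, as the fundamental theorem of calculus for x^s exp(-x). The index is
    shifted because for n = 0 the interval reduces to the point 1. *)
Lemma integral_g_recurrence s n :
  s * \int[leb]_(x in `[an n.+1, bn n.+1]) g s x =
  \int[leb]_(x in `[an n.+1, bn n.+1]) g (s + 1) x +
  (bn n.+1 `^ s * expR (- bn n.+1) - an n.+1 `^ s * expR (- an n.+1)).
Proof.
pose f x := s * g s x - g (s + 1) x.
pose F x : R := x `^ s * expR (- x).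
have ab : an n.+1 < bn n.+1.
  rewrite (@lt_trans _ _ 1)//; first by rewrite invf_lt1// ltr1n.
  by rewrite /bn ltr1n.
have dF x : 0 < x -> is_derive x 1 F (f x).
  move=> x0.
  have := is_deriveM (is_derive_powR s x0) (is_derive_expRN x).
  move=> H; apply: (is_derive_eq H); rewrite /f /g addrK.
  by rewrite /GRing.scale/=; ring.
have dF' x : 0 < x -> derivable F x 1.
  by move=> x0; exact: (@ex_derive _ _ _ _ _ _ _ (dF x x0)).
have cf x : 0 < x -> {for x, continuous f}.
  move=> x0; apply: (@continuousB _ _ _ (fun x => s * g s x)).
    by apply: continuousM; [exact: cst_continuous|exact: cg].
  exact: cg.
have H := @continuous_FTC2 R f F _ _ ab (within_continuous_itv_pos (an_gt0 _) cf)
  (derivable_oo_LRcontinuous_pos (an_gt0 _) ab dF').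
have {H} := H (fun x => ltac:(rewrite in_itv/= => /andP[ax _];
  rewrite derive1E (@derive_val _ _ _ _ _ _ _ (dF x (lt_trans (an_gt0 _) ax))))).
move=> H.
have : \int[leb]_(x in `[an n.+1, bn n.+1]) f x = F (bn n.+1) - F (an n.+1).
  by rewrite /Rintegral H.
have isg : leb.-integrable `[an n.+1, bn n.+1] (EFin \o (fun x => s * g s x)).
  rewrite (_ : _ \o _ = (fun x => s%:E * (EFin \o g s) x)%E)//.
  by apply: integrableZl => //; exact: ig.
rewrite /f RintegralB; [|exact: measurable_itv|exact: isg|exact: ig].
rewrite RintegralZl; [|exact: measurable_itv|exact: ig].
by move=> <-; rewrite addrC subrK.
Qed.

(** The recurrence removes the singularity at 0: the integrand for s + 1 is bounded by C exp(-x/2),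
    of integral 2 C, and the boundary terms contribute at most C. *)
Lemma integral_g_lty s : 0 < s -> (\int[leb]_(x in `]0%R, +oo[) (g s x)%:E < +oo)%E.
Proof.
move=> s0; have [C C0 gC] := powR_expRN_bound (ltW s0).
have fin1 : (\int[leb]_(x in `]0%R, +oo[) (g (s + 1) x)%:E <= (2 * C)%:E)%E.
  have H : (\int[leb]_(x in `[0%R, +oo[) (C * expR (- (x / 2)))%:E = (2 * C)%:E)%E.
    pose F (u : R) : R := - (2 * C) * expR (- (u / 2)).
    have F0 : F 0 = - (2 * C) by rewrite /F mul0r oppr0 expR0 mulr1.
    have d x : is_derive x 1 F (C * expR (- (x / 2))).
      by apply: is_derive_eq; rewrite /GRing.scale/=; field.
    rewrite [RHS](_ : _ = 0%:E - (F 0)%:E)%E; last by rewrite F0 -EFinB sub0r opprK.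
    apply: ge0_continuous_FTC2y.
    - by move=> x _; rewrite mulr_ge0 ?expR_ge0// ltW.
    - apply: continuous_subspaceT => x.
      apply: differentiable_continuous; apply/derivable1_diffP.
      exact: ex_derive.
    - rewrite -[X in _ --> X](mulr0 (- (2 * C))); apply: cvgM; first exact: cvg_cst.
      apply: (cvg_comp (fun x => x / 2) (fun x => expR (- x))); last exact: cvgr_expR.
      apply/cvgryPge => A; apply: filterS (nbhs_pinfty_ge (num_real (A * 2))) => x.
      by rewrite ler_pdivlMr.
    - by move=> x _; exact: (@ex_derive _ _ _ _ _ _ _ (d x)).
    - apply: cvg_at_right_filter.
      apply: differentiable_continuous; apply/derivable1_diffP.
      exact: (@ex_derive _ _ _ _ _ _ _ (d 0)).
    - by move=> x _; rewrite derive1E (@derive_val _ _ _ _ _ _ _ (d x)).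
  have mC : measurable_fun [set: R] (fun x => (C * expR (- (x / 2)))%:E).
    apply/measurable_EFinP; apply: measurable_funM => //.
    by apply: measurableT_comp => //; apply: measurable_funN; exact: measurable_funM.
  rewrite -H -integral_itv_obnd_cbnd; last exact: measurable_funTS.
  apply: ge0_le_integral => //.
  - by move=> x _; rewrite lee_fin g_ge0.
  - by apply: measurable_funTS; apply/measurable_EFinP; exact: mg.
  - exact: measurable_funTS.
  - by move=> x /=; rewrite in_itv/= andbT lee_fin /g addrK; exact: gC.
have le1 n : (\int[leb]_(x in `[an n.+1, bn n.+1]) (g s x)%:E <= ((2 * C + C) / s)%:E)%E.
  have fe t : (\int[leb]_(x in `[an n.+1, bn n.+1]) (g t x)%:E)%E \is a fin_num.
    by apply: integrable_fin_num => //; exact: ig.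
  rewrite -(fineK (fe s)) lee_fin ler_pdivlMr// mulrC.
  have := integral_g_recurrence s n; rewrite {1}/Rintegral => ->.
  apply: lerD.
    rewrite -lee_fin /Rintegral fineK//.
    apply: le_trans fin1.
    apply: ge0_subset_integral => //.
    - by apply: measurable_funTS; apply/measurable_EFinP; exact: mg.
    - by move=> x _; rewrite lee_fin g_ge0.
    - by move=> x /=; rewrite !in_itv/= andbT => /andP[ax _]; exact: lt_le_trans ax.
  rewrite lerBlDr (@le_trans _ _ C)//; last by rewrite lerDl mulr_ge0 ?powR_ge0 ?expR_ge0.
  apply: le_trans (gC _ _) _; first by rewrite /bn.
  rewrite -[leRHS]mulr1 ler_wpM2l ?(ltW C0)//.
  by rewrite -expR0 ler_expR oppr_le0 divr_ge0.
apply: (@le_lt_trans _ _ ((2 * C + C) / s)%:E); last exact: ltry.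
have cgS := @cvg_g s; rewrite -cvg_shiftS in cgS.
rewrite -(cvg_lim _ cgS)//; apply: lime_le; last by apply: nearW => n; exact: le1.
by apply/cvg_ex; eexists; exact: cgS.
Unshelve. all: by end_near. Qed.

Lemma integral_Gamma s : 0 < s ->
  (\int[leb]_(x in `]0%R, +oo[) (x `^ (s - 1) * expR (- x))%:E = (Gamma s)%:E)%E.
Proof.
move=> s0; rewrite /Gamma /Rintegral fineK// ge0_fin_numE; first exact: integral_g_lty.
by apply: integral_ge0 => x _; rewrite lee_fin g_ge0.
Qed.

Let cvg_gR s : 0 < s ->
  \int[leb]_(x in `[an n, bn n]) g s x @[n --> \oo] --> Gamma s.
Proof.
move=> s0; apply: fine_cvg; rewrite -integral_Gamma//; exact: cvg_g.
Qed.

(** The limit of the truncated recurrence: the boundary terms vanish at infinity by exponential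
    decay and at 0 because s > 0. *)
Lemma GammaS s : 0 < s -> Gamma (s + 1) = s * Gamma s.
Proof.
move=> s0; have [C C0 gC] := powR_expRN_bound (ltW s0).
have s10 : 0 < s + 1 by rewrite addr_gt0.
have e0 : bn n `^ s * expR (- bn n) @[n --> \oo] --> 0.
  apply: (@squeeze_cvgr _ _ _ _ (cst 0) (fun n => C * expR (- (bn n / 2)))).
  - apply: nearW => n; rewrite mulr_ge0 ?powR_ge0 ?expR_ge0//=.
    by apply: gC; rewrite /bn.
  - exact: cvg_cst.
  rewrite -[X in _ --> X](mulr0 C); apply: cvgM; first exact: cvg_cst.
  apply: (cvg_comp (fun n => bn n / 2) (fun x => expR (- x))); last exact: cvgr_expR.
  apply/cvgryPge => A; near=> n; rewrite ler_pdivlMr//.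
  by near: n; move/cvgryPge : bny; exact.
have a0 : an n `^ s * expR (- an n) @[n --> \oo] --> 0.
  rewrite -[X in _ --> X](mul0r (expR (- 0))); apply: cvgM.
    have := powR_cvg0 s0; move/cvg_at_rightP; apply; split => //.
  apply: (cvg_comp an (fun x => expR (- x))); first exact: an0.
  exact: continuous_expRN.
have := cvg_gR s10; rewrite -cvg_shiftS => c1.
have : s * \int[leb]_(x in `[an n.+1, bn n.+1]) g s x @[n --> \oo] --> s * Gamma s.
  by apply: cvgM; [exact: cvg_cst|have := cvg_gR s0; rewrite -cvg_shiftS].
under eq_fun do rewrite integral_g_recurrence.
move=> c2; apply/esym; apply: (cvg_unique _ c2) => //.
rewrite -cvg_shiftS in e0; rewrite -cvg_shiftS in a0.
have H := cvgD c1 (cvgB e0 a0); rewrite subrr addr0 in H.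
exact: H.
Unshelve. all: by end_near. Qed.

Lemma Gamma_gt0 s : 0 < s -> 0 < Gamma s.
Proof.
move=> s0; rewrite -lte_fin -integral_Gamma//.
(* On [1, 2], x^(s-1) >= 1/x >= 1/2 as s > 0, and exp(-x) >= exp(-2). *)
apply: (@lt_le_trans _ _ (\int[leb]_(x in `[1%R, 2%R]) (expR (- 2) / 2)%:E)%E).
  rewrite integral_cst//= lebesgue_measure_itv/= lte_fin ltr1n -EFinB.
  by rewrite -EFinM lte_fin mulr_gt0 ?divr_gt0 ?expR_gt0// subr_gt0 ltr1n.
apply: (@le_trans _ _ (\int[leb]_(x in `[1%R, 2%R]) (g s x)%:E)%E).
  apply: ge0_le_integral => //.
  - by apply: measurable_funTS; apply/measurable_EFinP; exact: mg.
  - move=> x /=; rewrite in_itv/= => /andP[x1 x2]; rewrite lee_fin mulrC.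
    have x0 : 0 < x by exact: lt_le_trans x1.
    apply: ler_pM; rewrite ?expR_ge0//; last by rewrite ler_expR lerN2.
    apply: (@le_trans _ _ (x `^ (- 1))); last by apply: ler_powR => //; rewrite lerBrDr addrC subrr ltW.
    by rewrite powR_inv1 ?(ltW x0)// lef_pV2 ?posrE.
apply: ge0_subset_integral => //.
- by apply: measurable_funTS; apply/measurable_EFinP; exact: mg.
- by move=> x _; rewrite lee_fin g_ge0.
- by move=> x /=; rewrite !in_itv/= andbT => /andP[ax _]; exact: lt_le_trans ax.
Qed.

(** Substitution of p x^2 in Euler's integral, first on compact intervals. *)
Lemma gauss_moment s p : 0 < s -> 0 < p ->
  (\int[leb]_(x in `]0%R, +oo[) (x `^ (2 * s - 1) * expR (- (p * x ^+ 2)))%:E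
   = (Gamma s * p `^ (- s) / 2)%:E)%E.
Proof.
move=> s0 p0.
pose F x : R := p * x ^+ 2.
have dF x : is_derive x 1 F (2 * p * x).
  by apply: is_derive_eq; rewrite /GRing.scale/=; ring.
have F'E : (F^`()%classic : R -> R) = fun x => 2 * p * x.
  by apply/funext => x; rewrite derive1E (@derive_val _ _ _ _ _ _ _ (dF x)).
pose h x : R := x `^ (2 * s - 1) * expR (- (p * x ^+ 2)).
have hF x : 0 < x -> g s (F x) * (2 * p * x) = 2 * p `^ s * h x.
  move=> x0; rewrite /g /F /h powRM ?(ltW p0) ?sqr_ge0//.
  have -> : (x ^+ 2) `^ (s - 1) = x `^ (2 * s - 2).
    by rewrite -powR_mulrn ?(ltW x0)// -powRrM; congr (_ `^ _); ring.
  rewrite (_ : 2 * s - 1 = (2 * s - 2) + 1); last by ring.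
  rewrite [in RHS]powRD ?(gt_eqF x0) ?implybT// powRr1 ?(ltW x0)//.
  have -> : p `^ s = p `^ (s - 1) * p.
    by rewrite mulrC mulr_powRB1// ltW.
  by ring.
have sub n : (\int[leb]_(x in `[F (an n.+1), F (bn n.+1)]) (g s x)%:E =
   \int[leb]_(x in `[an n.+1, bn n.+1]) (2 * p `^ s * h x)%:E)%E.
  have ab : an n.+1 < bn n.+1.
    rewrite (@lt_trans _ _ 1)//; first by rewrite invf_lt1// ltr1n.
    by rewrite /bn ltr1n.
  have cF' x : {for x, continuous F^`()%classic}.
    by rewrite F'E; apply: continuousM; [exact: cst_continuous|exact: cvg_id].
  rewrite (@integration_by_substitution_increasing R).
  - apply: eq_integral => x; rewrite inE/= in_itv/= => /andP[ax _].
    by rewrite F'E -hF// (lt_le_trans _ ax).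
  - exact: ltW.
  - move=> x y; rewrite !in_itv/= => /andP[ax _] /andP[ay _] xy.
    by rewrite /F ltr_pM2l// ltr_pXn2r// nnegrE (le_trans (ltW (an_gt0 n.+1))).
  - by move=> x _; exact: cF'.
  - by apply/cvg_ex; exists (F^`()%classic (an n.+1)); apply: cvg_at_right_filter; exact: cF'.
  - by apply/cvg_ex; exists (F^`()%classic (bn n.+1)); apply: cvg_at_left_filter; exact: cF'.
  - apply: derivable_oo_LRcontinuous_pos => // x _; exact: (@ex_derive _ _ _ _ _ _ _ (dF x)).
  - apply: within_continuous_itv_pos => [|x]; last exact: cg.
    by rewrite /F mulr_gt0// exprn_gt0.
have mh : measurable_fun [set: R] h.
  apply: measurable_funM; first exact: measurable_powR.
  apply: measurableT_comp => //; apply: measurable_funN.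
  by apply: measurable_funM => //; exact: measurable_funX.
have c1 : (\int[leb]_(x in `[F (an n), F (bn n)]) (g s x)%:E @[n --> \oo] --> (Gamma s)%:E)%E.
  rewrite -integral_Gamma//; apply: cvg_integral_itv_pos.
  - by move=> n; rewrite mulr_gt0// exprn_gt0.
  - move=> m n mn; rewrite /F ler_pM2l// lerXn2r// ?nnegrE ?(ltW (an_gt0 _))//.
    exact: an_ni.
  - move=> m n mn; rewrite /F ler_pM2l// lerXn2r ?nnegrE ?ler0n//; exact: bn_nd.
  - rewrite -[X in _ --> X](mulr0 p); apply: cvgM; first exact: cvg_cst.
    rewrite -[X in _ --> X](mulr0 0); under eq_fun do rewrite expr2; exact: cvgM.
  - apply/cvgryPge => A; near=> n.
    apply: (@le_trans _ _ (p * bn n)); last first.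
      by rewrite /F ler_pM2l// expr2 ler_peMr// /bn ?ler1n.
    rewrite -ler_pdivrMl//; near: n; move/cvgryPge : bny; exact.
  - exact: measurable_funTS.
  - by move=> x _; exact: g_ge0.
have c2 : (\int[leb]_(x in `[an n, bn n]) (2 * p `^ s * h x)%:E @[n --> \oo] -->
   \int[leb]_(x in `]0%R, +oo[) (2 * p `^ s * h x)%:E)%E.
  apply: cvg_integral_itv_pos => //.
    by apply: measurable_funM => //; exact: measurable_funTS.
  by move=> x _; rewrite !mulr_ge0 ?powR_ge0 ?expR_ge0.
pose u n := (\int[leb]_(x in `[an n.+1, bn n.+1]) (2 * p `^ s * h x)%:E)%E.
have c3 : u n @[n --> \oo] --> (Gamma s)%:E.
  rewrite (_ : u = fun n => (\int[leb]_(x in `[F (an n.+1), F (bn n.+1)]) (g s x)%:E)%E).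
    by rewrite (cvg_shiftS (fun n => (\int[leb]_(x in `[F (an n), F (bn n)]) (g s x)%:E)%E)).
  by apply/funext => n; rewrite sub.
have c4 : u n @[n --> \oo] --> (\int[leb]_(x in `]0%R, +oo[) (2 * p `^ s * h x)%:E)%E.
  by rewrite (cvg_shiftS (fun n => (\int[leb]_(x in `[an n, bn n]) (2 * p `^ s * h x)%:E)%E)).
have E0 : (\int[leb]_(x in `]0%R, +oo[) (2 * p `^ s * h x)%:E = (Gamma s)%:E)%E.
  exact: (cvg_unique _ c4 c3).
move: E0.
under eq_integral do rewrite EFinM.
rewrite ge0_integralZl; [|exact: measurable_itv|by apply/measurable_EFinP; exact: measurable_funTS|by move=> x _; rewrite lee_fin mulr_ge0 ?powR_ge0 ?expR_ge0|by rewrite lee_fin mulr_ge0 ?powR_ge0].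
have q0 : 0 < p `^ s by exact: powR_gt0.
move=> E; have {E} := congr1 (fun y : \bar R => ((2 * p `^ s)^-1)%:E * y)%E E.
rewrite muleA -EFinM mulVf ?mul1e; last by rewrite mulf_neq0// gt_eqF.
move=> ->; rewrite -EFinM; congr EFin; rewrite powRN; field.
by rewrite gt_eqF.
Unshelve. all: by end_near. Qed.

End Gamma_function.

(** * Normalized Bessel functions *)

Section pochhammer.
Context {R : realType}.
Implicit Types s x z : R.

Definition pochhammer s k : R := \prod_(i < k) (s + i%:R).

Lemma pochhammer0 s : pochhammer s 0 = 1.
Proof. by rewrite /pochhammer big_ord0. Qed.

Lemma pochhammerS s k : pochhammer s k.+1 = pochhammer s k * (s + k%:R).
Proof. by rewrite /pochhammer big_ord_recr. Qed.

Lemma pochhammer_gt0 s k : 0 < s -> 0 < pochhammer s k.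
Proof. by move=> s0; apply: prodr_gt0 => i _; rewrite ltr_wpDr. Qed.

Lemma pochhammer_ge1 s k : 1 <= s -> 1 <= pochhammer s k.
Proof.
move=> s1; elim: k => [|k ih]; first by rewrite pochhammer0.
rewrite pochhammerS -[leLHS]mulr1 ler_pM//.
by rewrite (le_trans s1)// lerDl.
Qed.

Lemma Gamma_pochhammer s k : 0 < s -> Gamma (s + k%:R) = pochhammer s k * Gamma s.
Proof.
move=> s0; elim: k => [|k ih]; first by rewrite addr0 pochhammer0 mul1r.
rewrite -natr1 addrA GammaS ?ltr_wpDr// ih pochhammerS; ring.
Qed.

End pochhammer.

Section bessel.
Context {R : realType}.
Variable s : R.
Hypothesis s_ge : 2^-1 <= s.

Let s_gt0 : 0 < s. Proof. by apply: lt_le_trans s_ge; rewrite invr_gt0. Qed.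

(** Coefficients in the variable u = (z/2)^2, with s = nu + 1; the assumption s >= 1/2 is nu >=
    -1/2. *)
Definition bessel_coef (k : nat) : R := (-1) ^+ k / (k`!%:R * pochhammer s k).

Let b := bessel_coef.

Let b_rec k : k.+1%:R * (s + k%:R) * b k.+1 = - b k.
Proof.
rewrite /b /bessel_coef pochhammerS factS natrM exprS.
have ? : k`!%:R != 0 :> R by rewrite pnatr_eq0 -lt0n fact_gt0.
have ? : pochhammer s k != 0 by rewrite gt_eqF// pochhammer_gt0.
have ? : s + k%:R != 0 by rewrite gt_eqF// ltr_wpDr.
have ? : k.+1%:R != 0 :> R by rewrite pnatr_eq0.
by field; rewrite -?natr1 ?addrA; do ?[apply/andP; split] => //; rewrite nat1r.
Qed.

(** As s >= 1/2, the first factor of the Pochhammer symbol is at least 1/2 and the others are at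
    least 1. The series is thereby compared with the exponential one. *)
Let b_bound k : `|b k| <= 2 / k`!%:R.
Proof.
have p0 := pochhammer_gt0 k s_gt0.
rewrite /b /bessel_coef normrM normrX normrN1 expr1n mul1r ger0_norm; last first.
  by rewrite invr_ge0 mulr_ge0// ltW.
rewrite invfM [leLHS]mulrC; apply: ler_wpM2r; first by rewrite invr_ge0.
rewrite -[leRHS]invrK lef_pV2 ?posrE ?invr_gt0// {p0}.
elim: k => [|k ih]; first by rewrite pochhammer0 invf_le1// ler1n.
case: k ih => [|k] ih; first by rewrite pochhammerS pochhammer0 mul1r addr0.
rewrite pochhammerS -[leLHS]mulr1 ler_pM ?invr_ge0//.
by rewrite -natr1 addrA lerDr addr_ge0// ltW.
Qed.

Let cvg_of_bound (c : R^nat) (M : R) x :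
  (forall k, `|c k| <= M / k`!%:R) -> cvgn (pseries c x).
Proof.
move=> cM; have M0 : 0 <= M.
  by have := le_trans (normr_ge0 _) (cM 0%N); rewrite fact0 divr1.
apply: normed_cvg.
apply: (@series_le_cvg _ _ (fun k => M * exp_coeff `|x| k)) => //.
- by move=> n /=; exact: normr_ge0.
- by move=> n; rewrite mulr_ge0// exp_coeff_ge0.
- move=> n /=; rewrite normrM normrX /exp_coeff/= [`|x| ^+ n / _]mulrC mulrA.
  by rewrite ler_wpM2r// exprn_ge0.
- by apply: is_cvg_seriesZ; exact: is_cvg_series_exp_coeff.
Qed.

(** The factor k + 1 created by differentiation cancels against the factorial, so all derived series
    converge everywhere with the same bound. *)
Let diffs_bound (c : R^nat) (M : R) :
  (forall k, `|c k| <= M / k`!%:R) -> (forall k, `|pseries_diffs c k| <= M / k`!%:R).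
Proof.
move=> cM k; rewrite /pseries_diffs normrM normr_nat.
apply: (le_trans (ler_wpM2l _ (cM _))) => //.
have ? : k`!%:R != 0 :> R by rewrite pnatr_eq0 -lt0n fact_gt0.
have ? : k.+1%:R != 0 :> R by rewrite pnatr_eq0.
suff -> : k.+1%:R * (M / (k.+1)`!%:R) = M / k`!%:R by [].
by rewrite factS natrM; field; apply/andP; split => //; rewrite nat1r.
Qed.

Let cb x : cvgn (pseries b x).
Proof. exact: cvg_of_bound b_bound. Qed.
Let cdb x : cvgn (pseries (pseries_diffs b) x).
Proof. exact/cvg_of_bound/diffs_bound/b_bound. Qed.
Let cddb x : cvgn (pseries (pseries_diffs (pseries_diffs b)) x).
Proof. exact/cvg_of_bound/diffs_bound/diffs_bound/b_bound. Qed.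
Let cdddb x : cvgn (pseries (pseries_diffs (pseries_diffs (pseries_diffs b))) x).
Proof. exact/cvg_of_bound/diffs_bound/diffs_bound/diffs_bound/b_bound. Qed.

Definition bessel_series (u : R) : R := limn (pseries b u).
Let h := bessel_series.
Let h1 (u : R) : R := limn (pseries (pseries_diffs b) u).
Let h2 (u : R) : R := limn (pseries (pseries_diffs (pseries_diffs b)) u).

Let dh (u : R) : is_derive u 1 h (h1 u).
Proof.
apply: (@pseries_snd_diffs _ _ (`|u| + 1)) => //.
by rewrite [ltRHS]ger0_norm ?addr_ge0// ltrDl.
Qed.

Let dh1 (u : R) : is_derive u 1 h1 (h2 u).
Proof.
apply: (@pseries_snd_diffs _ _ (`|u| + 1)) => //.
by rewrite [ltRHS]ger0_norm ?addr_ge0// ltrDl.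
Qed.

(** The coefficient of u^k is k (k+1) b_(k+1) + s (k+1) b_(k+1) + b_k, which is zero by [b_rec]. *)
Let ode (u : R) : u * h2 u + s * h1 u + h u = 0.
Proof.
have c2 : series (fun k => k%:R * pseries_diffs b k * u ^+ k) @ \oo --> u * h2 u.
  have := pseries_diffs_equiv (@cddb u) => /= H.
  rewrite (_ : series _ = (fun n => u * series (fun k => k%:R * pseries_diffs b k * u ^+ k.-1) n)).
    by apply: cvgM; [exact: cvg_cst|exact: H].
  apply/funext => n; rewrite /series/= mulr_sumr; apply: eq_bigr => k _.
  by case: k => [|k]; rewrite ?mul0r ?mulr0//= exprS; ring.
have c1 : series (fun k => s * (pseries_diffs b k * u ^+ k)) @ \oo --> s * h1 u.
  rewrite (_ : series _ = (fun n => s * pseries (pseries_diffs b) u n)).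
    by apply: cvgM; [exact: cvg_cst|exact: cdb].
  by apply/funext => n; rewrite /pseries /series/= mulr_sumr.
have c0 : series (fun k => b k * u ^+ k) @ \oo --> h u by exact: cb.
pose S n := series (fun k => k%:R * pseries_diffs b k * u ^+ k) n
  + series (fun k => s * (pseries_diffs b k * u ^+ k)) n
  + series (fun k => b k * u ^+ k) n.
have c : S n @[n --> \oo] --> u * h2 u + s * h1 u + h u.
  by apply: cvgD => //; exact: cvgD.
suff S0 : S = cst 0 by rewrite S0 in c; exact: (cvg_unique _ c (cvg_cst 0)).
apply/funext => n; rewrite /S /series/= -!big_split/= big1// => k _.
rewrite /pseries_diffs; have := b_rec k => /(congr1 (fun y => y * u ^+ k)).
by rewrite mulNr => /eqP; rewrite -addr_eq0 => /eqP <-; ring.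
Qed.

Lemma bessel_series0 : bessel_series 0 = 1.
Proof.
apply/cvg_lim => //; rewrite -cvg_shiftS.
rewrite (_ : (fun n => _) = cst 1); first exact: cvg_cst.
apply/funext => n; rewrite /pseries /series/= big_nat_recl//= expr0 mulr1.
rewrite big1 ?addr0; last by move=> k _; rewrite expr0n mulr0.
by rewrite /b /bessel_coef pochhammer0 fact0 expr0 mulr1 divr1.
Qed.

Lemma cvg_bessel_series (u : R) :
  series (fun k => bessel_coef k * u ^+ k) @ \oo --> bessel_series u.
Proof. exact: cb. Qed.

Lemma continuous_bessel_series : continuous bessel_series.
Proof.
move=> u; apply: differentiable_continuous; apply/derivable1_diffP.
exact: (@ex_derive _ _ _ _ _ _ _ (dh u)).
Qed.

(* With j(z) = h(z^2/4), Bessel's equation reads u h'' + s h' + h = 0, so that the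
   energy h^2 + u h'^2 has derivative - (2 s - 1) h'^2. *)
Lemma normr_bessel_series_le1 (u : R) : 0 <= u -> `|bessel_series u| <= 1.
Proof.
move=> u0; pose V (x : R) := h x ^+ 2 + x * h1 x ^+ 2.
have dV (x : R) : is_derive x 1 V (- (2 * s - 1) * h1 x ^+ 2).
  have := dh x; have := dh1 x => ? ?.
  apply: is_derive_eq; rewrite /GRing.scale/=.
  by have := ode x; nra.
have : V u <= V 0.
  apply: (@ler0_derive1_le_cc R V 0 u) => //.
  - move=> x _; rewrite derive1E (@derive_val _ _ _ _ _ _ _ (dV x)).
    by rewrite mulNr oppr_le0 mulr_ge0 ?sqr_ge0// subr_ge0 -(@ler_pM2l _ 2^-1) ?mulrA ?mulVf ?mul1r ?mulr1.
  - apply: continuous_subspaceT => x; apply: differentiable_continuous.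
    apply/derivable1_diffP; exact: (@ex_derive _ _ _ _ _ _ _ (dV x)).
  - by rewrite in_itv/= u0 lexx.
  - by rewrite in_itv/= lexx.
rewrite /V mul0r addr0 /h bessel_series0 expr1n => Vu.
rewrite -(@ler_pXn2r _ 2)// ?nnegrE// expr1n real_normK ?num_real//.
by apply: le_trans Vu; rewrite lerDl mulr_ge0// sqr_ge0.
Qed.

Lemma bessel_jE (z : R) : bessel_j (s - 1) z = bessel_series ((z / 2) ^+ 2).
Proof.
rewrite /bessel_j subrK; have G0 := Gamma_gt0 s_gt0.
set c := (fun k => _); suff : series c @ \oo --> (Gamma s)^-1 * bessel_series ((z / 2) ^+ 2).
  by move=> /cvg_lim ->//; rewrite mulrA mulfV ?mul1r ?gt_eqF.
rewrite (_ : series c = (fun n => (Gamma s)^-1 * series (fun k => b k * ((z / 2) ^+ 2) ^+ k) n)).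
  by apply: cvgM; [exact: cvg_cst|exact: cb].
apply/funext => n; rewrite /series/= mulr_sumr; apply: eq_bigr => k _.
rewrite /c /b /bessel_coef (_ : s - 1 + k%:R + 1 = s + k%:R); last by ring.
rewrite Gamma_pochhammer// !mulrA !invfM -exprM; ring.
Qed.

End bessel.

(** * Laguerre functions *)

Section laguerre.
Context {R : realType}.
Variables (alpha : R) (m : nat).
Hypothesis alpha0 : 0 <= alpha.

Let s_gt0 : 0 < alpha + 1. Proof. by rewrite ltr_wpDl. Qed.
Let s_ge1 : 1 <= alpha + 1. Proof. by rewrite lerDr. Qed.

(** Coefficients of L_m^alpha / L_m^alpha(0). The Pochhammer denominator is what Gaussian moments
    cancel, leaving a binomial sum. *)
Definition laguerre_coef (k : nat) : R :=
  (-1) ^+ k * 'C(m, k)%:R / pochhammer (alpha + 1) k.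

Let prodE j k : (j <= k)%N -> pochhammer (alpha + 1) j * \prod_(j <= i < k) (alpha + i%:R + 1)
  = pochhammer (alpha + 1) k.
Proof.
move=> jk; rewrite /pochhammer -!(big_mkord xpredT (fun i => alpha + 1 + i%:R)).
rewrite [RHS](@big_cat_nat _ _ _ j)//=; congr (_ * _).
by apply: eq_bigr => i _; rewrite addrAC.
Qed.

Lemma laguerre_horner0 : (laguerre alpha m).[0] = pochhammer (alpha + 1) m / m`!%:R.
Proof.
rewrite horner_coef0 coef_poly ltn0Sn expr0 mul1r fact0 mul1r subn0.
by rewrite -(@prodE 0 m)// pochhammer0 mul1r.
Qed.

Lemma laguerre_funE z : laguerre_fun alpha m z =
  expR (- (z / 2)) * \sum_(k < m.+1) laguerre_coef k * z ^+ k.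
Proof.
rewrite /laguerre_fun laguerre_horner0 -mulrA; congr (_ * _).
rewrite horner_poly mulr_suml; apply: eq_bigr => -[k /= km] _.
rewrite /laguerre_coef -(@prodE k m)//.
have ? : pochhammer (alpha + 1) k != 0 by rewrite gt_eqF// pochhammer_gt0.
have ? : \prod_(k <= i < m) (alpha + i%:R + 1) != 0.
  by rewrite gt_eqF// prodr_gt0// => i _; rewrite addrAC ltr_wpDr.
have f0 n : n`!%:R != 0 :> R by rewrite pnatr_eq0 -lt0n fact_gt0.
rewrite -(@bin_fact m k)// !natrM.
field.
rewrite !f0 /=; apply/and3P; split => //; by rewrite pnatr_eq0 -lt0n bin_gt0.
Qed.

Lemma measurable_laguerre_fun : measurable_fun [set: R] (laguerre_fun alpha m).
Proof.
rewrite (_ : laguerre_fun _ _ = (fun z => expR (- (z / 2)) * \sum_(k < m.+1) laguerre_coef k * z ^+ k)); last first.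
  by apply/funext => z; rewrite laguerre_funE.
apply: measurable_funM.
  by apply: measurableT_comp => //; apply: measurable_funN; exact: measurable_funM.
apply: measurable_sum => k; apply: measurable_funM => //; exact: measurable_funX.
Qed.

Let coef_le k : `|laguerre_coef k| <= 'C(m, k)%:R.
Proof.
rewrite /laguerre_coef normrM normrM normrX normrN1 expr1n mul1r normr_nat.
rewrite ger0_norm ?invr_ge0 ?(ltW (pochhammer_gt0 _ s_gt0))//.
rewrite ler_pdivrMr ?pochhammer_gt0// -[leLHS]mulr1 ler_wpM2l//.
exact: pochhammer_ge1.
Qed.

(** Each monomial satisfies z^k exp(-z/2) <= 2^k k!. The bound depends on m, which suffices at a
    fixed frequency. *)
Lemma laguerre_fun_bounded : exists M : R, forall z, 0 <= z -> `|laguerre_fun alpha m z| <= M.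
Proof.
exists (\sum_(k < m.+1) 'C(m, k)%:R * (2 ^+ k * k`!%:R)) => z z0.
rewrite laguerre_funE mulr_sumr; apply: (le_trans (ler_norm_sum _ _ _)).
apply: ler_sum => k _; rewrite mulrCA normrM; apply: ler_pM => //.
rewrite normrM ger0_norm ?expR_ge0// ger0_norm ?exprn_ge0//.
rewrite expRN mulrC ler_pdivrMr ?expR_gt0//.
case: k => -[|k] _ /=.
  by rewrite !expr0 fact0 !mul1r -expR0 ler_expR divr_ge0.
have := @expR_ge1Dxn R (z / 2) k (divr_ge0 z0 (ler0n _ 2)).
rewrite expr_div_n => H.
have {}H : z ^+ k.+1 / 2 ^+ k.+1 / k.+1`!%:R <= expR (z / 2).
  by apply: le_trans H; rewrite lerDr.
rewrite !ler_pdivrMr ?exprn_gt0 ?ltr0n ?fact_gt0// in H.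
by apply: (le_trans H); rewrite -mulrA [leRHS]mulrC [_`!%:R * _]mulrC.
Qed.

(** For alpha >= 0 the coefficients are at most the binomial ones, so the polynomial is bounded by
    (1 + z)^m <= exp(m z). Unlike the previous bound, this one is uniform in m. *)
Lemma laguerre_fun_le (z : R) : 0 <= z -> m%:R * z <= 1 -> `|laguerre_fun alpha m z| <= expR 1.
Proof.
move=> z0 mz; rewrite laguerre_funE normrM -[leRHS]mul1r; apply: ler_pM => //.
  by rewrite ger0_norm ?expR_ge0// -expR0 ler_expR oppr_le0 divr_ge0.
apply: (@le_trans _ _ ((1 + z) ^+ m)).
  apply: (le_trans (ler_norm_sum _ _ _)); rewrite exprDn; apply: ler_sum => k _.
  rewrite expr1n mul1r normrM [`|z ^+ k|]ger0_norm ?exprn_ge0// -mulr_natl.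
  by apply: ler_wpM2r; [exact: exprn_ge0|exact: coef_le].
apply: (@le_trans _ _ (expR (m%:R * z))); last by rewrite ler_expR.
by rewrite expRM_natl lerXn2r ?nnegrE ?expR_ge0 ?addr_ge0// expR_ge1Dx.
Qed.

End laguerre.

(** * Power series integrated against Gaussian weights *)

Section gauss_pseries.
Context {R : realType}.
Notation leb := (@lebesgue_measure R).
Variables (s p : R).
Hypotheses (s0 : 0 < s) (p0 : 0 < p).

Definition gauss_weight (x : R) : R := x `^ (2 * s - 1) * expR (- (p * x ^+ 2)).
Definition gauss_mass : R := Gamma s * p `^ (- s) / 2.

Lemma gauss_weight_ge0 x : 0 <= gauss_weight x.
Proof. by rewrite mulr_ge0 ?powR_ge0 ?expR_ge0. Qed.

Lemma gauss_mass_gt0 : 0 < gauss_mass.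
Proof. by rewrite divr_gt0// mulr_gt0 ?Gamma_gt0 ?powR_gt0. Qed.

Lemma measurable_gauss_weight : measurable_fun [set: R] gauss_weight.
Proof.
apply: measurable_funM; first exact: measurable_powR.
apply: measurableT_comp => //; apply: measurable_funN.
by apply: measurable_funM => //; exact: measurable_funX.
Qed.

(** A factor x^(2k) shifts s to s + k in the Gaussian moment, and the quotient of Gamma values is a
    Pochhammer symbol. *)
Lemma gauss_monomial k :
  (\int[leb]_(x in `]0%R, +oo[) ((x ^+ 2) ^+ k * gauss_weight x)%:E =
   (gauss_mass * (pochhammer s k / p ^+ k))%:E)%E.
Proof.
have := @gauss_moment R (s + k%:R) p.
rewrite ltr_wpDr// => /(_ erefl p0).
rewrite Gamma_pochhammer// (_ : - (s + k%:R) = - s - k%:R); last by ring.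
rewrite powRD ?(gt_eqF p0) ?implybT// powR_invn ?(ltW p0)//.
rewrite (_ : _ * _ / 2 = gauss_mass * (pochhammer s k / p ^+ k)); last first.
  by rewrite /gauss_mass; ring.
move=> <-; apply: eq_integral => x; rewrite inE/= in_itv/= andbT => x0.
congr EFin; rewrite /gauss_weight mulrA; congr (_ * _).
rewrite (_ : 2 * (s + k%:R) - 1 = (2 * k)%:R + (2 * s - 1)); last by rewrite natrM; ring.
by rewrite [RHS]powRD ?(gt_eqF x0) ?implybT// powR_mulrn ?(ltW x0)// exprM.
Qed.

(** The mechanism behind all explicit integrals: termwise integration multiplies the k-th
    coefficient by [pochhammer s k], which cancels the denominators of the Laguerre and Bessel
    coefficients. *)
Lemma gauss_pseries (a : R^nat) (h : R -> R) :
  cvgn (series (fun k => `|a k| * (pochhammer s k / p ^+ k))) ->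
  (forall x, 0 < x -> series (fun k => a k * (x ^+ 2) ^+ k) @ \oo --> h x) ->
  leb.-integrable `](0:R), +oo[ (EFin \o (fun x => h x * gauss_weight x)) /\
  series (fun k => a k * (pochhammer s k / p ^+ k)) @ \oo -->
    gauss_mass^-1 * \int[leb]_(x in `]0, +oo[) (h x * gauss_weight x).
Proof.
move=> ca ch.
pose f k (x : R) := a k * ((x ^+ 2) ^+ k * gauss_weight x).
have mf0 k : measurable_fun [set: R] (fun x : R => (x ^+ 2) ^+ k * gauss_weight x).
  apply: measurable_funM; last exact: measurable_gauss_weight.
  by apply: measurable_funX; exact: measurable_funX.
have mf k : measurable_fun `](0:R), +oo[ (f k).
  by apply: measurable_funTS; apply: measurable_funM.
have f0_ge0 k (x : R) : 0 <= (x ^+ 2) ^+ k * gauss_weight x.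
  by apply: mulr_ge0; [apply: exprn_ge0; exact: sqr_ge0|exact: gauss_weight_ge0].
have int0 k : leb.-integrable `](0:R), +oo[ (EFin \o (fun x : R => (x ^+ 2) ^+ k * gauss_weight x)).
  apply/integrableP; split; first by apply: measurable_funTS; apply/measurable_EFinP; exact: mf0.
  under eq_integral do rewrite gee0_abs ?lee_fin//.
  by rewrite gauss_monomial ltry.
have intf k : \int[leb]_(x in `]0, +oo[) f k x = gauss_mass * (a k * (pochhammer s k / p ^+ k)).
  rewrite /f RintegralZl; [|exact: measurable_itv|exact: int0].
  by rewrite {1}/Rintegral gauss_monomial/=; ring.
have normf k : (\int[leb]_(x in `]0%R, +oo[) `|(f k x)%:E| =
    (gauss_mass * (`|a k| * (pochhammer s k / p ^+ k)))%:E)%E.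
  under eq_integral => x _.
    rewrite abse_EFin /f normrM (ger0_norm (f0_ge0 _ _)) EFinM.
    over.
  rewrite ge0_integralZl//; last 2 first.
  - by apply: measurable_funTS; apply/measurable_EFinP; exact: mf0.
  - by move=> x _; rewrite lee_fin.
  by rewrite gauss_monomial -EFinM mulrCA.
have [] := @integral_series_cvg _ _ _ leb `](0:R), +oo[ (measurable_itv _) f (fun x => h x * gauss_weight x) mf.
- under eq_eseriesr do rewrite normf.
  have cm := is_cvg_seriesZ (k := gauss_mass) ca.
  rewrite (_ : (fun n => _) = EFin \o series (gauss_mass *: (fun k => `|a k| * (pochhammer s k / p ^+ k)))).
    have : EFin \o series (gauss_mass *: (fun k => `|a k| * (pochhammer s k / p ^+ k))) @ \oo --> (limn (series (gauss_mass *: (fun k => `|a k| * (pochhammer s k / p ^+ k)))))%:E.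
      by apply: cvg_EFin; [exact: nearW|exact: cm].
    by move=> /cvg_lim ->//; rewrite ltry.
  by apply/funext => n /=; rewrite /series/= -sumEFin.
- move=> x; rewrite /= in_itv/= andbT => x0.
  rewrite (_ : series _ = (fun n => series (fun k => a k * (x ^+ 2) ^+ k) n * gauss_weight x)).
    by apply: cvgM; [exact: ch|exact: cvg_cst].
  by apply/funext => n; rewrite /series/= mulr_suml; apply: eq_bigr => k _; rewrite /f mulrA.
move=> ih ch'; split => //.
rewrite (_ : series _ = (fun n => gauss_mass^-1 * series (fun k => \int[leb]_(x in `]0, +oo[) f k x) n)).
  by apply: cvgM; [exact: cvg_cst|exact: ch'].
apply/funext => n; rewrite /series/= mulr_sumr; apply: eq_bigr => k _.
by rewrite intf mulKf// gt_eqF// gauss_mass_gt0.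
Qed.

End gauss_pseries.

(** * Integrals of products of one-variable functions *)

Section tensor.
Local Open Scope ereal_scope.
Context d1 d2 (T1 : measurableType d1) (T2 : measurableType d2) (R : realType).
Variable m1 : {sigma_finite_measure set T1 -> \bar R}.
Variable m2 : {sigma_finite_measure set T2 -> \bar R}.
Variables (U : T1 -> R) (V : T2 -> R).
Hypotheses (mU : measurable_fun [set: T1] U) (mV : measurable_fun [set: T2] V).

Lemma measurable_tensor :
  measurable_fun [set: T1 * T2] (fun z => (U z.1 * V z.2)%R).
Proof.
by apply: measurable_funM; [exact: (measurableT_comp mU)|exact: (measurableT_comp mV)].
Qed.

Lemma ge0_integral_tensor : (forall x, 0 <= U x)%R -> (forall x, 0 <= V x)%R ->
  \int[m1 \x m2]_z (U z.1 * V z.2)%:E = \int[m1]_x (U x)%:E * \int[m2]_y (V y)%:E.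
Proof.
move=> U0 V0; rewrite fubini_tonelli1; last 2 first.
- by apply/measurable_EFinP; exact: measurable_tensor.
- by move=> z; rewrite lee_fin mulr_ge0.
rewrite -ge0_integralZr//; last 3 first.
- exact/measurable_EFinP.
- by move=> x _; rewrite lee_fin.
- by apply: integral_ge0 => y _; rewrite lee_fin.
apply: eq_integral => x _; rewrite /fubini_F/=.
under eq_integral do rewrite EFinM.
rewrite ge0_integralZl//; last 3 first.
- exact/measurable_EFinP.
- by move=> y _; rewrite lee_fin.
- by rewrite lee_fin.
Qed.

Hypotheses (iU : m1.-integrable setT (EFin \o U)) (iV : m2.-integrable setT (EFin \o V)).

Lemma integrable_tensor :
  (m1 \x m2).-integrable setT (EFin \o (fun z => (U z.1 * V z.2)%R)).
Proof.
apply/integrable12ltyP; first by apply/measurable_EFinP; exact: measurable_tensor.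
have /integrableP[_ fV] := iV; have /integrableP[_ fU] := iU.
under eq_integral => x _.
  under eq_integral => y _ do rewrite /= normrM EFinM.
  rewrite ge0_integralZl//; last first.
    by apply/measurable_EFinP; exact: measurableT_comp.
  over.
rewrite ge0_integralZr//; last 2 first.
- by apply/measurable_EFinP; exact: measurableT_comp.
- by apply: integral_ge0 => y _; rewrite lee_fin.
apply: lte_mul_pinfty => //; first exact: integral_ge0.
by rewrite ge0_fin_numE// integral_ge0.
Qed.

Lemma integral_tensor :
  \int[m1 \x m2]_z (U z.1 * V z.2)%:E = \int[m1]_x (U x)%:E * \int[m2]_y (V y)%:E.
Proof.
have fV := integrable_fin_num measurableT iV.
rewrite -(integral12_prod_meas1 integrable_tensor) -(fineK fV).
rewrite -integralZr//; apply: eq_integral => x _; rewrite /fubini_F/=.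
under eq_integral do rewrite EFinM.
by rewrite integralZl// -[in LHS](fineK fV).
Qed.

End tensor.

(** * Product integrals for the measure on K *)

Section m_alpha_integral.
Context {R : realType} (alpha : {nonneg R}).
Local Notation a := (alpha%:num).
Local Notation leb := (@lebesgue_measure R).
Local Notation RM := (measurableTypeR R).

Definition m_const : R := (pi * Gamma (a + 1))^-1.

Lemma m_const_gt0 : 0 < m_const.
Proof. by rewrite invr_gt0 mulr_gt0 ?pi_gt0// Gamma_gt0// ltr_wpDl. Qed.

(** The power and the cut-off of one coordinate are absorbed in the function, so that u(x) v(t)
    times the density of [m_alpha] is again a product. *)
Let half (e : R) (u : R -> R) (x : R) : R := u x * x `^ e * \1_`[0, +oo[ x.

Let half_integral (e : R) (u : R -> R) : measurable_fun [set: RM] u ->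
  (\int[leb]_x (half e u x)%:E = \int[leb]_(x in `]0%R, +oo[) (u x * x `^ e)%:E)%E.
Proof.
move=> mu; rewrite integral_itv_obnd_cbnd; last first.
  apply: measurable_funTS; apply/measurable_EFinP; exact: measurable_funM.
rewrite [RHS]integral_mkcond; apply: eq_integral => x _.
rewrite patchE /half indicE; case: ifPn => _; first by rewrite mulr1.
by rewrite mulr0.
Qed.

Let mhalf (e : R) (u : R -> R) : measurable_fun [set: RM] u -> measurable_fun [set: RM] (half e u).
Proof.
move=> mu; apply: measurable_funM; last exact: measurable_indic.
by apply: measurable_funM => //; exact: measurable_powR.
Qed.

Let half_norm (e : R) (u : R -> R) x : half e (fun y => `|u y|) x = `|half e u x|.
Proof. by rewrite /half !normrM (ger0_norm (powR_ge0 _ _)) indicE normr_nat. Qed.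

Let half_integrable (e : R) (u : R -> R) : measurable_fun [set: RM] u ->
  leb.-integrable `](0:R), +oo[ (EFin \o (fun x => u x * x `^ e)) ->
  leb.-integrable setT (EFin \o half e u).
Proof.
move=> mu /integrableP[_ iu]; apply/integrableP; split.
  by apply/measurable_EFinP; exact: mhalf.
move: iu; rewrite (_ : (\int[leb]_(x in `]0%R, +oo[) _)%E =
  (\int[leb]_(x in `]0%R, +oo[) (`|u x| * x `^ e)%:E)%E); last first.
  by apply: eq_integral => x _; rewrite /= normrM (ger0_norm (powR_ge0 _ _)).
rewrite -half_integral; last exact: measurableT_comp.
rewrite (_ : (fun x => _) = (fun x => `|(EFin \o half e u) x|%E))//.
by apply/funext => x; rewrite /= half_norm.
Qed.

Let weightE (u v : R -> R) z : u z.1 * v z.2 * m_weight alpha z =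
  m_const * (half (2 * a + 1) u z.1 * half (2 * a) v z.2).
Proof.
rewrite /m_weight -/m_const /half /K_space !indicE in_setX.
by case: (z.1 \in _); case: (z.2 \in _) => /=; ring.
Qed.

Lemma ge0_integral_m_alpha (u v : R -> R) :
  measurable_fun [set: RM] u -> measurable_fun [set: RM] v ->
  (forall x, 0 <= u x) -> (forall x, 0 <= v x) ->
  (\int[m_alpha alpha]_z (u z.1 * v z.2)%:E =
   m_const%:E * (\int[leb]_(x in `]0%R, +oo[) (u x * x `^ (2 * a + 1))%:E *
                 \int[leb]_(t in `]0%R, +oo[) (v t * t `^ (2 * a))%:E))%E.
Proof.
move=> mu mv u0 v0; rewrite /m_alpha ge0_integral_mweighted; last 2 first.
- by apply/measurable_EFinP; exact: measurable_tensor.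
- by move=> z; rewrite lee_fin mulr_ge0.
under eq_integral do rewrite -EFinM weightE EFinM.
have h0 e (f : R -> R) x : (forall x, 0 <= f x) -> 0 <= half e f x.
  by move=> f0; rewrite !mulr_ge0 ?powR_ge0.
rewrite ge0_integralZl//; last 3 first.
- by apply/measurable_EFinP; apply: measurable_tensor; exact: mhalf.
- by move=> z _; rewrite lee_fin mulr_ge0// h0.
- by rewrite lee_fin ltW// m_const_gt0.
rewrite ge0_integral_tensor ?half_integral//; [exact: mhalf|exact: mhalf| |].
- by move=> x; exact: h0.
- by move=> x; exact: h0.
Qed.

Lemma integral_m_alpha (u v : R -> R) :
  measurable_fun [set: RM] u -> measurable_fun [set: RM] v ->
  leb.-integrable `](0:R), +oo[ (EFin \o (fun x => u x * x `^ (2 * a + 1))) ->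
  leb.-integrable `](0:R), +oo[ (EFin \o (fun t => v t * t `^ (2 * a))) ->
  (m_alpha alpha).-integrable setT (EFin \o (fun z : RM * RM => u z.1 * v z.2)) /\
  \int[m_alpha alpha]_z (u z.1 * v z.2) =
   m_const * (\int[leb]_(x in `]0, +oo[) (u x * x `^ (2 * a + 1)) *
              \int[leb]_(t in `]0, +oo[) (v t * t `^ (2 * a))).
Proof.
move=> mu mv iu iv; have muv := measurable_tensor mu mv; split.
  apply/integrableP; split; first exact/measurable_EFinP.
  have /integrableP[_ fu] := half_integrable mu iu.
  have /integrableP[_ fv] := half_integrable mv iv.
  under eq_integral do rewrite /= normrM.
  rewrite (ge0_integral_m_alpha (u := fun x => `|u x|) (v := fun x => `|v x|))//; [|exact: measurableT_comp|exact: measurableT_comp].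
  rewrite -!half_integral; [|exact: measurableT_comp|exact: measurableT_comp].
  have nE e f : (\int[leb]_x (half e (fun y => `|f y|%R) x)%:E = \int[leb]_x `|(EFin \o half e f) x|)%E.
    by apply: eq_integral => x _; rewrite half_norm.
  rewrite !nE lte_mul_pinfty ?lee_fin ?(ltW m_const_gt0)//.
  apply: lte_mul_pinfty => //; first exact: integral_ge0.
  by rewrite ge0_fin_numE// integral_ge0.
rewrite /Rintegral /m_alpha integral_mweighted; last exact/measurable_EFinP.
under eq_integral do rewrite -EFinM weightE EFinM.
have iU := half_integrable mu iu; have iV := half_integrable mv iv.
rewrite integralZl//; last exact: (integrable_tensor (mhalf _ mu) (mhalf _ mv) iU iV).
rewrite (integral_tensor (mhalf _ mu) (mhalf _ mv) iU iV) !half_integral//.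
have fu : (\int[leb]_(x in `]0%R, +oo[) (u x * x `^ (2 * a + 1))%:E)%E \is a fin_num.
  exact: integrable_fin_num.
have fv : (\int[leb]_(t in `]0%R, +oo[) (v t * t `^ (2 * a))%:E)%E \is a fin_num.
  exact: integrable_fin_num.
by rewrite !fineM// fin_numM.
Qed.

End m_alpha_integral.

(** * The negative binomial series *)

Section negative_binomial.
Context {R : realType}.
Notation leb := (@lebesgue_measure R).
Variable s : R.
Hypothesis s0 : 0 < s.

Let gw0 (p q x : R) : expR (q * x ^+ 2) * gauss_weight s p x = gauss_weight s (p - q) x.
Proof.
rewrite /gauss_weight mulrCA -expRD; congr (_ * expR _); ring.
Qed.

Let cvg_expq (q x : R) :
  series (fun k => q ^+ k / k`!%:R * (x ^+ 2) ^+ k) @ \oo --> expR (q * x ^+ 2).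
Proof.
rewrite (_ : (fun k => _) = exp_coeff (q * x ^+ 2)); first exact: is_cvg_series_exp_coeff.
by apply/funext => k; rewrite /exp_coeff/= [in RHS]exprMn mulrAC.
Qed.

(** Both sides are the normalised integral of exp(q x^2) against x^(2s-1) exp(-x^2): termwise it
    gives the series, and merging the exponentials gives a Gaussian moment with parameter 1 - q. *)
Lemma negative_binomial_series (q : R) : `|q| < 1 ->
  series (fun k => pochhammer s k / k`!%:R * q ^+ k) @ \oo --> (1 - q) `^ (- s).
Proof.
move=> q1.
(* Partial sums of the absolute series are normalised integrals of partial sums of exp(|q| x^2),
   hence bounded by the Gaussian moment with parameter 1 - |q|. *)
have cabs : cvgn (series (fun k => `|q ^+ k / k`!%:R| * (pochhammer s k / 1 ^+ k))).
  apply: nondecreasing_is_cvgn.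
    apply/nondecreasing_seqP => n; rewrite /series/= big_nat_recr//= lerDl.
    by rewrite mulr_ge0// expr1n divr1 ltW// pochhammer_gt0.
  have q1' : 0 < 1 - `|q| by rewrite subr_gt0.
  exists ((gauss_mass s 1)^-1 * gauss_mass s (1 - `|q|)) => _ [n _ <-].
  rewrite -(@ler_pM2l _ (gauss_mass s 1)) ?gauss_mass_gt0// mulVKf ?gt_eqF ?gauss_mass_gt0//.
  rewrite -lee_fin /series/= mulr_sumr -sumEFin.
  under eq_bigr => k _.
    rewrite mulrCA EFinM -gauss_monomial//.
    over.
  have mf k : measurable_fun `](0:R), +oo[ (fun x : R => ((x ^+ 2) ^+ k * gauss_weight s 1 x)%:E).
    apply: measurable_funTS; apply/measurable_EFinP; apply: measurable_funM; last exact: measurable_gauss_weight.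
    by apply: measurable_funX; exact: measurable_funX.
  have f0 k (x : R) : 0 <= (x ^+ 2) ^+ k * gauss_weight s 1 x.
    by apply: mulr_ge0; [apply: exprn_ge0; exact: sqr_ge0|exact: gauss_weight_ge0].
  under eq_bigr => k _.
    rewrite -ge0_integralZl; [|exact: measurable_itv|exact: mf|by move=> x _; rewrite lee_fin|by []].
    over.
  rewrite -(@ge0_integral_sum _ _ _ leb _ (measurable_itv `](0:R), +oo[) _
     (fun k (x : R) => (`|q ^+ k / k`!%:R|%:E * ((x ^+ 2) ^+ k * gauss_weight s 1 x)%:E)%E)); last 2 first.
  - by move=> k; apply: measurable_funeM; exact: mf.
  - by move=> k x _; rewrite mule_ge0 ?lee_fin.
  have := @gauss_moment R s (1 - `|q|) s0 q1'; rewrite -/(gauss_mass s _) => <-.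
  apply: ge0_le_integral => //.
  - by move=> x _; apply: sume_ge0 => k _; rewrite mule_ge0 ?lee_fin.
  - by apply: emeasurable_sum => k; apply: measurable_funeM; exact: mf.
  - by apply: measurable_funTS; apply/measurable_EFinP; exact: measurable_gauss_weight.
  move=> x _; rewrite sumEFin -/(gauss_weight s (1 - `|q|) x) -gw0 lee_fin.
  under eq_bigr do rewrite mulrA.
  rewrite -mulr_suml; apply: ler_wpM2r; first exact: gauss_weight_ge0.
  have cq := @cvg_expq `|q| x.
  rewrite -(cvg_lim _ cq)//.
  apply: (@le_trans _ _ (series (fun k => `|q| ^+ k / k`!%:R * (x ^+ 2) ^+ k) n)).
    rewrite /series/= le_eqVlt; apply/orP; left; apply/eqP.
    by apply: eq_bigr => k _; rewrite normrM normfV normrX normr_nat.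
  apply: nondecreasing_cvgn_le; last by apply/cvg_ex; eexists; exact: cq.
  apply/nondecreasing_seqP => i; rewrite /series/= big_nat_recr//= lerDl.
  apply: mulr_ge0; first by rewrite divr_ge0 ?exprn_ge0.
  by apply: exprn_ge0; exact: sqr_ge0.
have [_] := gauss_pseries s0 ltr01 cabs (fun x _ => @cvg_expq q x).
have -> : series (fun k => q ^+ k / k`!%:R * (pochhammer s k / 1 ^+ k)) =
   series (fun k => pochhammer s k / k`!%:R * q ^+ k).
  congr series; apply/funext => k; rewrite expr1n divr1; ring.
have q0 : 0 < 1 - q by rewrite subr_gt0 (le_lt_trans (ler_norm _)).
under eq_Rintegral do rewrite gw0.
rewrite {1}/Rintegral (gauss_moment s0 q0)/= /gauss_mass powR1.
rewrite (_ : _^-1 * _ = (1 - q) `^ (- s))//.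
have : Gamma s != 0 by rewrite gt_eqF// Gamma_gt0.
by move=> ?; field.
Qed.

End negative_binomial.

(** * Transforms of Gaussians *)

Section kernel.
Context {R : realType} (alpha : {nonneg R}).
Local Notation a := (alpha%:num).
Local Notation leb := (@lebesgue_measure R).
Local Notation RM := (measurableTypeR R).
Local Notation b1 := (a + 1).
Local Notation b2 := (a + 2^-1).

Lemma b1_gt0 : 0 < b1. Proof. by rewrite ltr_wpDl. Qed.
Lemma b2_ge : 2^-1 <= b2. Proof. by rewrite lerDr. Qed.
Lemma b2_gt0 : 0 < b2. Proof. by rewrite ltr_wpDl// invr_gt0. Qed.

Definition kernelL (w : R * nat) (x : R) : R := laguerre_fun a w.2 (w.1 * x ^+ 2).
Definition kernelJ (w : R * nat) (t : R) : R := bessel_series b2 ((w.1 * t / 2) ^+ 2).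

Lemma LB_kernelE w z : LB_kernel alpha w z = kernelL w z.1 * kernelJ w z.2.
Proof.
have E : a - 2^-1 = b2 - 1 by lra.
by rewrite /LB_kernel E (bessel_jE b2_ge) mulrC.
Qed.

Lemma measurable_kernelL w : measurable_fun [set: RM] (kernelL w).
Proof.
apply: (measurableT_comp (measurable_laguerre_fun _ _)) => //.
by apply: measurable_funM => //; exact: measurable_funX.
Qed.

Lemma measurable_kernelJ w : measurable_fun [set: RM] (kernelJ w).
Proof.
apply: (@measurableT_comp _ _ _ _ _ _ (bessel_series b2)).
  by apply: continuous_measurable_fun; exact: continuous_bessel_series b2_ge.
by apply: measurable_funX; apply: measurable_funM => //; exact: measurable_funM.
Qed.

Lemma measurable_LB_kernel w : measurable_fun [set: RM * RM] (LB_kernel alpha w).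
Proof.
rewrite (_ : LB_kernel alpha w = (fun z => kernelL w z.1 * kernelJ w z.2)).
  exact: measurable_tensor (measurable_kernelL w) (measurable_kernelJ w).
by apply/funext => z; exact: LB_kernelE.
Qed.

Lemma kernelJ_le1 w t : `|kernelJ w t| <= 1.
Proof. by apply: normr_bessel_series_le1; [exact: b2_ge|exact: sqr_ge0]. Qed.

(** The sign condition keeps the Laguerre factor in its decaying range; the bound may depend on the
    frequency. *)
Lemma LB_kernel_bounded w : 0 <= w.1 -> exists2 M, 0 < M & forall z, `|LB_kernel alpha w z| <= M.
Proof.
move=> w0; have [M HM] := @laguerre_fun_bounded R a w.2 (ltac:(by [])).
exists (`|M| + 1); first by rewrite ltr_wpDl.
move=> z; rewrite LB_kernelE normrM -[leRHS]mulr1; apply: ler_pM => //; last exact: kernelJ_le1.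
apply: le_trans (HM _ _) _; first by rewrite mulr_ge0// sqr_ge0.
by rewrite (le_trans (ler_norm _))// lerDl.
Qed.

Definition gauss2 (cd : R * R) (z : R * R) : R :=
  expR (- (cd.1 * z.1 ^+ 2)) * expR (- (cd.2 * z.2 ^+ 2)).

Definition gauss2_const : R := m_const alpha * (Gamma b1 / 2) * (Gamma b2 / 2).

(** The middle line is p^-(alpha+1) (1 - lambda/p)^m with p = c + lambda/2. The inverse of p is a
    power so that measurability follows from that of [powR]. *)
Definition gauss2_transform (cd : R * R) (w : R * nat) : R :=
  gauss2_const *
  ((cd.1 + w.1 / 2) `^ (- b1) * (1 - w.1 * (cd.1 + w.1 / 2) `^ (- 1)) ^+ w.2) *
  (cd.2 `^ (- b2) * expR (- (w.1 ^+ 2 / (4 * cd.2)))).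

Lemma gauss2_const_gt0 : 0 < gauss2_const.
Proof.
by rewrite !mulr_gt0 ?m_const_gt0 ?divr_gt0 ?Gamma_gt0 ?b1_gt0 ?b2_gt0.
Qed.

Lemma measurable_expsq (c : R) : measurable_fun [set: RM] (fun x : R => expR (- (c * x ^+ 2))).
Proof.
apply: measurableT_comp => //; apply: measurable_funN.
by apply: measurable_funM => //; exact: measurable_funX.
Qed.

Lemma measurable_gauss2 cd : measurable_fun [set: RM * RM] (gauss2 cd).
Proof. exact: (measurable_tensor (measurable_expsq _) (measurable_expsq _)). Qed.

Lemma gauss2_ge0 cd z : 0 <= gauss2 cd z.
Proof. by rewrite mulr_ge0 ?expR_ge0. Qed.

(** The factor exp(-lambda x^2 / 2) of the Laguerre function joins the Gaussian, whence p = c +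
    lambda/2. What remains after integration is the binomial expansion of (1 - lambda/p)^m. *)
Let laguerre_half c w : 0 < c -> 0 <= w.1 ->
  leb.-integrable `](0:R), +oo[
    (EFin \o (fun x => expR (- (c * x ^+ 2)) * kernelL w x * x `^ (2 * a + 1))) /\
  \int[leb]_(x in `]0, +oo[) (expR (- (c * x ^+ 2)) * kernelL w x * x `^ (2 * a + 1)) =
  Gamma b1 / 2 * ((c + w.1 / 2) `^ (- b1) * (1 - w.1 / (c + w.1 / 2)) ^+ w.2).
Proof.
case: w => l M /= c0 l0; pose p := c + l / 2.
have p0 : 0 < p by rewrite ltr_wpDr// divr_ge0.
pose A k := laguerre_coef a M k * l ^+ k.
have A0 k : (M < k)%N -> A k = 0 by move=> Mk; rewrite /A /laguerre_coef bin_small// mulr0 !mul0r.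
(* The polynomial is treated as a power series: the binomial coefficient makes [A k] vanish for k >
   M. *)
have cvgA (f : R^nat) : series (fun k => A k * f k) @ \oo --> \sum_(k < M.+1) A k * f k.
  apply: cvg_near_cst.
  exists M.+1 => // n /= Mn; rewrite /series/= (big_cat_nat (n := M.+1))//=.
  rewrite [X in _ + X]big1_seq ?addr0 ?big_mkord// => k.
  by rewrite mem_index_iota => /andP[_ /andP[Mk _]]; rewrite A0 ?mul0r.
pose h (x : R) := \sum_(k < M.+1) A k * (x ^+ 2) ^+ k.
have cabs : cvgn (series (fun k => `|A k| * (pochhammer b1 k / p ^+ k))).
  have := cvgA (fun k => Num.sg (A k) * (pochhammer b1 k / p ^+ k)).
  rewrite (_ : (fun k => _) = (fun k => `|A k| * (pochhammer b1 k / p ^+ k))).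
    by move=> H; apply/cvg_ex; eexists; exact: H.
  by apply/funext => k; rewrite mulrA [A k * _]mulrC -normrEsg.
have [ih ch] := gauss_pseries b1_gt0 p0 cabs (fun x _ => cvgA (fun k => (x ^+ 2) ^+ k)).
have hE x : expR (- (c * x ^+ 2)) * kernelL (l, M) x * x `^ (2 * a + 1) = h x * gauss_weight b1 p x.
  rewrite /kernelL laguerre_funE//= /gauss_weight /p.
  rewrite (_ : 2 * b1 - 1 = 2 * a + 1); last by ring.
  rewrite (_ : - ((c + l / 2) * x ^+ 2) = - (c * x ^+ 2) - (l * x ^+ 2 / 2)); last by field.
  rewrite expRD (_ : h x = \sum_(k < M.+1) laguerre_coef a M k * (l * x ^+ 2) ^+ k); last first.
    by apply: eq_bigr => k _; rewrite /A (exprMn k l) mulrA.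
  ring.
rewrite (_ : (fun x => _) = (fun x => h x * gauss_weight b1 p x)); last first.
  by apply/funext => x; rewrite hE.
split; first exact: ih.
have E : (gauss_mass b1 p)^-1 * \int[leb]_(x in `]0, +oo[) (h x * gauss_weight b1 p x)
    = \sum_(k < M.+1) A k * (pochhammer b1 k / p ^+ k).
  exact: (cvg_unique _ ch (cvgA _)).
rewrite -[LHS](mulVKf (lt0r_neq0 (gauss_mass_gt0 b1_gt0 p0))) E.
rewrite /gauss_mass -/p (_ : \sum_(k < _) _ = (1 - l / p) ^+ M); first by ring.
rewrite exprDn; apply: eq_bigr => k _; rewrite /A /laguerre_coef expr1n mul1r -mulr_natr.
have ? : pochhammer b1 k != 0 by rewrite gt_eqF// pochhammer_gt0// b1_gt0.
rewrite -mulNr exprMn exprVn [(- l) ^+ k]exprNn.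
have ? : p ^+ k != 0 by rewrite gt_eqF// exprn_gt0.
by field; apply/andP.
Qed.

(** After cancellation of the Pochhammer symbols the integrated Bessel series is the exponential
    series at -lambda^2 / (4 d). *)
Let bessel_half d w : 0 < d ->
  leb.-integrable `](0:R), +oo[
    (EFin \o (fun t => expR (- (d * t ^+ 2)) * kernelJ w t * t `^ (2 * a))) /\
  \int[leb]_(t in `]0, +oo[) (expR (- (d * t ^+ 2)) * kernelJ w t * t `^ (2 * a)) =
  Gamma b2 / 2 * (d `^ (- b2) * expR (- (w.1 ^+ 2 / (4 * d)))).
Proof.
case: w => l M /= d0.
pose A k := bessel_coef b2 k * (l ^+ 2 / 4) ^+ k.
have cvgA (t : R) : series (fun k => A k * (t ^+ 2) ^+ k) @ \oo --> kernelJ (l, M) t.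
  have := @cvg_bessel_series R b2 b2_ge ((l * t / 2) ^+ 2).
  rewrite (_ : (fun k => _) = (fun k => A k * (t ^+ 2) ^+ k))//.
  apply/funext => k; rewrite /A (_ : (l * t / 2) ^+ 2 = l ^+ 2 / 4 * t ^+ 2); last by field.
  by rewrite (exprMn k (l ^+ 2 / 4)) mulrA.
have pE k : A k * (pochhammer b2 k / d ^+ k) = exp_coeff (- (l ^+ 2 / (4 * d))) k.
  rewrite /A /bessel_coef /exp_coeff/=.
  have ? : pochhammer b2 k != 0 by rewrite gt_eqF// pochhammer_gt0// b2_gt0.
  have ? : k`!%:R != 0 :> R by rewrite pnatr_eq0 -lt0n fact_gt0.
  have ? : d ^+ k != 0 by rewrite gt_eqF// exprn_gt0.
  rewrite [in RHS]exprNn (_ : l ^+ 2 / (4 * d) = (l ^+ 2 / 4) / d); last by field; rewrite gt_eqF.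
  rewrite [(_ / d) ^+ k]exprMn exprVn; field.
  by apply/and3P.
have cabs : cvgn (series (fun k => `|A k| * (pochhammer b2 k / d ^+ k))).
  rewrite (_ : (fun k => _) = exp_coeff (l ^+ 2 / (4 * d))).
    exact: is_cvg_series_exp_coeff.
  apply/funext => k.
  have q0 : 0 <= pochhammer b2 k / d ^+ k.
    by rewrite divr_ge0 ?exprn_ge0 ?ltW// ?pochhammer_gt0 ?b2_gt0.
  rewrite -[X in _ * X](ger0_norm q0) -normrM pE /exp_coeff/= normrM normfV normrX normrN normr_nat.
  by rewrite ger0_norm// divr_ge0 ?sqr_ge0// mulr_ge0// ltW.
have [ih ch] := gauss_pseries b2_gt0 d0 cabs (fun t _ => cvgA t).
have hE t : expR (- (d * t ^+ 2)) * kernelJ (l, M) t * t `^ (2 * a) = kernelJ (l, M) t * gauss_weight b2 d t.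
  rewrite /gauss_weight (_ : 2 * b2 - 1 = 2 * a); last by field.
  ring.
rewrite (_ : (fun x => _) = (fun x => kernelJ (l, M) x * gauss_weight b2 d x)); last first.
  by apply/funext => x; rewrite hE.
split; first exact: ih.
move: ch; rewrite (_ : (fun k => _) = exp_coeff (- (l ^+ 2 / (4 * d)))); last first.
  by apply/funext => k; rewrite pE.
move=> /cvg_lim => /(_ _)/(congr1 (fun y => gauss_mass b2 d * y)).
rewrite mulVKf ?gt_eqF ?gauss_mass_gt0 ?b2_gt0// => <-//.
by rewrite /gauss_mass -/(expR _); ring.
Qed.

Lemma LB_gauss2 cd w : 0 < cd.1 -> 0 < cd.2 -> 0 <= w.1 ->
  (m_alpha alpha).-integrable setT (EFin \o (fun z => gauss2 cd z * LB_kernel alpha w z)) /\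
  \int[m_alpha alpha]_z (gauss2 cd z * LB_kernel alpha w z) = gauss2_transform cd w.
Proof.
move=> c0 d0 w0.
have [i1 e1] := laguerre_half c0 w0.
have [i2 e2] := bessel_half w d0.
have [i e] := integral_m_alpha
  (measurable_funM (measurable_expsq cd.1) (measurable_kernelL w))
  (measurable_funM (measurable_expsq cd.2) (measurable_kernelJ w)) i1 i2.
have E z : gauss2 cd z * LB_kernel alpha w z =
    (expR (- (cd.1 * z.1 ^+ 2)) * kernelL w z.1) * (expR (- (cd.2 * z.2 ^+ 2)) * kernelJ w z.2).
  by rewrite LB_kernelE /gauss2; ring.
rewrite (_ : (fun z => _) = (fun z => (expR (- (cd.1 * z.1 ^+ 2)) * kernelL w z.1) * (expR (- (cd.2 * z.2 ^+ 2)) * kernelJ w z.2))); last first.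
  by apply/funext => z; rewrite E.
split => //; have p0 : 0 <= cd.1 + w.1 / 2 by rewrite addr_ge0 ?divr_ge0// ltW.
rewrite e e1 e2 /gauss2_transform /gauss2_const powR_inv1//; ring.
Qed.

(** The kernel is identically 1 at lambda = 0, m = 0, so this is a value of the transform. *)
Lemma integral_gauss2 cd : 0 < cd.1 -> 0 < cd.2 ->
  (m_alpha alpha).-integrable setT (EFin \o gauss2 cd) /\
  \int[m_alpha alpha]_z gauss2 cd z = gauss2_const * cd.1 `^ (- b1) * cd.2 `^ (- b2).
Proof.
move=> c0 d0; have [] := @LB_gauss2 cd (0, 0%N) c0 d0 (lexx _).
have k1 z : LB_kernel alpha (0, 0%N) z = 1.
  rewrite LB_kernelE /kernelL /kernelJ/= !mul0r expr0n/= bessel_series0 mulr1.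
  rewrite laguerre_funE//= mul0r oppr0 expR0 mul1r big_ord1 expr0 mulr1.
  by rewrite /laguerre_coef expr0 bin0 pochhammer0 mul1r divr1.
rewrite (_ : (fun z => _) = gauss2 cd); last by apply/funext => z; rewrite k1 mulr1.
move=> i e; split => //; rewrite e /gauss2_transform/= mul0r addr0 expr0 expr0n/= !mul0r oppr0 expR0; ring.
Qed.

End kernel.

(** * Plancherel formula for Gaussian sums *)

Lemma measurable_fun_prodnat d (T : measurableType d) (R : realType) (f : T * nat -> R) :
  (forall n, measurable_fun [set: T] (fun x => f (x, n))) -> measurable_fun [set: T * nat] f.
Proof.
move=> mf _ B mB; rewrite setTI.
rewrite (_ : f @^-1` B = \bigcup_n (((fun x => f (x, n)) @^-1` B) `*` [set n])).
  apply: bigcup_measurable => n _; apply: measurableX => //.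
  by rewrite -[X in measurable X]setTI; exact: mf.
apply/seteqP; split => [[x n] /= Bf|[x n] [k _] /= [Bf ->]//].
by exists n.
Qed.

Lemma cvg_sum (R : realType) (I : Type) (r : seq I) (f : I -> R^nat) (l : I -> R) :
  (forall i, f i @ \oo --> l i) ->
  \sum_(i <- r) f i n @[n --> \oo] --> \sum_(i <- r) l i.
Proof.
move=> fl; elim: r => [|i r ih].
  by rewrite big_nil; under eq_fun do rewrite big_nil; exact: cvg_cst.
by rewrite big_cons; under eq_fun do rewrite big_cons; apply: cvgD => //; exact: fl.
Qed.

Section gamma_integral.
Context {R : realType} (alpha : {nonneg R}).
Local Notation a := (alpha%:num).
Local Notation leb := (@lebesgue_measure R).
Local Notation RM := (measurableTypeR R).
Local Notation b1 := (a + 1).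
Local Notation b2 := (a + 2^-1).

Definition gamma_const : R := (2 `^ (2 * a - 1) * Gamma b2)^-1.

Lemma gamma_const_gt0 : 0 < gamma_const.
Proof. by rewrite invr_gt0 mulr_gt0 ?powR_gt0// Gamma_gt0// b2_gt0. Qed.

(** The sum over the degree is placed inside the integral because the negative binomial series will
    be summed at fixed lambda. *)
Lemma ge0_integral_gamma_alpha (f : R * nat -> R) :
  measurable_fun [set: RM * nat] f -> (forall w, 0 <= f w) ->
  (\int[gamma_alpha alpha]_w (f w)%:E =
   \int[leb]_(l in `]0%R, +oo[) ((gamma_const * l `^ (3 * a + 1))%:E *
     \sum_(0 <= M <oo) ((laguerre a M).[0] * f (l, M))%:E))%E.
Proof.
move=> mf f0; rewrite /gamma_alpha ge0_integral_mweighted; last 2 first.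
- exact/measurable_EFinP.
- by move=> w; rewrite lee_fin.
have mw : measurable_fun [set: RM * nat] (fun w => (f w)%:E * (gamma_weight alpha w)%:E)%E.
  by apply: emeasurable_funM; apply/measurable_EFinP => //; exact: measurable_gamma_weight.
rewrite fubini_tonelli1//; last first.
  by move=> w; rewrite mule_ge0 ?lee_fin ?gamma_weight_ge0.
rewrite integral_itv_obnd_cbnd; last first.
  apply: emeasurable_funM.
    apply: measurable_funTS; apply/measurable_EFinP; exact: measurable_funM.
  apply: ge0_emeasurable_sum => [M l _ _|M _].
    by rewrite lee_fin mulr_ge0// laguerre0_ge0.
  apply: measurable_funTS; apply/measurable_EFinP; apply: measurable_funM => //.
  exact: (measurableT_comp mf (measurable_pair2 M)).
rewrite [RHS]integral_mkcond; apply: eq_integral => l _.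
rewrite /fubini_F patchE ge0_integral_count; last first.
  by move=> M; rewrite mule_ge0 ?lee_fin ?gamma_weight_ge0.
case: ifPn => lK.
  rewrite -nneseriesZl; last by move=> M _; rewrite lee_fin mulr_ge0// laguerre0_ge0.
  apply: eq_eseriesr => M _; rewrite -!EFinM; congr EFin.
  rewrite /gamma_weight -/gamma_const /Khat_space indicE in_setX lK/= in_setT/=; ring.
rewrite eseries0// => M _ _ /=.
by rewrite /gamma_weight /Khat_space indicE in_setX (negbTE lK)/= mulr0 mule0.
Qed.

End gamma_integral.

Section gauss_sums.
Context {R : realType} (alpha : {nonneg R}).
Local Notation a := (alpha%:num).
Local Notation leb := (@lebesgue_measure R).
Local Notation RM := (measurableTypeR R).
Local Notation b1 := (a + 1).
Local Notation b2 := (a + 2^-1).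
Local Notation idx := (R * ({posnum R} * {posnum R}))%type.

Definition params (i : idx) : R * R := (i.2.1%:num, i.2.2%:num).

Definition gsum (s : seq idx) (z : R * R) : R := \sum_(i <- s) i.1 * gauss2 (params i) z.

Definition gsum_transform (s : seq idx) (w : R * nat) : R :=
  \sum_(i <- s) i.1 * gauss2_transform alpha (params i) w.

(** The quadratic form to which the squared norms of a Gaussian sum and of its transform both
    reduce, each with its own constant. *)
Let gram (s : seq idx) : R := \sum_(i <- s) \sum_(j <- s)
  i.1 * j.1 * ((i.2.1%:num + j.2.1%:num) `^ (- b1) * (i.2.2%:num + j.2.2%:num) `^ (- b2)).

Lemma measurable_gsum s : measurable_fun [set: RM * RM] (gsum s).
Proof.
apply: measurable_sum => i; apply: measurable_funM => //; exact: measurable_gauss2.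
Qed.

Lemma measurable_gsum_transform s : measurable_fun [set: RM * nat] (gsum_transform s).
Proof.
apply: measurable_sum => i; apply: measurable_funM => //.
apply: measurable_fun_prodnat => M; rewrite /gauss2_transform/=.
have mq : measurable_fun [set: RM] (fun l : R => i.2.1%:num + l / 2).
  by apply: measurable_funD => //; exact: measurable_funM.
apply: measurable_funM.
  apply: measurable_funM => //; apply: measurable_funM.
    exact: (measurableT_comp (measurable_powR _) mq).
  apply: measurable_funX; apply: measurable_funB => //; apply: measurable_funM => //.
  exact: (measurableT_comp (measurable_powR _) mq).
apply: measurable_funM => //; apply: measurableT_comp => //; apply: measurable_funN.
by apply: measurable_funM => //; exact: measurable_funX.
Qed.

Let integral_gsum_sqr s :
  sqint (m_alpha alpha) (gsum s) = (gauss2_const alpha * gram s)%:E.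
Proof.
pose g (i j : idx) := gauss2 (i.2.1%:num + j.2.1%:num, i.2.2%:num + j.2.2%:num).
have gg (i j : idx) : (m_alpha alpha).-integrable setT (EFin \o g i j) /\
   \int[m_alpha alpha]_z g i j z = gauss2_const alpha *
     (i.2.1%:num + j.2.1%:num) `^ (- b1) * (i.2.2%:num + j.2.2%:num) `^ (- b2).
  by apply: (@integral_gauss2 R alpha (_, _)) => /=; rewrite addr_gt0.
have sq z : gsum s z ^+ 2 = \sum_(i <- s) \sum_(j <- s) i.1 * j.1 * g i j z.
  rewrite expr2 /gsum mulr_suml; apply: eq_bigr => i _; rewrite mulr_sumr.
  apply: eq_bigr => j _; rewrite /g /gauss2/= mulrDl opprD expRD [in expR (- ((_ + _) * z.2 ^+ 2))]mulrDl opprD expRD.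
  ring.
rewrite /sqint; under eq_integral => z _.
  rewrite sq -sumEFin.
  under eq_bigr do rewrite -sumEFin.
  over.
have iz (i j : idx) : (m_alpha alpha).-integrable setT (fun z => (i.1 * j.1 * g i j z)%:E).
  by under eq_fun do rewrite EFinM; apply: integrableZl => //; exact: (gg i j).1.
rewrite integral_sum//; last by move=> i; apply: integrable_sum => // j _; exact: iz.
rewrite /gram mulr_sumr -sumEFin; apply: eq_bigr => i _.
rewrite integral_sum// mulr_sumr -sumEFin; apply: eq_bigr => j _.
under eq_integral do rewrite EFinM.
rewrite integralZl//; last exact: (gg i j).1.
rewrite -(fineK (integrable_fin_num measurableT (gg i j).1)) -EFinM; congr EFin.
by rewrite [fine _](gg i j).2; ring.
Qed.

Let gK : R := gamma_const alpha * gauss2_const alpha ^+ 2 * (Gamma b2 / 2) * 4 `^ b2.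

(** With [P], [Q] and [T] the transform of the i-th Gaussian at (l, M) reads [T i l * Q i l ^+ M], a
    geometric sequence in M. *)
Let P (i : idx) (l : R) : R := i.2.1%:num + l / 2.
Let Q (i : idx) (l : R) : R := 1 - l / P i l.
Let T (i : idx) (l : R) : R := gauss2_const alpha * P i l `^ (- b1) *
  (i.2.2%:num `^ (- b2) * expR (- (l ^+ 2 / (4 * i.2.2%:num)))).

Let P_gt0 i l : 0 < l -> 0 < P i l.
Proof. by move=> l0; rewrite addr_gt0// divr_gt0. Qed.

Let transformE s l M : 0 < l ->
  gsum_transform s (l, M) = \sum_(i <- s) i.1 * (T i l * Q i l ^+ M).
Proof.
move=> l0; apply: eq_bigr => i _; congr (_ * _).
rewrite /gauss2_transform/= -/(P i l) powR_inv1 ?(ltW (P_gt0 i l0))//.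
by rewrite -/(Q i l) /T; ring.
Qed.

Let Q_lt1 i l : 0 < l -> `|Q i l| < 1.
Proof.
move=> l0; have p0 := P_gt0 i l0; rewrite ltr_norml /Q.
have : l / P i l < 2.
  have c0 : 0 < i.2.1%:num by [].
  by rewrite ltr_pdivrMr// /P; lra.
have : 0 < l / P i l by rewrite divr_gt0.
by lra.
Qed.

Let QQ_lt1 i j l : 0 < l -> `|Q i l * Q j l| < 1.
Proof.
move=> l0; rewrite normrM mulr_ilt1//; exact: Q_lt1.
Qed.

(* The generating series of the L_M^alpha(0) is a negative binomial series, which
   sums the product of the M-th powers of two Gaussian transforms. *)
Let inner s l : 0 < l ->
  (\sum_(0 <= M <oo) ((laguerre a M).[0] * gsum_transform s (l, M) ^+ 2)%:E)%E =
  (\sum_(i <- s) \sum_(j <- s) i.1 * j.1 * (T i l * T j l) * (1 - Q i l * Q j l) `^ (- b1))%:E.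
Proof.
move=> l0; apply/cvg_lim => //.
pose u M := (laguerre a M).[0] * gsum_transform s (l, M) ^+ 2.
rewrite (_ : (fun n => _) = EFin \o series u); last first.
  by apply/funext => n; rewrite /series/= -sumEFin.
apply: cvg_EFin; first exact: nearW.
have uE n : series u n = \sum_(i <- s) \sum_(j <- s) i.1 * j.1 * (T i l * T j l) *
    series (fun M => pochhammer b1 M / M`!%:R * (Q i l * Q j l) ^+ M) n.
  rewrite /series/=; under eq_bigr => M _.
    rewrite /u laguerre_horner0 transformE// expr2 mulr_suml mulr_sumr.
    under eq_bigr do rewrite mulr_sumr mulr_sumr.
    over.
  rewrite exchange_big/=; apply: eq_bigr => i _.
  rewrite exchange_big/=; apply: eq_bigr => j _.
  rewrite mulr_sumr; apply: eq_bigr => M _.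
  by rewrite exprMn; ring.
rewrite (_ : series u = fun n => \sum_(i <- s) \sum_(j <- s) i.1 * j.1 * (T i l * T j l) *
    series (fun M => pochhammer b1 M / M`!%:R * (Q i l * Q j l) ^+ M) n); last exact/funext.
apply: cvg_sum => i; apply: cvg_sum => j.
apply: cvgM; first exact: cvg_cst.
apply: negative_binomial_series; [exact: b1_gt0|exact: QQ_lt1].
Qed.

(** The coefficient 1/(4 d_i) + 1/(4 d_j) of l^2 in the product of two transforms. *)
Let rho (i j : idx) : R := (i.2.2%:num + j.2.2%:num) / (4 * (i.2.2%:num * j.2.2%:num)).

Let rho_gt0 i j : 0 < rho i j.
Proof. by rewrite divr_gt0// mulr_gt0. Qed.

(** The key identity is P_i P_j (1 - Q_i Q_j) = l (c_i + c_j): it separates l from the parameters.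
    The remaining power of l is (3 alpha + 1) - (alpha + 1) = 2 alpha, the weight of a Gaussian
    moment. *)
Let pointwise (i j : idx) l : 0 < l ->
  gamma_const alpha * l `^ (3 * a + 1) * ((T i l * T j l) * (1 - Q i l * Q j l) `^ (- b1)) =
  gamma_const alpha * gauss2_const alpha ^+ 2 *
   ((i.2.1%:num + j.2.1%:num) `^ (- b1) * (i.2.2%:num * j.2.2%:num) `^ (- b2)) *
  gauss_weight b2 (rho i j) l.
Proof.
move=> l0; have pi0 := P_gt0 i l0; have pj0 := P_gt0 j l0.
have c0 : 0 < i.2.1%:num + j.2.1%:num by rewrite addr_gt0.
have E1 : P i l `^ (- b1) * P j l `^ (- b1) * (1 - Q i l * Q j l) `^ (- b1) =
    l `^ (- b1) * (i.2.1%:num + j.2.1%:num) `^ (- b1).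
  have q0 : 0 <= 1 - Q i l * Q j l.
    by rewrite subr_ge0 (le_trans (ler_norm _))// ltW// QQ_lt1.
  rewrite -!powRM ?mulr_ge0 ?(ltW pi0) ?(ltW pj0) ?(ltW l0) ?(ltW c0)//.
  congr (_ `^ _); rewrite /Q.
  have ? : P i l != 0 by rewrite gt_eqF.
  have ? : P j l != 0 by rewrite gt_eqF.
  transitivity (l * (P i l + P j l - l)); first by field; apply/andP.
  by rewrite /P; field.
have E2 : expR (- (l ^+ 2 / (4 * i.2.2%:num))) * expR (- (l ^+ 2 / (4 * j.2.2%:num))) =
    expR (- (rho i j * l ^+ 2)).
  rewrite -expRD; congr expR; rewrite /rho; field.
  by rewrite !gt_eqF.
have E3 : l `^ (3 * a + 1) * l `^ (- b1) = l `^ (2 * b2 - 1).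
  rewrite -powRD ?(gt_eqF l0) ?implybT//; congr (_ `^ _); lra.
rewrite /gauss_weight -E3 -E2 powRM// /T.
transitivity (gamma_const alpha * gauss2_const alpha ^+ 2 * l `^ (3 * a + 1) *
  (P i l `^ (- b1) * P j l `^ (- b1) * (1 - Q i l * Q j l) `^ (- b1)) *
  (i.2.2%:num `^ (- b2) * j.2.2%:num `^ (- b2)) * (expR (- (l ^+ 2 / (4 * i.2.2%:num))) * expR (- (l ^+ 2 / (4 * j.2.2%:num))))).
  by ring.
by rewrite E1; ring.
Qed.

Let sqint_transform s :
  sqint (gamma_alpha alpha) (gsum_transform s) = (gK * gram s)%:E.
Proof.
rewrite /sqint (@ge0_integral_gamma_alpha R alpha (fun w => gsum_transform s w ^+ 2)); last 2 first.
- by apply: measurable_funX; exact: measurable_gsum_transform.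
- by move=> w; exact: sqr_ge0.
pose k (i j : idx) := gamma_const alpha * gauss2_const alpha ^+ 2 *
   ((i.2.1%:num + j.2.1%:num) `^ (- b1) * (i.2.2%:num * j.2.2%:num) `^ (- b2)) * (i.1 * j.1).
have pw (i j : idx) l : 0 < l -> gamma_const alpha * l `^ (3 * a + 1) *
    (i.1 * j.1 * (T i l * T j l) * (1 - Q i l * Q j l) `^ (- b1)) =
    k i j * gauss_weight b2 (rho i j) l.
  move=> l0; transitivity (i.1 * j.1 * (gamma_const alpha * l `^ (3 * a + 1) *
    ((T i l * T j l) * (1 - Q i l * Q j l) `^ (- b1)))); first by ring.
  by rewrite pointwise// /k; ring.
under eq_integral => l.
  rewrite inE/= in_itv/= andbT => l0.
  rewrite inner// -EFinM mulr_sumr -sumEFin.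
  under eq_bigr => i _.
    rewrite mulr_sumr -sumEFin.
    under eq_bigr => j _.
      rewrite pw//.
      over.
    over.
  over.
have ig i j : leb.-integrable `](0:R), +oo[ (EFin \o gauss_weight b2 (rho i j)).
  apply/integrableP; split.
    by apply: measurable_funTS; apply/measurable_EFinP; exact: measurable_gauss_weight.
  under eq_integral do rewrite /= ger0_norm ?gauss_weight_ge0//.
  by rewrite (gauss_moment (b2_gt0 alpha) (rho_gt0 i j)) ltry.
have ik i j : leb.-integrable `](0:R), +oo[ (fun l => (k i j * gauss_weight b2 (rho i j) l)%:E).
  have := @integrableZl _ _ _ leb _ (measurable_itv _) (k i j) _ (ig i j); exact.
rewrite integral_sum//; last by move=> i; apply: integrable_sum => // j _; exact: ik.
rewrite /gram mulr_sumr -sumEFin; apply: eq_bigr => i _.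
rewrite integral_sum// mulr_sumr -sumEFin; apply: eq_bigr => j _.
under eq_integral do rewrite EFinM.
rewrite integralZl//; last exact: ig.
rewrite (gauss_moment (b2_gt0 alpha) (rho_gt0 i j)) -EFinM; congr EFin.
rewrite /k /gK.
have d0 : 0 < i.2.2%:num + j.2.2%:num by rewrite addr_gt0.
(* The product d_i d_j times [rho i j] is (d_i + d_j)/4, which recovers the second factor of the
   Gram form. *)
have E : (i.2.2%:num * j.2.2%:num) `^ (- b2) * rho i j `^ (- b2) =
    4 `^ b2 * (i.2.2%:num + j.2.2%:num) `^ (- b2).
  have E4 : 4 `^ b2 = (4^-1) `^ (- b2) :> R by rewrite -powR_inv1// -powRrM mulrNN mul1r.
  rewrite E4 -!powRM ?(ltW d0) ?(ltW (rho_gt0 i j)) ?invr_ge0//.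
  congr (_ `^ _); rewrite /rho; field.
  by rewrite !gt_eqF.
transitivity (gamma_const alpha * gauss2_const alpha ^+ 2 * (Gamma b2 / 2) * (i.1 * j.1) *
  (i.2.1%:num + j.2.1%:num) `^ (- b1) * ((i.2.2%:num * j.2.2%:num) `^ (- b2) * rho i j `^ (- b2))).
  by ring.
by rewrite E; ring.
Qed.

Definition plancherel_const : R := gamma_const alpha * gauss2_const alpha * (Gamma b2 / 2) * 4 `^ b2.

Lemma plancherel_const_gt0 : 0 < plancherel_const.
Proof.
apply: mulr_gt0; last exact: powR_gt0.
apply: mulr_gt0; last by apply: divr_gt0 => //; apply: Gamma_gt0; exact: b2_gt0.
by apply: mulr_gt0; [exact: gamma_const_gt0|exact: gauss2_const_gt0].
Qed.

Lemma plancherel_gsum s : sqint (gamma_alpha alpha) (gsum_transform s) =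
  (plancherel_const%:E * sqint (m_alpha alpha) (gsum s))%E.
Proof.
rewrite sqint_transform integral_gsum_sqr -EFinM; congr EFin.
by rewrite /gK /plancherel_const; ring.
Qed.

End gauss_sums.

(** * Approximation in L^1 and L^2 *)

Section L1L2_distance.
Context d (T : measurableType d) (R : realType).
Variable mu : {measure set T -> \bar R}.
Implicit Types u v h : T -> R.

(* Controls the L^1 and the L^2 norms at once. *)
Definition mass12 h : \bar R := (\int[mu]_x (`|h x| + h x ^+ 2)%:E)%E.

Let mass12_int_ge0 h x : 0 <= `|h x| + h x ^+ 2.
Proof. by rewrite addr_ge0// sqr_ge0. Qed.

Let mmass12 h : measurable_fun [set: T] h ->
  measurable_fun [set: T] (fun x => (`|h x| + h x ^+ 2)%:E).
Proof.
move=> mh; apply/measurable_EFinP; apply: measurable_funD; first exact: measurableT_comp.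
exact: measurable_funX.
Qed.

Lemma mass12_ge0 h : (0 <= mass12 h)%E.
Proof. by apply: integral_ge0 => x _; rewrite lee_fin. Qed.

Lemma le_mass12 u v : measurable_fun [set: T] u -> measurable_fun [set: T] v ->
  (forall x, `|u x| <= `|v x|) -> (mass12 u <= mass12 v)%E.
Proof.
move=> mu' mv uv; apply: ge0_le_integral => //.
- by move=> x _; rewrite lee_fin.
- exact: mmass12.
- exact: mmass12.
move=> x _; rewrite lee_fin; apply: lerD; first exact: uv.
by rewrite -[leLHS]real_normK ?num_real// -[leRHS]real_normK ?num_real// lerXn2r// nnegrE.
Qed.

Lemma mass12D u v h : measurable_fun [set: T] u -> measurable_fun [set: T] v ->
  measurable_fun [set: T] h -> (forall x, `|h x| <= `|u x| + `|v x|) ->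
  (mass12 h <= 2%:E * (mass12 u + mass12 v))%E.
Proof.
move=> mu' mv mh huv.
rewrite -ge0_integralD//; last 4 first.
- by move=> x _; rewrite lee_fin.
- exact: mmass12.
- by move=> x _; rewrite lee_fin.
- exact: mmass12.
rewrite -ge0_integralZl//; last 2 first.
- by apply: emeasurable_funD; exact: mmass12.
- by move=> x _; rewrite adde_ge0 ?lee_fin.
apply: ge0_le_integral => //.
- by move=> x _; rewrite lee_fin.
- exact: mmass12.
- by apply: measurable_funeM; apply: emeasurable_funD; exact: mmass12.
move=> x _; rewrite -EFinD -EFinM lee_fin.
have : h x ^+ 2 <= (`|u x| + `|v x|) ^+ 2.
  by rewrite -[leLHS]real_normK ?num_real// lerXn2r// nnegrE addr_ge0.
have := huv x.
rewrite -(real_normK (num_real (u x))) -(real_normK (num_real (v x))).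
have := normr_ge0 (u x); have := normr_ge0 (v x).
set p := `|u x|; set q := `|v x| => q0 p0 h1 h2.
have := sqr_ge0 (p - q); nra.
Qed.

Lemma mass12_scale (c : R) u : measurable_fun [set: T] u ->
  (mass12 (fun x => (c * u x)%R) <= (`|c| + c ^+ 2)%:E * mass12 u)%E.
Proof.
move=> mu'; rewrite -ge0_integralZl; [|exact: measurableT|exact: mmass12|
  by move=> x _; rewrite lee_fin|by rewrite lee_fin addr_ge0// sqr_ge0].
apply: ge0_le_integral => //.
- by move=> x _; rewrite lee_fin addr_ge0// sqr_ge0.
- by apply: mmass12; exact: measurable_funM.
- by apply: measurable_funeM; exact: mmass12.
move=> x _; rewrite -EFinM lee_fin normrM exprMn mulrDl !mulrDr.
have := normr_ge0 c; have := normr_ge0 (u x); have := sqr_ge0 c; have := sqr_ge0 (u x).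
nra.
Qed.

Lemma mass12_dct (f : nat -> T -> R) (g U : T -> R) :
  (forall n, measurable_fun [set: T] (f n)) -> measurable_fun [set: T] g ->
  measurable_fun [set: T] U ->
  (mass12 U < +oo)%E -> (forall n x, `|f n x - g x| <= U x) ->
  {ae mu, forall x, f n x @[n --> \oo] --> g x} ->
  mass12 (fun x => f n x - g x) @[n --> \oo] --> 0%E.
Proof.
move=> mf mg mU Uoo fgU fg.
have mfg n : measurable_fun [set: T] (fun x => (`|f n x - g x| + (f n x - g x) ^+ 2)%:E).
  by apply: mmass12; exact: measurable_funB.
have iU : mu.-integrable setT (fun x => (`|U x| + U x ^+ 2)%:E).
  apply/integrableP; split; first exact: mmass12.
  by under eq_integral do rewrite gee0_abs ?lee_fin//.
have cae : {ae mu, forall x, setT x ->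
    (`|f n x - g x| + (f n x - g x) ^+ 2)%:E @[n --> \oo] --> cst 0%E x}.
  apply: filterS fg => x fgx _.
  have h0 : f n x - g x @[n --> \oo] --> 0.
    by rewrite -(subrr (g x)); apply: cvgB => //; exact: cvg_cst.
  apply: cvg_EFin; first exact: nearW.
  rewrite -[X in _ --> X](addr0 0) -[X in _ --> X + _](normr0 R) -[X in _ --> _ + X](mul0r 0).
  apply: cvgD; first exact: cvg_norm.
  by under eq_fun do rewrite expr2; exact: cvgM.
have bae : {ae mu, forall x n, setT x -> (`|(`|f n x - g x| + (f n x - g x) ^+ 2)%R%:E| <= (`|U x| + U x ^+ 2)%R%:E)%E}.
  apply: aeW => x n _; rewrite gee0_abs lee_fin; last first.
    exact: (mass12_int_ge0 (fun x => f n x - g x)).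
  have Ux0 : 0 <= U x by exact: le_trans (fgU n x).
  apply: lerD; first by rewrite (ger0_norm Ux0).
  rewrite -[leLHS]real_normK ?num_real// lerXn2r// nnegrE//; exact: fgU.
have [_ _] := dominated_convergence measurableT mfg (measurable_cst _) cae iU bae.
by rewrite integral0.
Qed.

Lemma sqint_le_mass12 h : measurable_fun [set: T] h -> (sqint mu h <= mass12 h)%E.
Proof.
move=> mh; apply: ge0_le_integral => //.
- by move=> x _; rewrite lee_fin sqr_ge0.
- exact: measurable_sqr.
- exact: mmass12.
by move=> x _; rewrite lee_fin lerDr.
Qed.

Lemma normr_le_mass12 h : measurable_fun [set: T] h -> (\int[mu]_x `|(h x)%:E| <= mass12 h)%E.
Proof.
move=> mh; apply: ge0_le_integral => //.
- by apply: measurableT_comp => //; exact/measurable_EFinP.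
- exact: mmass12.
by move=> x _; rewrite lee_fin lerDl sqr_ge0.
Qed.

Lemma mass12_integrable h : measurable_fun [set: T] h -> (mass12 h < +oo)%E ->
  mu.-integrable setT (EFin \o h).
Proof.
move=> mh hoo; apply/integrableP; split; first exact/measurable_EFinP.
exact: le_lt_trans (normr_le_mass12 mh) hoo.
Qed.

End L1L2_distance.

Section approximation.
Context d (T : measurableType d) (R : realType).
Variable mu : {measure set T -> \bar R}.
Variable D : set (T -> R).
Hypothesis mD : forall g, D g -> measurable_fun [set: T] g.
Hypothesis D0 : D (cst 0).
Hypothesis DD : forall f g, D f -> D g -> D (fun x => f x + g x).
Hypothesis DZ : forall (c : R) g, D g -> D (fun x => c * g x).

Definition approximable (h : T -> R) : Prop :=
  forall e : R, 0 < e -> exists2 g, D g & (mass12 mu (fun x => (h x - g x)%R) <= e%:E)%E.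

Let approx0 : approximable (cst 0).
Proof.
move=> e e0; exists (cst 0) => //.
rewrite /mass12; under eq_integral do rewrite subrr normr0 expr0n addr0.
by rewrite integral0 lee_fin ltW.
Qed.

Let approxD u v : measurable_fun [set: T] u -> measurable_fun [set: T] v ->
  approximable u -> approximable v -> approximable (fun x => u x + v x).
Proof.
move=> mu' mv au av e e0.
have e4 : 0 < e / 4 by rewrite divr_gt0.
have [f Df fu] := au _ e4; have [g Dg gv] := av _ e4.
have mf := mD Df; have mg := mD Dg.
exists (fun x => f x + g x); first exact: DD.
apply: (@le_trans _ _ (2%:E * (mass12 mu (fun x => u x - f x)%R + mass12 mu (fun x => v x - g x)%R)))%E.
  apply: mass12D; do ?[apply: measurable_funB => //|exact: measurable_funD].
  by move=> x; rewrite opprD addrACA ler_normD.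
rewrite (_ : e%:E = 2%:E * ((e / 4)%:E + (e / 4)%:E))%E; last first.
  by rewrite -EFinD -EFinM; congr EFin; field.
by rewrite lee_wpmul2l ?lee_fin// leeD.
Qed.

Let approxZ (c : R) u : measurable_fun [set: T] u ->
  approximable u -> approximable (fun x => c * u x).
Proof.
move=> mu' au e e0.
pose k : R := `|c| + c ^+ 2 + 1.
have k0 : 0 < k by rewrite ltr_wpDl// addr_ge0// sqr_ge0.
have [g Dg gu] := au (e / k) (divr_gt0 e0 k0).
have mg := mD Dg.
exists (fun x => c * g x); first exact: DZ.
have mug : measurable_fun [set: T] (fun x => u x - g x) by exact: measurable_funB.
rewrite (_ : (fun x => _) = (fun x => c * (u x - g x))); last first.
  by apply/funext => x; rewrite mulrBr.
apply: (le_trans (mass12_scale mu c mug)).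
apply: (@le_trans _ _ (k%:E * (e / k)%:E)%E).
  apply: lee_pmul => //; first by rewrite lee_fin addr_ge0// sqr_ge0.
    exact: mass12_ge0.
  by rewrite lee_fin lerDl.
by rewrite -EFinM mulrCA mulfV ?mulr1// gt_eqF.
Qed.

Lemma approxB u v : measurable_fun [set: T] u -> measurable_fun [set: T] v ->
  approximable u -> approximable v -> approximable (fun x => u x - v x).
Proof.
move=> mu' mv au av.
rewrite (_ : (fun x => _) = (fun x => u x + (-1) * v x)); last first.
  by apply/funext => x; rewrite mulN1r.
apply: approxD => //; first exact: measurable_funM.
exact: approxZ.
Qed.

Let approx_sum (I : Type) (r : seq I) (u : I -> T -> R) :
  (forall i, measurable_fun [set: T] (u i)) -> (forall i, approximable (u i)) ->
  approximable (fun x => \sum_(i <- r) u i x).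
Proof.
move=> mu' au; elim: r => [|i r ih].
  by rewrite (_ : (fun x => _) = cst 0)//; apply/funext => x; rewrite big_nil.
rewrite (_ : (fun x => _) = (fun x => u i x + \sum_(j <- r) u j x)); last first.
  by apply/funext => x; rewrite big_cons.
by apply: approxD => //; exact: measurable_sum.
Qed.

(** Dominated convergence makes [mass12 mu (u n - h)] small for some n, and [u n] is then
    approximated within the class. *)
Lemma approx_lim (u : nat -> T -> R) (h U : T -> R) :
  (forall n, measurable_fun [set: T] (u n)) -> measurable_fun [set: T] h ->
  measurable_fun [set: T] U ->
  (mass12 mu U < +oo)%E -> (forall n x, `|u n x - h x| <= U x) ->
  {ae mu, forall x, u n x @[n --> \oo] --> h x} ->
  (forall n, approximable (u n)) -> approximable h.
Proof.
move=> mu' mh mU Uoo uhU uh au e e0.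
have e4 : 0 < e / 4 by rewrite divr_gt0.
have c := mass12_dct mu' mh mU Uoo uhU uh.
have [N un] : exists n, (mass12 mu (fun x => u n x - h x)%R <= (e / 4)%:E)%E.
  move/fine_cvgP : c => [cfin /cvgrPdist_le /(_ _ e4) cl].
  have [n _ /(_ n (leqnn n)) [/= finn]] := filterI cfin cl.
  rewrite sub0r normrN => dn; exists n; rewrite -(fineK finn) lee_fin.
  exact: le_trans (ler_norm _) dn.
have [g Dg gu] := au N _ e4; have mg := mD Dg.
exists g => //.
apply: (@le_trans _ _ (2%:E * (mass12 mu (fun x => u N x - h x)%R + mass12 mu (fun x => u N x - g x)%R)))%E.
  apply: mass12D; do ?exact: measurable_funB.
  move=> x; rewrite -[`|u N x - h x|]normrN; apply: le_trans (ler_normD _ _).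
  by rewrite opprB addrA subrK.
rewrite (_ : e%:E = 2%:E * ((e / 4)%:E + (e / 4)%:E))%E; last first.
  by rewrite -EFinD -EFinM; congr EFin; field.
by rewrite lee_wpmul2l ?lee_fin// leeD.
Qed.

Variable G : set (set T).
Hypothesis GE : @measurable _ T = <<s G >>.
Hypothesis GI : setI_closed G.
Variable B : nat -> set T.
Hypothesis GB : forall n, G (B n).
Hypothesis ndB : {homo B : m n / (m <= n)%N >-> m `<=` n}.
Hypothesis BT : \bigcup_n B n = [set: T].
Hypothesis Bfin : forall n, (mass12 mu (\1_(B n) : T -> R) < +oo)%E.
Hypothesis GA : forall A, G A -> approximable \1_A.

Let mB n : measurable (B n).
Proof. by rewrite GE; exact: sub_sigma_algebra. Qed.

Let mG A : G A -> measurable A.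
Proof. by move=> GA'; rewrite GE; exact: sub_sigma_algebra. Qed.

(** Dynkin's theorem; the intersection with [B n] keeps the mass finite, so complements become
    differences and the indicator of [B n] dominates disjoint unions. *)
Let approx_indic n (A : set T) : measurable A -> approximable \1_(A `&` B n).
Proof.
rewrite GE => sA.
apply: (@dynkin_induction _ T G (fun A => approximable \1_(A `&` B n))) => //.
- by rewrite setTI; exact: GA.
- by move=> X GX; apply: GA; exact: GI.
- move=> X mX aX.
  rewrite (_ : \1_(~` X `&` B n) = (fun x => \1_(B n) x - \1_(X `&` B n) x)); last first.
    apply/funext => x; rewrite !indicE !in_setI in_setC.
    by case: (x \in X); case: (x \in B n); rewrite /= ?subrr ?subr0.
  apply: approxB => //; [by apply: measurable_indic; exact: measurableI|exact: GA].
- move=> F mF tF aF.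
  (* By disjointness at most one term is nonzero: the partial sums jump once, after the index j of
     the set containing x. *)
  have sumE x : (exists j, forall N,
      \sum_(0 <= k < N) (\1_(F k `&` B n) x : R) = ((j < N)%N && (x \in B n))%:R)
        /\ x \in \bigcup_k F k \/ (forall N, \sum_(0 <= k < N) (\1_(F k `&` B n) x : R) = 0)
        /\ x \notin \bigcup_k F k.
    have [xF|xF] := boolP (x \in \bigcup_k F k); [left|right]; split => //.
      move: xF; rewrite inE => -[j _ Fjx]; exists j => N.
      have Fk k : x \in F k = (k == j).
        apply/idP/eqP => [|->]; last by rewrite inE.
        by rewrite inE => Fkx; apply: tF => //; exists x.
      elim: N => [|N ih]; first by rewrite big_nil.
      rewrite big_nat_recr//= ih indicE in_setI Fk.
      case: (x \in B n); rewrite ?andbF ?addr0// !andbT ltnS [in RHS]leq_eqVlt eq_sym.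
      by have [->|_] := eqVneq j N; rewrite ?ltnn ?add0r ?addr0.
    move=> N; rewrite big1// => k _; rewrite indicE in_setI.
    rewrite memNset// => Fkx; move: xF; rewrite notin_setE; apply; by exists k.
  apply: (@approx_lim (fun N x => \sum_(0 <= k < N) \1_(F k `&` B n) x) _ (\1_(B n))).
  - by move=> N; apply: measurable_sum => k; apply: measurable_indic; exact: measurableI.
  - by apply: measurable_indic; apply: measurableI => //; exact: bigcup_measurable.
  - exact: measurable_indic.
  - exact: Bfin.
  - move=> N x; rewrite !indicE in_setI.
    case: (sumE x) => -[].
      move=> [j ->] ->; case: (x \in B n); rewrite /= ?andbT ?andbF ?subrr ?normr0//.
      by case: (j < N)%N; rewrite ?subrr ?normr0// sub0r normrN normr1.
    by move=> -> /negbTE ->; rewrite subrr normr0.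
  - apply: aeW => x; rewrite indicE in_setI; case: (sumE x) => -[].
      move=> [j sj] ->; apply: cvg_near_cst; exists j.+1 => // N /= jN.
      by rewrite sj jN.
    by move=> s0 /negbTE ->; under eq_fun do rewrite s0; exact: cvg_cst.
  - by move=> N; apply: approx_sum => // k; apply: measurable_indic; exact: measurableI.
Qed.

Let approx_ge0 (h : T -> R) : measurable_fun [set: T] h -> (forall x, 0 <= h x) ->
  (mass12 mu h < +oo)%E -> approximable h.
Proof.
move=> mh h0 hoo.
have mhE : measurable_fun [set: T] (EFin \o h) by exact/measurable_EFinP.
have h0E x : [set: T] x -> (0 <= (EFin \o h) x)%E by rewrite lee_fin.
pose s := nnsfun_approx measurableT mhE.
have sh n x : s n x <= h x.
  by have := le_approx n h0E (I : [set: T] x); rewrite -(nnsfun_approxE measurableT mhE).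
(* Simple functions below h, cut off to the exhausting sets; h itself dominates the error. *)
apply: (@approx_lim (fun n x => s n x * \1_(B n) x) _ h) => //.
- by move=> n; apply: measurable_funM => //; exact: measurable_indic.
- move=> n x; rewrite distrC ger0_norm ?subr_ge0.
    by rewrite gerBl mulr_ge0.
  apply: le_trans (sh n x); rewrite indicE; case: (x \in B n); rewrite ?mulr1 ?mulr0//.
- apply: aeW => x; rewrite -[X in _ --> X]mulr1; apply: cvgM.
    by have /fine_cvg := cvg_nnsfun_approx measurableT mhE h0E (I : [set: T] x).
  apply: cvg_near_cst.
  have : (\bigcup_n B n) x by rewrite BT.
  move=> [N _ BNx]; exists N => // n /= Nn.
  by rewrite indicE mem_set//; exact: ndB BNx.
- move=> n.
  rewrite (_ : (fun x => _) = (fun x => \sum_(y <- finmap.enum_fset (fset_set (range (s n))))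
      (y * \1_((s n @^-1` [set y]) `&` B n) x))); last first.
    apply/funext => x; rewrite [in LHS](fimfunE (s n)) fsbig_finite//= mulr_suml.
    apply: eq_bigr => y _; rewrite -mulrA; congr (_ * _).
    by rewrite !indicE in_setI; case: (_ \in _); case: (_ \in _); rewrite /= ?mulr1 ?mulr0.
  apply: approx_sum => y.
    apply: measurable_funM => //; apply: measurable_indic; exact: measurableI.
  apply: approxZ; last exact: approx_indic.
  by apply: measurable_indic; exact: measurableI.
Qed.

Lemma approximable_dense h : measurable_fun [set: T] h -> (mass12 mu h < +oo)%E ->
  approximable h.
Proof.
move=> mh hoo.
pose p (x : T) : R := (`|h x| + h x) / 2; pose q (x : T) : R := (`|h x| - h x) / 2.
rewrite (_ : h = (fun x => p x - q x)); last by apply/funext => x; rewrite /p /q; field.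
have mp : measurable_fun [set: T] p.
  by apply: measurable_funM => //; apply: measurable_funD => //; exact: measurableT_comp.
have mq : measurable_fun [set: T] q.
  by apply: measurable_funM => //; apply: measurable_funB => //; exact: measurableT_comp.
have hn x : - h x <= `|h x| by rewrite -normrN ler_norm.
have hp x : h x <= `|h x| by exact: ler_norm.
have p0 x : 0 <= p x by rewrite /p; have := hn x; lra.
have q0 x : 0 <= q x by rewrite /q; have := hp x; lra.
apply: approxB => //; apply: approx_ge0 => //.
- apply: le_lt_trans hoo; apply: le_mass12 => // x.
  by rewrite ger0_norm// /p; have := hp x; lra.
- apply: le_lt_trans hoo; apply: le_mass12 => // x.
  by rewrite ger0_norm// /q; have := hn x; lra.
Qed.

End approximation.

(** * Density of Gaussian sums *)

Lemma bernoulli_le (R : realType) (u : R) (M : nat) : 0 <= u <= 1 -> 1 - (1 - u) ^+ M <= M%:R * u.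
Proof.
move=> /andP[u0 u1]; elim: M => [|M ih]; first by rewrite expr0 subrr mul0r.
have : 0 <= (1 - u) ^+ M <= 1 by rewrite exprn_ge0 ?subr_ge0//= exprn_ile1 ?subr_ge0 ?lerBlDr ?lerDl.
rewrite exprS -natr1; nra.
Qed.

Section bump.
Context {R : realType}.
Variable p : R.
Hypothesis p0 : 0 <= p.

Let k (n : nat) : R := n.+1%:R.
Let N (n : nat) : nat := (Num.truncn (k n * expR (k n * p ^+ 2))).+1.

(* With y = exp(-x^2) and theta = exp(-p^2), this is 1 - (1 - y^k)^N for
   N ~ k theta^(-k), which tends to 1 if y >= theta and to 0 if y < theta. *)
Definition bump (n : nat) (x : R) : R := 1 - (1 - expR (- (k n * x ^+ 2))) ^+ N n.

Let k_gt0 n : 0 < k n. Proof. by rewrite /k. Qed.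

Let N_ge n : k n * expR (k n * p ^+ 2) <= (N n)%:R.
Proof.
have /truncn_itv/andP[_ /ltW] : 0 <= k n * expR (k n * p ^+ 2).
  by rewrite mulr_ge0 ?expR_ge0.
exact.
Qed.

Let N_le n : (N n)%:R <= k n * expR (k n * p ^+ 2) + 1.
Proof.
have /truncn_itv/andP[H _] : 0 <= k n * expR (k n * p ^+ 2).
  by rewrite mulr_ge0 ?expR_ge0.
by rewrite /N -natr1 lerD2r.
Qed.

(** Subtracting the binomial expansion from 1 cancels the constant term, so only exponentials with a
    positive parameter are left. *)
Lemma bump_sum n : exists (M : nat) (c : nat -> R), forall x,
  bump n x = \sum_(j < M) c j * expR (- ((n.+1 * j.+1)%:R * x ^+ 2)).
Proof.
exists (N n), (fun j => - ((-1) ^+ j.+1 *+ 'C(N n, j.+1))) => x.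
rewrite /bump exprDn big_ord_recl/= subn0 expr1n expr0 mul1r bin0 mulr1n opprD addNKr.
rewrite -sumrN; apply: eq_bigr => j _.
have -> : expR (- ((n.+1 * j.+1)%:R * x ^+ 2)) = expR (- (k n * x ^+ 2)) ^+ j.+1.
  rewrite -expRM_natl /k natrM; congr expR; ring.
rewrite /= (_ : fintype.bump 0 j = j.+1)// expr1n mul1r [in LHS]exprNn [RHS]mulNr.
by congr (- _); rewrite [RHS]mulrnAl.
Qed.

Let y01 n x : 0 <= expR (- (k n * x ^+ 2)) <= 1.
Proof. by rewrite expR_ge0/= -expR0 ler_expR oppr_le0 mulr_ge0 ?sqr_ge0. Qed.

Let bump_le1 n x : 0 <= bump n x <= 1.
Proof.
have /andP[y0 y1] := y01 n x.
rewrite /bump subr_ge0 exprn_ile1 ?subr_ge0 ?lerBlDr ?lerDl//=.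
by rewrite exprn_ge0// subr_ge0.
Qed.

(** Bernoulli's inequality bounds the bump by N y^k, and N <= k exp(k p^2) + 1. *)
Let bump_le n x : p ^+ 2 <= x ^+ 2 -> bump n x <= 2 * (k n * expR (- (k n * (x ^+ 2 - p ^+ 2)))).
Proof.
move=> px; apply: (le_trans (bernoulli_le _ (y01 n x))).
apply: (@le_trans _ _ ((k n * expR (k n * p ^+ 2) + 1) * expR (- (k n * x ^+ 2)))).
  by apply: ler_wpM2r; [exact: expR_ge0|exact: N_le].
have E : expR (k n * p ^+ 2) * expR (- (k n * x ^+ 2)) = expR (- (k n * (x ^+ 2 - p ^+ 2))).
  by rewrite -expRD; congr expR; ring.
rewrite mulrDl mul1r -mulrA E mulr2n mulrDl mul1r lerD2l.
rewrite -[leLHS]mul1r; apply: ler_pM; rewrite ?expR_ge0//; first by rewrite /k ler1n.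
by rewrite ler_expR lerN2 ler_pM2l// gerBl sqr_ge0.
Qed.

(** A Gaussian majorant independent of n, for dominated convergence. If x^2 - p^2 < 1 the bump is at
    most 1; otherwise k <= exp(k - 1) turns [bump_le] into the bound. *)
Lemma bump_bound n x : 0 <= bump n x <= 2 * expR (1 + p ^+ 2) * expR (- x ^+ 2).
Proof.
have /andP[b0 b1] := bump_le1 n x; rewrite b0/= -mulrA -expRD.
have [c1|/ltW c1] := leP 1 (x ^+ 2 - p ^+ 2); last first.
  apply: (le_trans b1); rewrite -[leLHS]mul1r ler_pM//.
    by rewrite ler1n.
  by rewrite -[leLHS]expR0 ler_expR; lra.
apply: (le_trans (bump_le _ _)); first by lra.
rewrite ler_pM2l//; apply: (@le_trans _ _ (expR (k n - 1) * expR (- (k n * (x ^+ 2 - p ^+ 2))))).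
  by rewrite ler_wpM2r ?expR_ge0//; have := @expR_ge1Dx R (k n - 1); lra.
rewrite -expRD ler_expR.
have : 1 <= k n by rewrite /k ler1n.
set c := x ^+ 2 - p ^+ 2; have -> : 1 + p ^+ 2 - x ^+ 2 = 1 - c by rewrite /c; ring.
by rewrite -/c in c1; nra.
Qed.

(** For |x| <= p, endpoints included, (1 - y^k)^N <= exp(-N y^k) <= exp(-k). For |x| > p the bump is
    at most 4 / (c^2 k) with c = x^2 - p^2, by the quadratic term of the exponential. *)
Lemma cvg_bump x : bump n x @[n --> \oo] --> ((`|x| <= p)%R%:R : R).
Proof.
have ch : (n.+1%:R^-1 : R) @[n --> \oo] --> 0 by exact: cvg_harmonic.
have [xp|px] := leP `|x| p.
  have x2 : x ^+ 2 <= p ^+ 2 by rewrite -(real_normK (num_real x)) lerXn2r// nnegrE.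
  rewrite -[X in _ --> X](subr0 1); apply: cvgB; first exact: cvg_cst.
  apply: (@squeeze_cvgr _ _ _ _ (cst 0) (fun n => expR (- n.+1%:R))).
  - apply: nearW => n; have /andP[y0 y1] := y01 n x.
    rewrite exprn_ge0 ?subr_ge0//=.
    apply: (@le_trans _ _ (expR (- expR (- (k n * x ^+ 2))) ^+ N n)).
      by rewrite lerXn2r ?nnegrE ?subr_ge0 ?expR_ge0// expR_ge1Dx.
    rewrite -expRM_natl ler_expR mulrN lerN2.
    apply: (@le_trans _ _ (k n * expR (k n * p ^+ 2) * expR (- (k n * x ^+ 2)))); last first.
      by rewrite ler_wpM2r ?expR_ge0.
    rewrite -mulrA -expRD -[leLHS]mulr1 ler_pM2l// -expR0 ler_expR.
    by rewrite -mulrBr mulr_ge0 ?subr_ge0// ltW.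
  - exact: cvg_cst.
  - by rewrite (cvg_shiftS (fun n => expR (- n%:R))); exact: cvgn_expR.
have x2 : p ^+ 2 < x ^+ 2 by rewrite -(real_normK (num_real x)) ltrXn2r ?nnegrE.
pose c := x ^+ 2 - p ^+ 2; have c0 : 0 < c by rewrite subr_gt0.
apply: (@squeeze_cvgr _ _ _ _ (cst 0) (fun n => 4 / c ^+ 2 * n.+1%:R^-1)).
- apply: nearW => n; have /andP[-> _] /= := bump_le1 n x.
  apply: (le_trans (bump_le _ (ltW x2))); rewrite -/c.
  rewrite expRN -/(k n).
  have := @expR_ge1Dxn R (k n * c) 1 (ltW (mulr_gt0 (k_gt0 n) c0)).
  rewrite (_ : 2`!%:R = 2)// => H.
  have {}H : (k n * c) ^+ 2 / 2 <= expR (k n * c) by apply: le_trans H; rewrite lerDr.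
  have q0 : 0 < (k n * c) ^+ 2 / 2 by rewrite divr_gt0// exprn_gt0// mulr_gt0.
  apply: (@le_trans _ _ (2 * (k n * ((k n * c) ^+ 2 / 2)^-1))).
    rewrite !ler_pM2l// lef_pV2 ?posrE ?expR_gt0//.
  rewrite le_eqVlt; apply/orP; left; apply/eqP; rewrite exprMn; field.
  by rewrite !gt_eqF.
- exact: cvg_cst.
- by rewrite -[X in _ --> X](mulr0 (4 / c ^+ 2)); apply: cvgM; [exact: cvg_cst|exact: ch].
Qed.

Lemma indicator_bound x : 0 <= ((`|x| <= p)%R%:R : R) <= 2 * expR (1 + p ^+ 2) * expR (- x ^+ 2).
Proof.
rewrite ler0n/=; have [xp|_] := leP `|x| p; last by rewrite !mulr_ge0 ?expR_ge0.
have x2 : x ^+ 2 <= p ^+ 2 by rewrite -(real_normK (num_real x)) lerXn2r// nnegrE.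
rewrite -mulrA -expRD -[leLHS]mul1r; apply: ler_pM => //; first by rewrite ler1n.
by rewrite -[leLHS]expR0 ler_expR; lra.
Qed.

End bump.

Section density.
Context {R : realType} (alpha : {nonneg R}).
Local Notation a := (alpha%:num).
Local Notation RM := (measurableTypeR R).
Local Notation m := (m_alpha alpha).

Lemma mass12_eq_K (u v : R * R -> R) :
  measurable_fun [set: RM * RM] u -> measurable_fun [set: RM * RM] v ->
  (forall z, K_space z -> u z = v z) -> mass12 m u = mass12 m v.
Proof.
move=> mu mv uv; rewrite /mass12 /m_alpha !ge0_integral_mweighted.
- apply: eq_integral => z _; rewrite -!EFinM; congr EFin.
  rewrite /m_weight indicE; have [zK|_] := boolP (z \in K_space); last by rewrite !mulr0.
  by rewrite uv//; move: zK; rewrite inE.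
- apply/measurable_EFinP; apply: measurable_funD; first exact: measurableT_comp.
  exact: measurable_funX.
- by move=> z; rewrite lee_fin addr_ge0// sqr_ge0.
- apply/measurable_EFinP; apply: measurable_funD; first exact: measurableT_comp.
  exact: measurable_funX.
- by move=> z; rewrite lee_fin addr_ge0// sqr_ge0.
Qed.

Let g11 : R * R -> R := gauss2 (1, 1).

Lemma mass12_gauss2 (c : R) : (mass12 m (fun z => c * g11 z)%R < +oo)%E.
Proof.
apply: (le_lt_trans (mass12_scale m c (measurable_gauss2 _))).
apply: lte_mul_pinfty; [by rewrite lee_fin addr_ge0// sqr_ge0|by []|].
have [/integrableP[_ ig] _] := @integral_gauss2 R alpha (1, 1) ltr01 ltr01.
apply: (@le_lt_trans _ _ (2%:E * \int[m]_z `|(EFin \o gauss2 (1, 1)%R) z|)%E); last first.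
  apply: lte_mul_pinfty => //.
rewrite -ge0_integralZl//; last first.
  by apply: measurableT_comp => //; apply/measurable_EFinP; exact: measurable_gauss2.
apply: ge0_le_integral => //.
- by move=> z _; rewrite lee_fin addr_ge0// sqr_ge0.
- apply/measurable_EFinP; apply: measurable_funD.
    by apply: measurableT_comp => //; exact: measurable_gauss2.
  by apply: measurable_funX; exact: measurable_gauss2.
- apply: measurable_funeM; apply: measurableT_comp => //; apply/measurable_EFinP; exact: measurable_gauss2.
move=> z _; rewrite -EFinM lee_fin.
have g0 := gauss2_ge0 (1, 1) z; rewrite ger0_norm//.
have g1 : g11 z <= 1.
  rewrite /g11 /gauss2 -expRD -[leRHS]expR0 ler_expR /=.
  by have := sqr_ge0 z.1; have := sqr_ge0 z.2; lra.
by rewrite /g11 in g1 *; nra.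
Qed.

Definition gsums : set (R * R -> R) := [set g | exists s, g = gsum s].

Lemma gsums_approximable g : gsums g -> approximable m gsums g.
Proof.
move=> Dg e e0; exists g => //.
rewrite /mass12; under eq_integral do rewrite subrr normr0 expr0n addr0.
by rewrite integral0 lee_fin ltW.
Qed.

Let pos_nat (n j : nat) : 0 < (n.+1 * j.+1)%:R :> R.
Proof. by rewrite ltr0n muln_gt0. Qed.

Let bump2_gsums (p q : R) n : gsums (fun z => bump p n z.1 * bump q n z.2).
Proof.
have [M [c cE]] := bump_sum p n; have [M' [c' cE']] := bump_sum q n.
exists [seq (c j * c' l, (PosNum (pos_nat n j), PosNum (pos_nat n l))) | j <- iota 0 M, l <- iota 0 M'].
apply/funext => z; rewrite cE cE' /gsum big_allpairs_dep/=.
rewrite -(big_mkord xpredT (fun j => c j * expR (- ((n.+1 * j.+1)%:R * z.1 ^+ 2)))).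
rewrite -(big_mkord xpredT (fun j => c' j * expR (- ((n.+1 * j.+1)%:R * z.2 ^+ 2)))).
rewrite mulr_suml /index_iota subn0; apply: eq_bigr => j _.
rewrite mulr_sumr subn0; apply: eq_bigr => l _.
by rewrite /gauss2/=; ring.
Qed.

Let box (p q : R) (z : R * R) : R := (`|z.1| <= p)%R%:R * (`|z.2| <= q)%R%:R.

Let mbox p q : measurable_fun [set: RM * RM] (box p q).
Proof.
have H (r : R) : measurable_fun [set: RM] (fun x : R => (`|x| <= r)%R%:R : R).
  rewrite (_ : (fun x => _) = \1_`[- r, r]).
    exact: measurable_indic.
  by apply/funext => x; rewrite indicE ler_norml; congr (_%:R); rewrite mem_setE in_itv.
exact: (measurable_tensor (H p) (H q)).
Qed.

Let Cst (p : R) : R := 2 * expR (1 + p ^+ 2).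

Let box_le p q z : 0 <= p -> 0 <= q -> 0 <= box p q z <= Cst p * Cst q * g11 z.
Proof.
move=> p0 q0; have /andP[u0 u1] := indicator_bound p0 z.1; have /andP[v0 v1] := indicator_bound q0 z.2.
rewrite mulr_ge0//= /g11 /gauss2/= !mul1r /Cst.
rewrite (_ : _ * _ * _ = (2 * expR (1 + p ^+ 2) * expR (- z.1 ^+ 2)) * (2 * expR (1 + q ^+ 2) * expR (- z.2 ^+ 2))); last by ring.
exact: ler_pM.
Qed.

Let approx_box p q : 0 <= p -> 0 <= q -> approximable m gsums (box p q).
Proof.
move=> p0 q0.
have bb n z : 0 <= bump p n z.1 * bump q n z.2 <= Cst p * Cst q * g11 z.
  have /andP[u0 u1] := bump_bound p n z.1; have /andP[v0 v1] := bump_bound q n z.2.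
  rewrite mulr_ge0//= /g11 /gauss2/= !mul1r /Cst.
  rewrite (_ : 2 * _ * (2 * _) * _ = (2 * expR (1 + p ^+ 2) * expR (- z.1 ^+ 2)) * (2 * expR (1 + q ^+ 2) * expR (- z.2 ^+ 2))); last by ring.
  exact: ler_pM.
apply: (@approx_lim _ _ _ m gsums _ (fun n z => bump p n z.1 * bump q n z.2) _ (fun z => Cst p * Cst q * g11 z)).
- by move=> g [s ->]; exact: measurable_gsum.
- by move=> n; have [s ->] := bump2_gsums p q n; exact: measurable_gsum.
- exact: mbox.
- by apply: measurable_funM => //; exact: measurable_gauss2.
- exact: mass12_gauss2.
- move=> n z; have /andP[u0 u1] := bb n z; have /andP[v0 v1] := box_le z p0 q0.
  by rewrite ler_norml; apply/andP; split; lra.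
- by apply: aeW => z; apply: cvgM; exact: cvg_bump.
- by move=> n; apply: gsums_approximable; exact: bump2_gsums.
Qed.

Let G : set (set (RM * RM)) := [set A | exists p q : R, A = `]-oo, p] `*` `]-oo, q]].

Let GE : @measurable _ (RM * RM)%type = <<s G >>.
Proof.
apply/seteqP; split; last first.
  apply: smallest_sub; first exact: sigma_algebra_measurable.
  by move=> _ [p [q ->]]; exact: measurableX.
(* The plane with the sigma-algebra generated by quadrants: both projections are measurable on it,
   since a half-plane is a countable union of quadrants, and hence so is the identity into the Borel
   plane. *)
pose T' := g_sigma_algebraType G.
have ray : @measurable _ RM = <<s [set A | exists x : R, A = `]-oo, x]%classic] >>.
  apply/seteqP; split; last first.
    apply: smallest_sub; first exact: sigma_algebra_measurable.
    by move=> _ [x ->]; exact: measurable_itv.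
  rewrite [X in X `<=` _]RGenOInfty.measurableE.
  apply: smallest_sub; first exact: smallest_sigma_algebra.
  move=> _ [x ->]; rewrite -setCitvl; apply: sigma_algebraC.
  by apply: sub_sigma_algebra; exists x.
have mrect (p q : R) : @measurable _ T' (`]-oo, p] `*` `]-oo, q]).
  by apply: sub_sigma_algebra; exists p, q.
have m1 : @measurable_fun _ _ T' RM setT fst.
  apply: measurability; first exact: ray.
  move=> _ [_ [p ->] <-]; rewrite setTI.
  rewrite (_ : fst @^-1` _ = \bigcup_n (`]-oo, p] `*` `]-oo, n%:R]) :> set T').
    by apply: bigcup_measurable => n _; exact: mrect.
  apply/seteqP; split => -[x y] /=; last by move=> [n _ []].
  rewrite !in_itv/= => xp; exists (Num.truncn y).+1 => //=; split; rewrite /= in_itv//=.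
  have [y0|/ltW y0] := leP 0 y; first by have /andP[_ /ltW] := truncn_itv y0.
  by rewrite (le_trans y0).
have m2 : @measurable_fun _ _ T' RM setT snd.
  apply: measurability; first exact: ray.
  move=> _ [_ [p ->] <-]; rewrite setTI.
  rewrite (_ : snd @^-1` _ = \bigcup_n (`]-oo, n%:R] `*` `]-oo, p]) :> set T').
    by apply: bigcup_measurable => n _; exact: mrect.
  apply/seteqP; split => -[x y] /=; last by move=> [n _ []].
  rewrite !in_itv/= => xp; exists (Num.truncn x).+1 => //=; split; rewrite /= in_itv//=.
  have [y0|/ltW y0] := leP 0 x; first by have /andP[_ /ltW] := truncn_itv y0.
  by rewrite (le_trans y0).
have mid : @measurable_fun _ _ T' (RM * RM)%type setT (fun z => (z.1, z.2)).
  exact: measurable_fun_pair.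
move=> A mA; have := mid measurableT A mA; rewrite setTI.
by rewrite (_ : _ @^-1` A = A)//; apply/seteqP; split => -[].
Qed.

Let quadrant (p q : R) : set (RM * RM) := `]-oo, p] `*` `]-oo, q].

Let mquadrant p q : measurable (quadrant p q).
Proof. exact: measurableX. Qed.

Let quadrant_box p q z : 0 <= p -> 0 <= q -> K_space z -> (\1_(quadrant p q) z : R) = box p q z.
Proof.
move=> p0 q0 [/=]; rewrite !in_itv/= !andbT => z1 z2.
rewrite indicE /quadrant in_setX !mem_setE !in_itv/= /box !ger0_norm//.
by case: (z.1 <= p); case: (z.2 <= q); rewrite /= ?mulr1 ?mulr0.
Qed.

Let mass12_quadrant p q : 0 <= p -> 0 <= q -> (mass12 m (\1_(quadrant p q) : R * R -> R) < +oo)%E.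
Proof.
move=> p0 q0; rewrite (mass12_eq_K (v := box p q)) => //.
- apply: (le_lt_trans _ (mass12_gauss2 (Cst p * Cst q))); apply: le_mass12.
  + exact: mbox.
  + by apply: measurable_funM => //; exact: measurable_gauss2.
  move=> z; have /andP[b0 b1] := box_le z p0 q0.
  by rewrite !ger0_norm//; exact: le_trans b1.
- by move=> z; exact: quadrant_box.
Qed.

Let approx_eq_K (u v : R * R -> R) :
  measurable_fun [set: RM * RM] u -> measurable_fun [set: RM * RM] v ->
  (forall z, K_space z -> u z = v z) -> approximable m gsums v -> approximable m gsums u.
Proof.
move=> mu mv uv av e e0; have [g Dg gv] := av e e0; exists g => //.
have mg : measurable_fun [set: RM * RM] g by have [s ->] := Dg; exact: measurable_gsum.
rewrite (mass12_eq_K (v := fun z => v z - g z))//; [exact: measurable_funB|exact: measurable_funB|].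
by move=> z Kz; rewrite uv.
Qed.

Let approx_quadrant A : G A -> approximable m gsums \1_A.
Proof.
move=> [p [q ->]]; rewrite -/(quadrant p q).
have [/andP[p0 q0]|pq] := boolP ((0 <= p) && (0 <= q)).
  apply: (@approx_eq_K _ (box p q)); [exact: measurable_indic|exact: mbox| |exact: approx_box].
  by move=> z; exact: quadrant_box.
(* A quadrant whose corner has a negative coordinate does not meet K. *)
apply: (@approx_eq_K _ (cst 0)); [exact: measurable_indic|exact: measurable_cst| |].
  move=> z [/=]; rewrite !in_itv/= !andbT => z1 z2.
  rewrite indicE /quadrant in_setX !mem_setE !in_itv/=.
  have [zp|//] := leP z.1 p; have [zq|//] := leP z.2 q.
  by move: pq; rewrite (le_trans z1 zp) (le_trans z2 zq).
apply: gsums_approximable; exists [::]; apply/funext => z.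
by rewrite /gsum big_nil.
Qed.

(* Quadrants generate the Borel sets, and on K the indicator of a quadrant is that of
   a box, a dominated limit of products of bumps, hence of Gaussian sums. *)
Lemma gsums_dense (h : R * R -> R) :
  measurable_fun [set: RM * RM] h -> (mass12 m h < +oo)%E -> approximable m gsums h.
Proof.
have gcat s t z : gsum (s ++ t) z = gsum s z + gsum t z :> R by rewrite /gsum big_cat.
apply: (@approximable_dense _ _ _ m gsums _ _ _ _ G GE _ (fun n => quadrant n%:R n%:R)) => //.
- by move=> g [s ->]; exact: measurable_gsum.
- by exists [::]; apply/funext => z; rewrite /gsum big_nil.
- by move=> f g [s ->] [t ->]; exists (s ++ t); apply/funext => z; rewrite gcat.
- move=> c g [s ->]; exists [seq (c * i.1, i.2) | i <- s]; apply/funext => z.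
  by rewrite /gsum big_map mulr_sumr; apply: eq_bigr => i _; rewrite mulrA.
- move=> _ _ [p [q ->]] [p' [q' ->]]; exists (Num.min p p'), (Num.min q q').
  apply/seteqP; split => -[x y] /=; rewrite !in_itv/= !le_min.
    by move=> [[-> ->] [-> ->]].
  by move=> [/andP[-> ->] /andP[-> ->]].
- by move=> n; exists n%:R, n%:R.
- move=> i j ij [x y] []/=; rewrite !in_itv/= => xi yi.
  have ij' : i%:R <= j%:R :> R by rewrite ler_nat.
  by split; rewrite /= in_itv/=; [exact: le_trans xi ij'|exact: le_trans yi ij'].
- apply/seteqP; split => // -[x y] _; exists (Num.truncn (`|x| + `|y|)).+1 => //=.
  have /truncn_itv/andP[_ /ltW H] : 0 <= `|x| + `|y| by rewrite addr_ge0.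
  split; rewrite /= in_itv/=; apply: le_trans H.
    by apply: le_trans (ler_norm x) _; rewrite lerDl.
  by apply: le_trans (ler_norm y) _; rewrite lerDr.
- by move=> n; exact: mass12_quadrant.
Qed.

End density.

(** * The transform of integrable functions *)

Section transform_L1L2.
Context {R : realType} (alpha : {nonneg R}).
Local Notation a := (alpha%:num).
Local Notation RM := (measurableTypeR R).
Local Notation m := (m_alpha alpha).
Local Notation gam := (gamma_alpha alpha).
Implicit Types h g : R * R -> R.

(* Set to 0 outside of [Khat_space], where the kernel may fail to be bounded. *)
Definition LBt h (w : R * nat) : R :=
  if 0 <= w.1 then \int[m]_z (h z * LB_kernel alpha w z) else 0.

Lemma sqint_gamma_eq (u v : R * nat -> R) :
  measurable_fun [set: RM * nat] u -> measurable_fun [set: RM * nat] v ->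
  (forall w, 0 <= w.1 -> u w = v w) -> sqint gam u = sqint gam v.
Proof.
move=> mu mv uv; rewrite /sqint /gamma_alpha !ge0_integral_mweighted.
- apply: eq_integral => w _; rewrite -!EFinM; congr EFin.
  rewrite /gamma_weight indicE; have [wK|_] := boolP (w \in Khat_space); last by rewrite !mulr0.
  rewrite uv//; move: wK; rewrite inE => -[/=]; by rewrite in_itv/= andbT.
- exact: measurable_sqr.
- by move=> w; rewrite lee_fin sqr_ge0.
- exact: measurable_sqr.
- by move=> w; rewrite lee_fin sqr_ge0.
Qed.

Let kernel_integrable h w : 0 <= w.1 -> measurable_fun [set: RM * RM] h ->
  m.-integrable setT (EFin \o h) ->
  m.-integrable setT (EFin \o (fun z => h z * LB_kernel alpha w z)).
Proof.
move=> w0 mh ih; have [M M0 HM] := LB_kernel_bounded alpha w0.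
apply: (@le_integrable _ _ _ m _ measurableT _ (fun z => M%:E * (EFin \o h) z)%E).
- apply/measurable_EFinP; apply: measurable_funM => //; exact: measurable_LB_kernel.
- move=> z _; rewrite /= lee_fin (normrM (h z)) (normrM M) (ger0_norm (ltW M0)) [leRHS]mulrC.
  by rewrite ler_wpM2l//; exact: HM.
- exact: integrableZl.
Qed.

Lemma LBtB h g : measurable_fun [set: RM * RM] h -> measurable_fun [set: RM * RM] g ->
  m.-integrable setT (EFin \o h) -> m.-integrable setT (EFin \o g) ->
  LBt (fun z => h z - g z) = (fun w => LBt h w - LBt g w).
Proof.
move=> mh mg ih ig; apply/funext => w; rewrite /LBt; case: ifP => w0; last by rewrite subrr.
under eq_Rintegral do rewrite mulrBl.
rewrite RintegralB//; exact: kernel_integrable.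
Qed.

(** The kernel is bounded only where h does not vanish, so that the uniform bound on a ball can
    serve for functions supported in it. *)
Lemma LBt_bound h w M : 0 <= w.1 -> measurable_fun [set: RM * RM] h ->
  m.-integrable setT (EFin \o h) ->
  (forall z, h z != 0 -> `|LB_kernel alpha w z| <= M) -> 0 <= M ->
  (`|(LBt h w)%:E| <= M%:E * \int[m]_z `|(h z)%:E|)%E.
Proof.
move=> w0 mh ih HM M0; rewrite /LBt w0.
have ik := kernel_integrable w0 mh ih.
rewrite /Rintegral fineK; last exact: (integrable_fin_num measurableT ik).
have mk : measurable_fun [set: RM * RM] (fun z => h z * LB_kernel alpha w z).
  apply: measurable_funM => //; exact: measurable_LB_kernel.
apply: (le_trans (le_abse_integral _ measurableT _)); first exact/measurable_EFinP.
rewrite -ge0_integralZl//; last first.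
  by apply: measurableT_comp => //; exact/measurable_EFinP.
apply: ge0_le_integral => //.
- by apply: measurableT_comp => //; exact/measurable_EFinP.
- by apply: measurable_funeM; apply: measurableT_comp => //; exact/measurable_EFinP.
move=> z _; rewrite !abse_EFin -EFinM lee_fin normrM mulrC.
have [->|hz] := eqVneq (h z) 0; first by rewrite normr0 !mulr0.
by rewrite ler_wpM2r// HM.
Qed.

Let gsum_mass12 s : (mass12 m (gsum s) < +oo)%E.
Proof.
elim: s => [|i s ih].
  rewrite /mass12; under eq_integral do rewrite /gsum big_nil normr0 expr0n addr0.
  by rewrite integral0.
have mg : measurable_fun [set: RM * RM] (gauss2 (params i)) by exact: measurable_gauss2.
have mig : measurable_fun [set: RM * RM] (fun z => i.1 * gauss2 (params i) z) by exact: measurable_funM.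
apply: (@le_lt_trans _ _ (2%:E * (mass12 m (fun z => i.1 * gauss2 (params i) z)%R + mass12 m (gsum s)))%E).
  apply: (@mass12D _ _ _ m _ _ _ mig (@measurable_gsum R s) (@measurable_gsum R (i :: s))).
  by move=> z; rewrite /gsum big_cons ler_normD.
apply: lte_mul_pinfty; [by []|by []|].
apply: lte_add_pinfty; last exact: ih.
apply: (le_lt_trans (mass12_scale m i.1 mg)).
apply: lte_mul_pinfty; [by rewrite lee_fin addr_ge0// sqr_ge0|by []|].
have [/integrableP[_ ig] _] := @integral_gauss2 R alpha (params i) (gt0 i.2.1) (gt0 i.2.2).
apply: (@le_lt_trans _ _ (2%:E * \int[m]_z `|(EFin \o gauss2 (params i)) z|)%E); last first.
  exact: lte_mul_pinfty.
rewrite -ge0_integralZl//; last first.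
  by apply: measurableT_comp => //; exact/measurable_EFinP.
apply: ge0_le_integral => //.
- by move=> z _; rewrite lee_fin addr_ge0// sqr_ge0.
- apply/measurable_EFinP; apply: measurable_funD; first exact: measurableT_comp.
  exact: measurable_funX.
- by apply: measurable_funeM; apply: measurableT_comp => //; exact/measurable_EFinP.
move=> z _; rewrite -EFinM lee_fin.
have g0 := gauss2_ge0 (params i) z; rewrite ger0_norm//.
have g1 : gauss2 (params i) z <= 1.
  rewrite /gauss2 -expRD -[leRHS]expR0 ler_expR -opprD oppr_le0.
  by apply: addr_ge0; apply: mulr_ge0; rewrite ?sqr_ge0//= ltW.
nra.
Qed.

Let gsum_integrable s : m.-integrable setT (EFin \o gsum s).
Proof. exact: mass12_integrable (measurable_gsum s) (gsum_mass12 s). Qed.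

Lemma LBt_gsum s w : 0 <= w.1 -> LBt (gsum s) w = gsum_transform alpha s w.
Proof.
move=> w0; rewrite /LBt w0 /gsum_transform.
under eq_Rintegral do rewrite /gsum mulr_suml.
pose f (i : R * ({posnum R} * {posnum R})) z := gauss2 (params i) z * LB_kernel alpha w z.
have p1 (i : R * ({posnum R} * {posnum R})) : 0 < (params i).1 by exact: (gt0 i.2.1).
have p2 (i : R * ({posnum R} * {posnum R})) : 0 < (params i).2 by exact: (gt0 i.2.2).
have fi i := LB_gauss2 alpha (p1 i) (p2 i) w0.
rewrite /Rintegral; under eq_integral => z _.
  rewrite -sumEFin.
  under eq_bigr => i _ do rewrite -mulrA EFinM.
  over.
have ii (i : R * ({posnum R} * {posnum R})) : m.-integrable setT (fun z => (i.1)%:E * (f i z)%:E)%E.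
  by apply: (integrableZl measurableT); exact: (fi i).1.
rewrite (@integral_sum _ _ _ m _ measurableT _ (fun i z => (i.1)%:E * (f i z)%:E)%E ii).
rewrite -sum_fine; last by move=> i _; exact: (integrable_fin_num measurableT (ii i)).
apply: eq_bigr => i _.
rewrite (integralZl measurableT (fi i).1) fineM//=; last exact: (integrable_fin_num measurableT (fi i).1).
by congr (_ * _); exact: (fi i).2.
Qed.

Let on_Khat (u : R * nat -> R) (w : R * nat) : R := u w * (0 <= w.1)%R%:R.

Let measurable_on_Khat u : measurable_fun [set: RM * nat] u -> measurable_fun [set: RM * nat] (on_Khat u).
Proof.
move=> mu; apply: measurable_funM => //.
rewrite (_ : (fun w : R * nat => _) = \1_Khat_space); first by apply: measurable_indic; exact: measurableX.
by apply/funext => w; rewrite indicE /Khat_space in_setX in_setT andbT mem_setE in_itv/= andbT.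
Qed.

Let LBt_gsumE s : LBt (gsum s) = on_Khat (gsum_transform alpha s).
Proof.
apply/funext => w; rewrite /on_Khat; have [w0|w0] := boolP (0 <= w.1).
  by rewrite LBt_gsum// mulr1.
by rewrite mulr0 /LBt (negbTE w0).
Qed.

Let measurable_LBt_gsum s : measurable_fun [set: RM * nat] (LBt (gsum s)).
Proof. by rewrite LBt_gsumE; apply: measurable_on_Khat; exact: measurable_gsum_transform. Qed.

Local Notation kap := (plancherel_const alpha).

Let plancherel_LBt_gsum s : sqint gam (LBt (gsum s)) = (kap%:E * sqint m (gsum s))%E.
Proof.
rewrite -plancherel_gsum; apply: sqint_gamma_eq => //; first exact: measurable_gsum_transform.
by move=> w w0; exact: LBt_gsum.
Qed.

Let gsumB s t : exists r, gsum r = (fun z => gsum s z - gsum t z) :> (R * R -> R).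
Proof.
exists (s ++ [seq (- i.1, i.2) | i <- t]); apply/funext => z.
rewrite /gsum big_cat big_map -sumrN; congr (_ + _); apply: eq_bigr => i _.
by rewrite mulNr.
Qed.

Let plancherel_gsumB s t :
  sqint gam (fun w => LBt (gsum s) w - LBt (gsum t) w) =
  (kap%:E * sqint m (fun z => (gsum s z - gsum t z)%R))%E.
Proof.
rewrite -LBtB; [|exact: measurable_gsum|exact: measurable_gsum|exact: gsum_integrable|exact: gsum_integrable].
by have [r <-] := gsumB s t; exact: plancherel_LBt_gsum.
Qed.

(** For a fixed frequency the kernel is bounded, so L^1 convergence of the functions implies
    pointwise convergence of the transforms. *)
Let cvg_LBt (s : nat -> seq (R * ({posnum R} * {posnum R}))) h w :
  measurable_fun [set: RM * RM] h -> (mass12 m h < +oo)%E ->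
  (forall n, mass12 m (fun z => h z - gsum (s n) z)%R <= (n.+1%:R^-1)%:E)%E ->
  LBt (gsum (s n)) w @[n --> \oo] --> LBt h w.
Proof.
move=> mh hoo hs.
have [w0|w0] := boolP (0 <= w.1); last first.
  rewrite (_ : (fun n => _) = cst 0); first by rewrite /LBt (negbTE w0); exact: cvg_cst.
  by apply/funext => n; rewrite /LBt (negbTE w0).
have [M M0 HM] := LB_kernel_bounded alpha w0.
have b n : `|LBt h w - LBt (gsum (s n)) w| <= M * n.+1%:R^-1.
  have mg := @measurable_gsum R (s n).
  have ih := mass12_integrable mh hoo.
  have ihg : m.-integrable setT (EFin \o (fun z => h z - gsum (s n) z)).
    have := integrableB measurableT ih (gsum_integrable (s n)).
    by apply: eq_integrable.
  have := LBt_bound w0 (measurable_funB mh mg) ihg (fun z _ => HM z) (ltW M0).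
  rewrite LBtB// => H; rewrite -lee_fin; apply: (le_trans H).
  rewrite EFinM lee_pmul2l//; apply: le_trans (hs n).
  by apply: normr_le_mass12; exact: measurable_funB.
apply/cvgrPdist_le => e e0.
have : (M * n.+1%:R^-1 : R) @[n --> \oo] --> 0.
  by rewrite -[X in _ --> X](mulr0 M); apply: cvgM; [exact: cvg_cst|exact: cvg_harmonic].
move=> /cvgrPdist_le /(_ e e0); apply: filterS => n.
rewrite sub0r normrN ger0_norm; last by rewrite mulr_ge0 ?invr_ge0// ltW.
exact: le_trans (b n).
Qed.

(** The rate 1/(n+1) serves pointwise convergence of the transforms; the tolerance e, valid from n =
    0 on, serves the L^2 comparison. *)
Let approx_seq h : measurable_fun [set: RM * RM] h -> (mass12 m h < +oo)%E ->
  forall e : R, 0 < e -> exists s : nat -> seq (R * ({posnum R} * {posnum R})),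
  (forall n, mass12 m (fun z => h z - gsum (s n) z)%R <= (n.+1%:R^-1)%:E)%E /\
  (forall n, mass12 m (fun z => h z - gsum (s n) z)%R <= e%:E)%E.
Proof.
move=> mh hoo e e0; have ah := gsums_dense mh hoo.
have H n : exists s, (mass12 m (fun z => h z - gsum s z)%R <= (Num.min e n.+1%:R^-1)%:E)%E.
  have [|g [s ->] gs] := ah (Num.min e n.+1%:R^-1); last by exists s.
  by rewrite lt_min e0/= invr_gt0.
have [s Hs] := choice H; exists s; split=> n; apply: (le_trans (Hs n)).
  by rewrite lee_fin ge_min lexx orbT.
by rewrite lee_fin ge_min lexx.
Qed.

Lemma measurable_LBt h : measurable_fun [set: RM * RM] h -> (mass12 m h < +oo)%E ->
  measurable_fun [set: RM * nat] (LBt h).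
Proof.
move=> mh hoo; have [s [s1 _]] := approx_seq mh hoo ltr01.
have : measurable_fun [set: RM * nat] (EFin \o LBt h).
  apply: (emeasurable_fun_cvg (fun n w => (LBt (gsum (s n)) w)%:E)).
    by move=> n; apply/measurable_EFinP; exact: measurable_LBt_gsum.
  by move=> w _; apply: cvg_EFin; [exact: nearW|exact: cvg_LBt].
by move/measurable_EFinP.
Qed.

(** The first approximant is compared with all later ones by the exact formula for Gaussian sums,
    and Fatou's lemma passes to the transform of h. No L^2 bound for [LBt] on general functions is
    presupposed. *)
Let approx_pair h : measurable_fun [set: RM * RM] h -> (mass12 m h < +oo)%E ->
  forall e : R, 0 < e -> exists s,
  (sqint m (fun z => h z - gsum s z)%R <= e%:E)%E /\
  (sqint gam (fun w => LBt h w - LBt (gsum s) w)%R <= (4 * kap * e)%:E)%E.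
Proof.
move=> mh hoo e e0; have [s [s1 s2]] := approx_seq mh hoo e0.
have mg n := @measurable_gsum R (s n).
have k0 := plancherel_const_gt0 alpha.
have sq n : (sqint m (fun z => h z - gsum (s n) z)%R <= e%:E)%E.
  by apply: le_trans (s2 n); apply: sqint_le_mass12; exact: measurable_funB.
exists (s 0%N); split; first exact: sq.
apply: (@sqint_fatou _ _ _ gam (fun n w => LBt (gsum (s n)) w - LBt (gsum (s 0%N)) w)).
- by move=> n; exact: measurable_funB.
- by apply: measurable_funB => //; exact: measurable_LBt.
- by apply: aeW => w; apply: cvgB; [exact: cvg_LBt|exact: cvg_cst].
apply: nearW => n; rewrite plancherel_gsumB.
rewrite (_ : (4 * kap * e)%:E = kap%:E * (2%:E * (e%:E + e%:E)))%E; last first.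
  by rewrite -EFinD -!EFinM; congr EFin; ring.
rewrite lee_pmul2l//; apply: (le_trans (le_sqint_dist m (mg n) mh (mg 0%N))).
by rewrite lee_wpmul2l ?lee_fin// leeD// sqint_distC.
Qed.

Let le_eps (x y : \bar R) (c : R) : 0 < c ->
  (forall e : R, 0 < e -> (x <= y + (c * e)%:E)%E) -> (x <= y)%E.
Proof.
move=> c0 H; apply/lee_addgt0Pr => e e0.
have := H (e / c); rewrite divr_gt0// => /(_ isT).
by rewrite mulrC divfK// gt_eqF.
Qed.

Let le_sqint_subD d (T : measurableType d) (mu : {measure set T -> \bar R}) (f g : T -> R) :
  measurable_fun [set: T] f -> measurable_fun [set: T] g ->
  (sqint mu f <= 2%:E * (sqint mu (fun x => (f x - g x)%R) + sqint mu g))%E.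
Proof.
move=> mf mg; apply: le_sqintD => //; first exact: measurable_funB.
by move=> x; have := ler_normD (f x - g x) (g x); rewrite subrK.
Qed.

Lemma plancherel_le h : measurable_fun [set: RM * RM] h -> (mass12 m h < +oo)%E ->
  (sqint gam (LBt h) <= (4 * kap)%:E * sqint m h)%E.
Proof.
move=> mh hoo; have k0 := plancherel_const_gt0 alpha.
(* The final bound is 2 (4 kap e + 2 kap (e + H)) = 4 kap H + 12 kap e, with H the squared norm of
   h. *)
apply: (@le_eps _ _ (12 * kap)); first by rewrite mulr_gt0.
move=> e e0; have [s [s1 s2]] := approx_pair mh hoo e0.
have hoo' : (sqint m h < +oo)%E by exact: le_lt_trans (sqint_le_mass12 m mh) hoo.
have H1 := le_sqint_subD gam (measurable_LBt mh hoo) (measurable_LBt_gsum s).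
have H2 := le_sqint_subD m (measurable_gsum s) mh.
rewrite plancherel_LBt_gsum in H1; rewrite sqint_distC in H2.
have := sqint_ge0 m h; case: (sqint m h) hoo' H2 => [Hh| |]// _ H2 _.
apply: (le_trans H1).
apply: (@le_trans _ _ (2%:E * ((4 * kap * e)%:E + kap%:E * (2%:E * (e%:E + Hh%:E)))))%E.
  rewrite lee_wpmul2l ?lee_fin// leeD// lee_wpmul2l ?lee_fin ?(ltW k0)//.
  apply: (le_trans H2); rewrite lee_wpmul2l ?lee_fin// leeD//.
by rewrite -!(EFinD, EFinM) lee_fin; lra.
Qed.

Lemma plancherel_ge h : measurable_fun [set: RM * RM] h -> (mass12 m h < +oo)%E ->
  (kap%:E * sqint m h <= 4%:E * sqint gam (LBt h))%E.
Proof.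
move=> mh hoo; have k0 := plancherel_const_gt0 alpha.
(* The final bound is 2 (kap e + 2 (4 kap e + S)) = 4 S + 18 kap e, with S the squared norm of the
   transform. *)
apply: (@le_eps _ _ (18 * kap)); first by rewrite mulr_gt0.
move=> e e0; have [s [s1 s2]] := approx_pair mh hoo e0.
have mL := measurable_LBt mh hoo.
have H1 := le_sqint_subD gam (measurable_LBt_gsum s) mL.
have H2 := le_sqint_subD m mh (measurable_gsum s).
rewrite plancherel_LBt_gsum sqint_distC in H1.
have := sqint_ge0 gam (LBt h); case: (sqint gam (LBt h)) H1 => [S| |]// H1 _; last first.
  by rewrite gt0_muley ?lte_fin// addye// leey.
apply: (@le_trans _ _ (2%:E * (kap%:E * e%:E + kap%:E * sqint m (gsum s))))%E.
  rewrite -ge0_muleDr ?lee_fin ?(ltW k0)// ?sqint_ge0// ?lee_fin ?(ltW e0)// muleCA.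
  rewrite lee_wpmul2l ?lee_fin ?(ltW k0)//; apply: (le_trans H2).
  by rewrite lee_wpmul2l ?lee_fin// leeD.
apply: (@le_trans _ _ (2%:E * (kap%:E * e%:E + (2%:E * ((4 * kap * e)%:E + S%:E)))))%E.
  rewrite lee_wpmul2l ?lee_fin// leeD//.
  by apply: (le_trans H1); rewrite lee_wpmul2l ?lee_fin// leeD.
by rewrite -!(EFinD, EFinM) lee_fin; lra.
Qed.

End transform_L1L2.

(** * Extension to L^2 *)

Section truncation.
Context {R : realType} (alpha : {nonneg R}).
Local Notation a := (alpha%:num).
Local Notation RM := (measurableTypeR R).
Local Notation b1 := (a + 1).
Local Notation b2 := (a + 2^-1).
Local Notation m := (m_alpha alpha).
Implicit Types f g : R * R -> R.

Lemma measurable_hom_norm : measurable_fun [set: RM * RM] (@hom_norm R).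
Proof.
apply: (measurableT_comp (measurable_powR _)) => //.
apply: measurable_funD; first exact: measurable_funX.
by apply: measurable_funM => //; exact: measurable_funX.
Qed.

Lemma hom_norm_ge0 (z : R * R) : 0 <= hom_norm z.
Proof. exact: powR_ge0. Qed.

Lemma hom_normX4 (z : R * R) : hom_norm z ^+ 4 = z.1 ^+ 4 + 4 * z.2 ^+ 2.
Proof.
have q0 : 0 <= z.1 ^+ 4 + 4 * z.2 ^+ 2.
  by apply: addr_ge0; [exact: exprn_even_ge0|rewrite mulr_ge0 ?sqr_ge0].
by rewrite -powR_mulrn ?hom_norm_ge0// /hom_norm -powRrM mulVf// powRr1.
Qed.

Definition hom_ball (r : R) : set (R * R) := [set z | hom_norm z <= r].

Lemma measurable_hom_ball r : measurable (hom_ball r : set (RM * RM)).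
Proof.
rewrite (_ : hom_ball r = setT `&` (@hom_norm R) @^-1` `]-oo, r]).
  exact: measurable_hom_norm.
by apply/seteqP; split=> z /=; rewrite /hom_ball/= in_itv/=; [|case].
Qed.

Lemma hom_ball_coord r z : 0 < r -> hom_ball r z -> z.1 ^+ 2 <= r ^+ 2 /\ z.2 ^+ 2 <= r ^+ 4.
Proof.
move=> r0 zr.
have : hom_norm z ^+ 4 <= r ^+ 4 by rewrite lerXn2r// nnegrE ?hom_norm_ge0// ltW.
rewrite hom_normX4 => H; have z2 := sqr_ge0 z.2; have z1 := sqr_ge0 z.1.
have r2 := sqr_ge0 r.
rewrite (exprM z.1 2 2) (exprM r 2 2) in H *; split; last by have := sqr_ge0 (z.1 ^+ 2); lra.
rewrite -(@ler_pXn2r _ 2)// ?nnegrE//; lra.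
Qed.

(* Up to a constant, the volume of [hom_ball r]; in closed form r^(6 alpha + 4). *)
Definition dil_volume (r : R) : R := (r ^+ 2) `^ b1 * (r ^+ 4) `^ b2.

Lemma dil_volume_gt0 r : 0 < r -> 0 < dil_volume r.
Proof. by move=> r0; apply: mulr_gt0; apply: powR_gt0; exact: exprn_gt0. Qed.

Lemma dil_volumeM r s : dil_volume (r * s) = dil_volume r * dil_volume s.
Proof.
have e4 x : 0 <= x ^+ 4 :> R by rewrite exprn_even_ge0.
rewrite /dil_volume !exprMn (powRM _ (sqr_ge0 _) (sqr_ge0 _)) (powRM _ (e4 _) (e4 _)); ring.
Qed.

Lemma dil_volume_le r : 0 < r -> r <= 1 -> dil_volume r <= r.
Proof.
move=> r0 r1; rewrite -[leRHS]mulr1 /dil_volume; apply: ler_pM; rewrite ?powR_ge0//.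
  apply: (@le_trans _ _ ((r ^+ 2) `^ 1)).
    by rewrite ger_powR ?lerDr// exprn_gt0//= exprn_ile1// ltW.
  by rewrite powRr1 ?sqr_ge0// expr2 ler_piMr// ltW.
rewrite -[leRHS]/((fun _ : R => 1) b2) -powR1 ge0_ler_powR ?nnegrE ?exprn_even_ge0 ?(ltW (b2_gt0 _))//.
by rewrite exprn_ile1// ltW.
Qed.

Lemma indic_hom_ball_le r z : 0 < r ->
  \1_(hom_ball r) z <= expR 2 * gauss2 ((r ^+ 2)^-1, (r ^+ 4)^-1) z.
Proof.
move=> r0; rewrite indicE; have [zr|_] := boolP (z \in _); last first.
  by rewrite mulr_ge0 ?expR_ge0 ?gauss2_ge0.
have [z1 z2] := hom_ball_coord r0 (set_mem zr).
rewrite /gauss2/= -!expRD -[leLHS]expR0 ler_expR.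
have : (r ^+ 2)^-1 * z.1 ^+ 2 <= 1 by rewrite mulrC ler_pdivrMr ?mul1r// exprn_gt0.
have : (r ^+ 4)^-1 * z.2 ^+ 2 <= 1 by rewrite mulrC ler_pdivrMr ?mul1r// exprn_gt0.
lra.
Qed.

(** The Gaussian with parameters r^-2 and r^-4 is at least exp(-2) on the ball, and its integral is
    explicit. *)
Lemma m_hom_ball r : 0 < r ->
  (\int[m]_z (\1_(hom_ball r) z)%:E <= (expR 2 * gauss2_const alpha * dil_volume r)%:E)%E.
Proof.
move=> r0.
have c0 : 0 < (r ^+ 2)^-1 by rewrite invr_gt0 exprn_gt0.
have d0 : 0 < (r ^+ 4)^-1 by rewrite invr_gt0 exprn_gt0.
have [ig eg] := @integral_gauss2 R alpha ((r ^+ 2)^-1, (r ^+ 4)^-1) c0 d0.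
have mg := measurable_gauss2 ((r ^+ 2)^-1, (r ^+ 4)^-1).
apply: (@le_trans _ _ (\int[m]_z ((expR 2)%:E * (gauss2 ((r ^+ 2)^-1, (r ^+ 4)^-1) z)%:E))%E).
  apply: ge0_le_integral => //.
  - apply/measurable_EFinP; apply: measurable_indic; exact: measurable_hom_ball.
  - by apply: measurable_funeM; exact/measurable_EFinP.
  by move=> z _; rewrite -EFinM lee_fin indic_hom_ball_le.
rewrite ge0_integralZl ?lee_fin ?expR_ge0//; last 2 first.
- exact/measurable_EFinP.
- by move=> z _; rewrite lee_fin gauss2_ge0.
rewrite -(fineK (integrable_fin_num measurableT ig)) -/(Rintegral _ _ _) eg -EFinM lee_fin.
rewrite /= /dil_volume.
have e4 : 0 <= r ^+ 4 by rewrite exprn_even_ge0.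
by rewrite -(powR_inv1 (sqr_ge0 r)) -(powR_inv1 e4) -!powRrM !mulrNN !mul1r !mulrA lexx.
Qed.

Definition trunc f (n : nat) (z : R * R) : R := f z * \1_(hom_ball n.+1%:R) z.

Lemma measurable_trunc f n : measurable_fun [set: RM * RM] f ->
  measurable_fun [set: RM * RM] (trunc f n).
Proof.
by move=> mf; apply: measurable_funM => //; apply: measurable_indic; exact: measurable_hom_ball.
Qed.

(** On a ball, which has finite measure, |f| <= 1 + f^2 makes an L^2 function integrable. *)
Lemma mass12_trunc f n : measurable_fun [set: RM * RM] f -> (sqint m f < +oo)%E ->
  (mass12 m (trunc f n) < +oo)%E.
Proof.
move=> mf foo; pose u z : R := \1_(hom_ball n.+1%:R) z.
have mu : measurable_fun [set: RM * RM] u by apply: measurable_indic; exact: measurable_hom_ball.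
apply: (@le_lt_trans _ _ (\int[m]_z ((u z)%:E + (2 * f z ^+ 2)%:E))%E).
  apply: ge0_le_integral => //.
  - by move=> z _; rewrite lee_fin addr_ge0// sqr_ge0.
  - apply/measurable_EFinP; apply: measurable_funD.
      by apply: measurableT_comp => //; exact: measurable_trunc.
    by apply: measurable_funX; exact: measurable_trunc.
  - apply/measurable_EFinP; apply: measurable_funD => //; apply: measurable_funM => //.
    exact: measurable_funX.
  move=> z _; rewrite lee_fin /trunc -/(u z) /u indicE; case: (z \in _); rewrite ?mulr1 ?mulr0.
    have : `|f z| <= 1 + f z ^+ 2.
      by rewrite -[f z ^+ 2]real_normK ?num_real//; have := sqr_ge0 (`|f z| - 1); nra.
    rewrite /=; lra.
  by rewrite normr0 expr0n !addr0 add0r mulr_ge0// sqr_ge0.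
rewrite ge0_integralD//; last 4 first.
- by move=> z _; rewrite lee_fin /u indicE.
- exact/measurable_EFinP.
- by move=> z _; rewrite lee_fin mulr_ge0// sqr_ge0.
- by apply/measurable_EFinP; apply: measurable_funM => //; exact: measurable_funX.
apply: lte_add_pinfty.
  by apply: (le_lt_trans (m_hom_ball _)) => //; rewrite ltry.
under eq_integral do rewrite EFinM.
rewrite ge0_integralZl//; last 2 first.
- exact: measurable_sqr.
- by move=> z _; rewrite lee_fin sqr_ge0.
exact: lte_mul_pinfty.
Qed.

Lemma trunc_cvg f : measurable_fun [set: RM * RM] f -> (sqint m f < +oo)%E ->
  forall e : R, 0 < e -> \forall n \near \oo, (sqint m (fun z => f z - trunc f n z)%R <= e%:E)%E.
Proof.
move=> mf foo e e0.
have mt n := measurable_trunc n mf.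
have i2 : m.-integrable setT (fun z => (f z ^+ 2)%:E).
  apply/integrableP; split; first exact: measurable_sqr.
  under eq_integral do rewrite gee0_abs ?lee_fin ?sqr_ge0//.
  exact: foo.
have [] := @dominated_convergence _ _ _ m _ measurableT
   (fun n z => ((f z - trunc f n z) ^+ 2)%:E) (cst 0%E) (fun z => (f z ^+ 2)%:E).
- by move=> n; apply: measurable_sqr; exact: measurable_funB.
- exact: measurable_cst.
- apply: aeW => z _; apply: cvg_EFin; first exact: nearW.
  apply: (cvg_near_cst).
  have [N _ HN] : \forall n \near \oo, hom_norm z <= n%:R by exact: nbhs_infty_ger.
  exists N => // n /= Nn; rewrite /trunc indicE mem_set ?mulr1 ?subrr ?expr0n//.
  by rewrite /hom_ball/= (le_trans (HN n Nn))// ler_nat.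
- exact: i2.
- apply: aeW => z n _; rewrite gee0_abs ?lee_fin ?sqr_ge0//.
  rewrite /trunc indicE; case: (_ \in _); rewrite ?mulr1 ?mulr0 ?subrr ?subr0//.
  by rewrite expr0n sqr_ge0.
move=> _ _; rewrite integral0 => /fine_cvgP[fn /cvgrPdist_le /(_ e e0)] H.
apply: filterS2 fn H => n /= F; rewrite sub0r normrN => D.
rewrite /sqint -(fineK F) lee_fin; exact: le_trans (ler_norm _) D.
Qed.

Lemma le_sqint_trunc f n : measurable_fun [set: RM * RM] f ->
  (sqint m (trunc f n) <= sqint m f)%E.
Proof.
move=> mf; apply: le_sqint => //; first exact: measurable_trunc.
by move=> z; rewrite normrM indicE; case: (_ \in _); rewrite ?normr1 ?normr0 ?mulr1 ?mulr0.
Qed.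

End truncation.

Section extension.
Context {R : realType} (alpha : {nonneg R}).
Local Notation RM := (measurableTypeR R).
Local Notation m := (m_alpha alpha).
Local Notation gam := (gamma_alpha alpha).
Local Notation kap := (plancherel_const alpha).

(* [G] is, up to null sets, the extension of [LBt] by continuity at [f]; the constant
   is not optimal. *)
Definition extends_LBt (f : R * R -> R) (G : R * nat -> R) : Prop :=
  measurable_fun [set: RM * nat] G /\
  forall g, measurable_fun [set: RM * RM] g -> (mass12 m g < +oo)%E ->
  (sqint gam (fun w => (G w - LBt alpha g w)%R) <= (16 * kap)%:E * sqint m (fun z => (f z - g z)%R))%E.

Lemma plancherel_leB g h : measurable_fun [set: RM * RM] g -> (mass12 m g < +oo)%E ->
  measurable_fun [set: RM * RM] h -> (mass12 m h < +oo)%E ->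
  (sqint gam (fun w => (LBt alpha g w - LBt alpha h w)%R) <=
   (4 * kap)%:E * sqint m (fun z => (g z - h z)%R))%E.
Proof.
move=> mg goo mh hoo.
rewrite -(LBtB mg mh (mass12_integrable mg goo) (mass12_integrable mh hoo)).
apply: plancherel_le; first exact: measurable_funB.
apply: (@le_lt_trans _ _ (2%:E * (mass12 m g + mass12 m h))%E).
  apply: mass12D => //; first exact: measurable_funB.
  by move=> z; exact: ler_normB.
by apply: lte_mul_pinfty => //; exact: lte_add_pinfty.
Qed.

Lemma exists_extends_LBt f : measurable_fun [set: RM * RM] f -> (sqint m f < +oo)%E ->
  exists G, extends_LBt f G.
Proof.
move=> mf foo; have k0 := plancherel_const_gt0 alpha.
(* Chosen so that the transforms of consecutive truncations differ by at most (9/16) 8^-k in squared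
   norm, as [riesz_fischer] requires. *)
pose dl k : R := (8^-1) ^+ k / (16 * kap).
have dl0 k : 0 < dl k by rewrite divr_gt0 ?exprn_gt0// mulr_gt0.
have Hn k : exists n, (sqint m (fun z => f z - trunc f n z)%R <= (dl k)%:E)%E.
  by have [N _ HN] := trunc_cvg mf foo (dl0 k); exists N; apply: HN => /=.
have [n {}Hn] := choice Hn; pose h k := trunc f (n k).
have mh k : measurable_fun [set: RM * RM] (h k) by exact: measurable_trunc.
have hoo k : (mass12 m (h k) < +oo)%E by exact: mass12_trunc.
have mL k := measurable_LBt (mh k) (hoo k).
have [||G mG GF] := @riesz_fischer _ _ _ gam (fun k => LBt alpha (h k)).
- by [].
- move=> k; apply: (le_trans (plancherel_leB _ _ _ _)) => //.
  apply: (@le_trans _ _ ((4 * kap)%:E * (2%:E * ((dl k.+1)%:E + (dl k)%:E)))%E).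
    rewrite lee_wpmul2l ?lee_fin ?(mulr_ge0 _ (ltW k0))//.
    apply: (le_trans (le_sqint_dist m (mh k.+1) mf (mh k))).
    rewrite lee_wpmul2l ?lee_fin//; apply: leeD; last exact: Hn.
    by rewrite sqint_distC; exact: Hn.
  rewrite -!(EFinD, EFinM) lee_fin /dl exprS.
  rewrite (_ : 4 * kap * _ = (8^-1 + 1) / 2 * 8^-1 ^+ k); last by field; rewrite gt_eqF.
  by rewrite ler_piMl ?exprn_ge0//; lra.
exists G; split=> // g mg goo.
have mLg := measurable_LBt mg goo.
have := sqint_ge0 m (fun z => f z - g z).
case E : (sqint m (fun z => f z - g z)) => [S| |]// S0; last first.
  by rewrite gt0_muley ?leey// lte_fin mulr_gt0.
apply/lee_addgt0Pr => e e0.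
apply: (@sqint_fatou _ _ _ gam (fun k w => LBt alpha (h k) w - LBt alpha g w)).
+ by move=> k; exact: measurable_funB.
+ exact: measurable_funB.
+ by apply: filterS GF => w Gw; apply: cvgB => //; exact: cvg_cst.
have d1 : dl k @[k --> \oo] --> 0.
  rewrite -[X in _ --> X](mul0r (16 * kap)^-1); apply: cvgM; last exact: cvg_cst.
  apply: cvg_expr; by rewrite ger0_norm// invf_lt1// ltr1n.
have e8 : 0 < e / (8 * kap) by rewrite divr_gt0// mulr_gt0.
move/cvgrPdist_le : d1 => /(_ _ e8); apply: filterS => k.
rewrite sub0r normrN gtr0_norm// => dk.
apply: (le_trans (plancherel_leB _ _ _ _)) => //.
apply: (@le_trans _ _ ((4 * kap)%:E * (2%:E * ((e / (8 * kap))%:E + S%:E)))%E).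
  rewrite lee_wpmul2l ?lee_fin ?(mulr_ge0 _ (ltW k0))//.
  apply: (le_trans (le_sqint_dist m (mh k) mf mg)).
  rewrite lee_wpmul2l ?lee_fin// E leeD// sqint_distC; apply: (le_trans (Hn k)).
  by rewrite lee_fin.
rewrite -!(EFinD, EFinM) lee_fin.
rewrite (_ : 4 * kap * _ = e + 8 * kap * S); last by field; rewrite gt_eqF.
by rewrite addrC lerD2r ler_wpM2r// ler_wpM2r ?(ltW k0)// ler_nat.
Qed.

(** Both extensions are compared with the transform of one truncation of f1. With truncation error d
    this gives 2 (16 kap d + 32 kap (S + d)) = 64 kap S + 96 kap d. *)
Lemma extends_LBt_lip f1 f2 G1 G2 :
  measurable_fun [set: RM * RM] f1 -> (sqint m f1 < +oo)%E ->
  measurable_fun [set: RM * RM] f2 ->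
  extends_LBt f1 G1 -> extends_LBt f2 G2 ->
  (sqint gam (fun w => (G1 w - G2 w)%R) <= (64 * kap)%:E * sqint m (fun z => (f1 z - f2 z)%R))%E.
Proof.
move=> mf1 foo mf2 [mG1 H1] [mG2 H2]; have k0 := plancherel_const_gt0 alpha.
have := sqint_ge0 m (fun z => f1 z - f2 z).
case E : (sqint m (fun z => f1 z - f2 z)) => [S| |]// S0; last first.
  by rewrite gt0_muley ?leey// lte_fin mulr_gt0.
apply/lee_addgt0Pr => e e0.
have e8 : 0 < e / (96 * kap) by rewrite divr_gt0// mulr_gt0.
have [N _ /(_ N (leqnn N)) HN] := trunc_cvg mf1 foo e8.
have mt := measurable_trunc N mf1; have too := mass12_trunc N mf1 foo.
have mL := measurable_LBt mt too.
apply: (le_trans (le_sqint_dist gam mG1 mL mG2)).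
apply: (@le_trans _ _ (2%:E * ((16 * kap)%:E * (e / (96 * kap))%:E +
   (16 * kap)%:E * (2%:E * (S%:E + (e / (96 * kap))%:E))))%E).
  rewrite lee_wpmul2l ?lee_fin// leeD//.
    by apply: (le_trans (H1 _ mt too)); rewrite lee_wpmul2l ?lee_fin ?(mulr_ge0 _ (ltW k0)).
  rewrite sqint_distC; apply: (le_trans (H2 _ mt too)).
  rewrite lee_wpmul2l ?lee_fin ?(mulr_ge0 _ (ltW k0))//.
  apply: (le_trans (le_sqint_dist m mf2 mf1 mt)).
  by rewrite lee_wpmul2l ?lee_fin// leeD// sqint_distC E.
rewrite -!(EFinD, EFinM) lee_fin le_eqVlt; apply/orP; left; apply/eqP; field.
by rewrite gt_eqF.
Qed.

End extension.

(** * Concentration on balls *)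

(** A Cauchy-Schwarz inequality in terms of positive upper bounds S and v, so that the optimal
    weight sqrt(v / S) exists even if h or the indicator is null. *)
Lemma integral_normr_indic_le d (T : measurableType d) (R : realType)
    (mu : {measure set T -> \bar R}) (h : T -> R) (B : set T) (S v : R) :
  measurable_fun [set: T] h -> measurable B -> 0 < S -> 0 < v ->
  (sqint mu h <= S%:E)%E -> (\int[mu]_x (\1_B x)%:E <= v%:E)%E ->
  (\int[mu]_x `|(h x * \1_B x)%:E| <= (Num.sqrt (S * v))%:E)%E.
Proof.
move=> mh mB S0 v0 hS Bv; set q := Num.sqrt (S * v).
have q0 : 0 < q by rewrite sqrtr_gt0 mulr_gt0.
have q2 : q ^+ 2 = S * v by rewrite sqr_sqrtr// mulr_ge0// ltW.
pose t := q / S; have t0 : 0 < t by rewrite divr_gt0.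
(* AM-GM: |h| 1_B <= t h^2 / 2 + 1_B / (2 t), with t = sqrt (v / S) *)
have mi : measurable_fun [set: T] (\1_B : T -> R) by exact: measurable_indic.
have i0 x : 0 <= \1_B x :> R by rewrite indicE.
have mh2 := measurable_sqr mh.
apply: (@le_trans _ _ (\int[mu]_x ((t / 2)%:E * (h x ^+ 2)%:E + (t^-1 / 2)%:E * (\1_B x)%:E))%E).
  apply: ge0_le_integral => //.
  - by apply: measurableT_comp => //; apply/measurable_EFinP; exact: measurable_funM.
  - apply: emeasurable_funD; first exact: measurable_funeM.
    by apply: measurable_funeM; exact/measurable_EFinP.
  move=> x _; rewrite abse_EFin -!EFinM -EFinD lee_fin normrM (ger0_norm (i0 x)).
  rewrite -[h x ^+ 2]real_normK ?num_real//; set y := `|h x|.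
  rewrite indicE; case: (x \in B); rewrite ?mulr1 ?mulr0 ?addr0; last first.
    by rewrite mulr_ge0 ?sqr_ge0// divr_ge0// ltW.
  rewrite -subr_ge0 (_ : _ - _ = (t / 2) * (y - t^-1) ^+ 2); last by field; rewrite gt_eqF.
  by rewrite mulr_ge0 ?sqr_ge0// divr_ge0// ltW.
have t2 : 0 <= t / 2 by rewrite divr_ge0// ltW.
have t3 : 0 <= t^-1 / 2 by rewrite divr_ge0// invr_ge0 ltW.
rewrite ge0_integralD//; last 4 first.
- by move=> x _; rewrite -EFinM lee_fin mulr_ge0 ?sqr_ge0.
- exact: measurable_funeM.
- by move=> x _; rewrite -EFinM lee_fin mulr_ge0.
- by apply: measurable_funeM; exact/measurable_EFinP.
rewrite ge0_integralZl//; last first.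
  by move=> x _; rewrite lee_fin sqr_ge0.
rewrite ge0_integralZl//; last exact/measurable_EFinP.
apply: (@le_trans _ _ ((t / 2)%:E * S%:E + (t^-1 / 2)%:E * v%:E)%E).
  by apply: leeD; rewrite lee_wpmul2l ?lee_fin.
rewrite -!EFinM -EFinD lee_fin le_eqVlt; apply/orP; left; apply/eqP.
have -> : v = q ^+ 2 / S by rewrite q2 mulrAC divff ?mul1r// gt_eqF.
by rewrite /t; field; rewrite !gt_eqF.
Qed.

Section spectral_ball.
Context {R : realType} (alpha : {nonneg R}).
Local Notation a := (alpha%:num).
Local Notation RM := (measurableTypeR R).
Local Notation b1 := (a + 1).
Local Notation b2 := (a + 2^-1).
Local Notation m := (m_alpha alpha).
Local Notation gam := (gamma_alpha alpha).
Local Notation kap := (plancherel_const alpha).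
Local Notation gc := (gauss2_const alpha).

Definition spec (w : R * nat) : R := 2 * (2 * w.2%:R + a + 1) * w.1.

Lemma measurable_spec : measurable_fun [set: RM * nat] spec.
Proof.
apply: measurable_funM => //.
exact: (@measurableT_comp _ _ _ _ _ _ (fun M : nat => 2 * (2 * M%:R + a + 1))).
Qed.

Definition spec_ball (rho : R) : set (R * nat) := [set w | 0 <= w.1 /\ spec w <= rho ^+ 2].

Lemma measurable_spec_ball rho : measurable (spec_ball rho : set (RM * nat)).
Proof.
rewrite (_ : spec_ball rho = (setT `&` fst @^-1` `[0, +oo[) `&` (setT `&` spec @^-1` `]-oo, rho ^+ 2])).
  apply: measurableI; last exact: measurable_spec.
  exact: (@measurable_fst _ _ RM nat).
apply/seteqP; split=> w /=; rewrite /spec_ball/= !in_itv/= andbT.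
  by case.
by case=> -[_ ?] [].
Qed.

Lemma spec_ball_le rho w : spec_ball rho w -> (4 * w.2%:R + 2) * w.1 <= rho ^+ 2.
Proof.
move=> [w0 H]; apply: le_trans H; rewrite /spec ler_wpM2r//.
have : 0 <= a by []. lra.
Qed.

Let transform_low : R := gc * 2 `^ (- b1) / 2 * expR (- 1).

Let transform_low_gt0 : 0 < transform_low.
Proof.
apply: mulr_gt0; last exact: expR_gt0.
apply: divr_gt0 => //; apply: mulr_gt0; [exact: gauss2_const_gt0|exact: powR_gt0].
Qed.

(** On the spectral ball (4 m + 2) lambda <= c = rho^2, so p = c + lambda/2 is at most 2 c,
    Bernoulli's inequality keeps (1 - lambda/p)^m above 1/2, and the exponent lambda^2 / (4 c^2) is
    at most 1. *)
Lemma gauss2_transform_ge rho w : 0 < rho -> spec_ball rho w ->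
  transform_low / dil_volume alpha rho <= gauss2_transform alpha (rho ^+ 2, rho ^+ 4) w.
Proof.
move=> r0 wE; have w0 : 0 <= w.1 by case: wE.
have H := spec_ball_le wE.
have n0 : 0 <= w.2%:R :> R by [].
have p2 : 0 < rho ^+ 2 by rewrite exprn_gt0.
have p4 : 0 < rho ^+ 4 by rewrite exprn_gt0.
set l := w.1 in w0 H *; set c := rho ^+ 2 in H p2 *.
have lc : 2 * l <= c by nra.
have cl0 : 0 < c + l / 2 by lra.
pose q := l / (c + l / 2).
have q0 : 0 <= q by rewrite divr_ge0// ltW.
have q1 : (4 * w.2%:R + 2) * q <= 1.
  by rewrite /q mulrA ler_pdivrMr// mul1r; apply: (le_trans H); lra.
have E1 : 2 `^ (- b1) * c `^ (- b1) <= (c + l / 2) `^ (- b1).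
  rewrite -powRM ?(ltW p2)// !powRN lef_pV2 ?posrE ?powR_gt0// ?mulr_gt0//.
  rewrite ge0_ler_powR ?nnegrE ?(ltW (b1_gt0 alpha)) ?(ltW cl0)//.
    by rewrite mulr_ge0// ltW.
  lra.
have E2 : 2^-1 <= (1 - l * (c + l / 2) `^ (- 1)) ^+ w.2.
  have nq : 0 <= w.2%:R * q by rewrite mulr_ge0.
  have q01 : 0 <= q <= 1 by rewrite q0/=; lra.
  by rewrite powR_inv1 ?(ltW cl0)// -/q; have := bernoulli_le w.2 q01; lra.
have E3 : expR (- 1) <= expR (- (l ^+ 2 / (4 * rho ^+ 4))).
  rewrite ler_expR lerN2 ler_pdivrMr ?mulr_gt0// mul1r.
  rewrite (_ : rho ^+ 4 = c ^+ 2); last by rewrite /c -exprM.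
  nra.
rewrite /gauss2_transform /transform_low /dil_volume /= -/c -/l invfM -!powRN.
rewrite (_ : _ * _ = gc * ((2 `^ (- b1) * c `^ (- b1)) * 2^-1) * ((rho ^+ 4) `^ (- b2) * expR (-1))); last by ring.
have g0 := gauss2_const_gt0 alpha.
apply: ler_pM.
- by apply: mulr_ge0; [exact: ltW|rewrite !mulr_ge0 ?powR_ge0].
- by rewrite mulr_ge0 ?powR_ge0 ?expR_ge0.
- rewrite ler_wpM2l ?(ltW g0)//; apply: ler_pM => //.
  by rewrite mulr_ge0 ?powR_ge0.
- by rewrite ler_wpM2l ?powR_ge0.
Qed.

(* The transform of the Gaussian with parameters rho^2, rho^4 is bounded below on
   [spec_ball rho], so Plancherel for this Gaussian bounds the measure of the ball. *)
Lemma sqint_spec_ball : exists2 K : R, 0 < K & forall rho, 0 < rho ->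
  (sqint gam (\1_(spec_ball rho) : R * nat -> R) <= (K * dil_volume alpha rho)%:E)%E.
Proof.
have k0 := plancherel_const_gt0 alpha; have g0 := gauss2_const_gt0 alpha.
exists (kap * gc / transform_low ^+ 2).
  by rewrite divr_gt0 ?exprn_gt0//; exact: mulr_gt0.
move=> rho r0; have V0 := dil_volume_gt0 alpha r0.
set V := dil_volume alpha rho in V0 *.
have p2 : 0 < rho ^+ 2 by rewrite exprn_gt0.
have p4 : 0 < rho ^+ 4 by rewrite exprn_gt0.
pose s : seq (R * ({posnum R} * {posnum R})) := [:: (1, (PosNum p2, PosNum p4))].
(* The factor that raises the lower bound of the transform on the spectral ball to 1, so that it
   dominates the indicator. *)
pose cK : R := V / transform_low.
have mT := @measurable_gsum_transform R alpha s.
have sT w : gsum_transform alpha s w = gauss2_transform alpha (rho ^+ 2, rho ^+ 4) w.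
  by rewrite /gsum_transform big_seq1 mul1r.
have sG z : gsum s z = gauss2 (rho ^+ 2, rho ^+ 4) z by rewrite /gsum big_seq1 mul1r.
pose ik : R * nat -> R := \1_(Khat_space : set (RM * nat)).
have mik : measurable_fun [set: RM * nat] ik.
  by apply: measurable_indic; exact: measurableX.
apply: (@le_trans _ _ (sqint gam (fun w => cK * gsum_transform alpha s w * ik w)%R)).
  apply: le_sqint.
  - by apply: measurable_indic; exact: measurable_spec_ball.
  - by apply: measurable_funM => //; exact: measurable_funM.
  move=> w; rewrite indicE; have [/set_mem wE|_] := boolP (w \in _); last by rewrite normr0.
  have w0 : 0 <= w.1 by case: wE.
  rewrite /ik indicE mem_set; last by split=> //=; rewrite in_itv/= w0.
  rewrite normr1 mulr1 sT (le_trans _ (ler_norm _))//.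
  rewrite mulrC -ler_pdivrMr ?divr_gt0// mul1r invf_div.
  exact: gauss2_transform_ge.
rewrite (@sqint_gamma_eq _ _ _ (fun w => cK * gsum_transform alpha s w)); last 3 first.
- by apply: measurable_funM => //; exact: measurable_funM.
- exact: measurable_funM.
- move=> w w0; rewrite /ik indicE mem_set ?mulr1//.
  by split=> //=; rewrite in_itv/= w0.
rewrite sqint_scale// plancherel_gsum.
have [ig eg] := @integral_gauss2 R alpha (rho ^+ 2, rho ^+ 4) p2 p4.
have mg := measurable_gauss2 (rho ^+ 2, rho ^+ 4).
have Hg : (sqint m (gsum s) <= (gc / V)%:E)%E.
  apply: (@le_trans _ _ (\int[m]_z (gauss2 (rho ^+ 2, rho ^+ 4) z)%:E)%E).
    apply: ge0_le_integral => //.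
    - by move=> z _; rewrite lee_fin sqr_ge0.
    - by apply: measurable_sqr; exact: measurable_gsum.
    - exact/measurable_EFinP.
    move=> z _; rewrite lee_fin sG expr2 ler_piMr ?gauss2_ge0//.
    rewrite /gauss2 -expRD -[leRHS]expR0 ler_expR -opprD oppr_le0.
    by apply: addr_ge0; apply: mulr_ge0; rewrite ?sqr_ge0//= ltW.
  rewrite -(fineK (integrable_fin_num measurableT ig)) -/(Rintegral _ _ _) eg lee_fin.
  by rewrite /V /dil_volume invfM -!powRN mulrA.
apply: (@le_trans _ _ ((cK ^+ 2)%:E * (kap%:E * (gc / V)%:E))%E).
  rewrite lee_wpmul2l ?lee_fin ?sqr_ge0// lee_wpmul2l ?lee_fin ?(ltW k0)//.
rewrite -!EFinM lee_fin /cK.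
have t0 := transform_low_gt0; set t := transform_low in t0 *.
by rewrite le_eqVlt; apply/orP; left; apply/eqP; field; rewrite !gt_eqF.
Qed.

(** Here m lambda x^2 <= rho^2 r^2 <= 1, the range of the bound on Laguerre functions that is
    uniform in m. *)
Lemma LB_kernel_le rho r w z : 0 < rho -> 0 < r -> rho * r <= 1 ->
  spec_ball rho w -> hom_ball r z -> `|LB_kernel alpha w z| <= expR 1.
Proof.
move=> rho0 r0 rr wE zB; have w0 : 0 <= w.1 by case: wE.
have [z1 _] := hom_ball_coord r0 zB; have H := spec_ball_le wE.
have n0 : 0 <= w.2%:R :> R by [].
rewrite LB_kernelE normrM -[leRHS]mulr1; apply: ler_pM => //; last exact: kernelJ_le1.
apply: laguerre_fun_le => //; first by rewrite mulr_ge0// sqr_ge0.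
have z0 := sqr_ge0 z.1.
have : (rho * r) ^+ 2 <= 1 by rewrite exprn_ile1// mulr_ge0// ltW.
rewrite exprMn => H1.
have H2 : w.2%:R * w.1 <= rho ^+ 2 by nra.
rewrite mulrA; apply: le_trans H1; apply: ler_pM => //.
by rewrite mulr_ge0.
Qed.

End spectral_ball.

(** * The uncertainty inequality at a fixed scale *)

Section dilated_estimate.
Context {R : realType} (alpha : {nonneg R}).
Local Notation a := (alpha%:num).
Local Notation RM := (measurableTypeR R).
Local Notation m := (m_alpha alpha).
Local Notation gam := (gamma_alpha alpha).
Local Notation kap := (plancherel_const alpha).
Local Notation gc := (gauss2_const alpha).

Let e2 : R := expR 1 ^+ 2.

(** The transform of the part in the ball is at most e times its L^1 norm, which Cauchy-Schwarz
    bounds by the ball volume. Squaring and integrating over the spectral ball multiplies the two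
    volumes, a function of rho r alone. *)
Let low_part : exists2 K : R, 0 < K & forall (h : R * R -> R) (rho r S : R),
  0 < rho -> 0 < r -> rho * r <= 1 -> 0 < S ->
  measurable_fun [set: RM * RM] h -> (mass12 m h < +oo)%E -> (sqint m h <= S%:E)%E ->
  (sqint gam (fun w => LBt alpha (fun z => h z * \1_(hom_ball r) z) w * \1_(spec_ball alpha rho) w)%R
    <= (K * dil_volume alpha (rho * r) * S)%:E)%E.
Proof.
have [K K0 HK] := sqint_spec_ball alpha.
have g0 := gauss2_const_gt0 alpha.
exists (e2 * (expR 2 * gc) * K).
  by rewrite mulr_gt0// mulr_gt0// ?exprn_gt0 ?expR_gt0// mulr_gt0// expR_gt0.
move=> h rho r S rho0 r0 rr S0 mh hoo hS.
have V0 := dil_volume_gt0 alpha r0; have V'0 := dil_volume_gt0 alpha rho0.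
set B := hom_ball r; set E := spec_ball alpha rho.
have mB : measurable (B : set (RM * RM)) by exact: measurable_hom_ball.
have mE : measurable (E : set (RM * nat)) by exact: measurable_spec_ball.
have mi : measurable_fun [set: RM * RM] (\1_B : R * R -> R) by exact: measurable_indic.
have mj : measurable_fun [set: RM * nat] (\1_E : R * nat -> R) by exact: measurable_indic.
pose hB z := h z * \1_B z.
have mhB : measurable_fun [set: RM * RM] hB by exact: measurable_funM.
have hB_le z : `|hB z| <= `|h z|.
  by rewrite /hB normrM indicE; case: (_ \in _); rewrite ?normr1 ?normr0 ?mulr1 ?mulr0.
have hBoo : (mass12 m hB < +oo)%E by exact: le_lt_trans (le_mass12 m mhB mh hB_le) hoo.
pose v := expR 2 * gc * dil_volume alpha r.
have v0 : 0 < v by rewrite mulr_gt0// mulr_gt0// expR_gt0.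
pose q := Num.sqrt (S * v).
have IB : (\int[m]_z `|(hB z)%:E| <= q%:E)%E.
  apply: integral_normr_indic_le => //; exact: m_hom_ball.
have HB w : E w -> `|LBt alpha hB w| <= expR 1 * q.
  move=> wE; have w0 : 0 <= w.1 by case: wE.
  rewrite -lee_fin EFinM.
  apply: (le_trans (@LBt_bound _ alpha hB w (expR 1) w0 mhB (mass12_integrable mhB hBoo) _ (expR_ge0 _))).
    move=> z; rewrite /hB indicE; have [/set_mem zB _|_] := boolP (z \in B).
      exact: LB_kernel_le rho0 r0 rr wE zB.
    by rewrite mulr0 eqxx.
  by rewrite lee_wpmul2l ?lee_fin ?expR_ge0.
apply: (@le_trans _ _ (sqint gam (fun w => (expR 1 * q) * \1_E w)%R)).
  apply: le_sqint.
  - by apply: measurable_funM => //; exact: measurable_LBt.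
  - exact: measurable_funM.
  move=> w; rewrite !normrM indicE; have [/set_mem wE|_] := boolP (w \in E); last by rewrite normr0 !mulr0.
  rewrite normr1 !mulr1 -normrM; apply: le_trans (HB w wE) _; exact: ler_norm.
rewrite sqint_scale//.
apply: (@le_trans _ _ (((expR 1 * q) ^+ 2)%:E * (K * dil_volume alpha rho)%:E)%E).
  by rewrite lee_wpmul2l ?lee_fin ?sqr_ge0// HK.
rewrite -EFinM lee_fin exprMn sqr_sqrtr; last by rewrite mulr_ge0// ltW.
rewrite dil_volumeM /v /e2 le_eqVlt; apply/orP; left; apply/eqP; ring.
Qed.

(** Outside the ball (|z| / r)^p >= 1. The function h is a truncation of f, whereas the weighted
    norm is that of f itself. *)
Let high_space (h : R * R -> R) (f : R * R -> R) (r p : R) : 0 < r -> 0 < p ->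
  measurable_fun [set: RM * RM] h -> measurable_fun [set: RM * RM] f ->
  (forall z, `|h z| <= `|f z|) ->
  (sqint m (fun z => h z - h z * \1_(hom_ball r) z)%R <=
   (r `^ (- (2 * p)))%:E * sqint m (fun z => hom_norm z `^ p * f z)%R)%E.
Proof.
move=> r0 p0 mh mf hf.
have mhp : measurable_fun [set: RM * RM] (fun z => hom_norm z `^ p * f z).
  by apply: measurable_funM => //; apply: (measurableT_comp (measurable_powR _)) => //; exact: measurable_hom_norm.
have -> : r `^ (- (2 * p)) = (r `^ (- p)) ^+ 2.
  by rewrite -powR_mulrn ?powR_ge0// -powRrM; congr (_ `^ _); ring.
rewrite -sqint_scale//; apply: le_sqint.
- apply: measurable_funB => //; apply: measurable_funM => //.
  by apply: measurable_indic; exact: measurable_hom_ball.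
- exact: measurable_funM.
move=> z; rewrite indicE; have [_|zB] := boolP (z \in _).
  by rewrite mulr1 subrr normr0.
rewrite mulr0 subr0 mulrA normrM (le_trans (hf z))//.
rewrite ler_peMl// ger0_norm ?mulr_ge0 ?powR_ge0//.
have rz : r <= hom_norm z.
  rewrite leNgt; apply: contraNN zB => zr; rewrite inE /hom_ball/=; exact: ltW.
rewrite powRN -ler_pdivrMl ?invr_gt0 ?powR_gt0// invrK mulr1.
by rewrite ge0_ler_powR ?nnegrE ?(ltW p0) ?(ltW r0)// hom_norm_ge0.
Qed.

(** The weighted norm is available for the extension G and not for the transform of h, hence the
    additional distance term. *)
Let high_spec (h : R * R -> R) (G : R * nat -> R) (rho b : R) : 0 < rho -> 0 < b ->
  measurable_fun [set: RM * RM] h -> (mass12 m h < +oo)%E -> measurable_fun [set: RM * nat] G ->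
  (sqint gam (fun w => LBt alpha h w - LBt alpha h w * \1_(spec_ball alpha rho) w)%R <=
   2%:E * (sqint gam (fun w => G w - LBt alpha h w)%R +
    (rho `^ (- (4 * b)))%:E * sqint gam (fun w => spec alpha w `^ b * G w)%R))%E.
Proof.
move=> rho0 b0 mh hoo mG; have mL := measurable_LBt mh hoo.
have mGp : measurable_fun [set: RM * nat] (fun w => spec alpha w `^ b * G w).
  by apply: measurable_funM => //; apply: (measurableT_comp (measurable_powR _)) => //; exact: measurable_spec.
have -> : rho `^ (- (4 * b)) = (rho `^ (- (2 * b))) ^+ 2.
  by rewrite -powR_mulrn ?powR_ge0// -powRrM; congr (_ `^ _); ring.
rewrite -sqint_scale//; apply: le_sqintD.
- exact: measurable_funB.
- exact: measurable_funM.
- apply: measurable_funB => //; apply: measurable_funM => //.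
  by apply: measurable_indic; exact: measurable_spec_ball.
move=> w; rewrite indicE; have [_|wE] := boolP (w \in _).
  by rewrite mulr1 subrr normr0 addr_ge0.
rewrite mulr0 subr0; have [w0|w0] := boolP (0 <= w.1); last first.
  by rewrite {1}/LBt (negbTE w0) normr0 addr_ge0.
have rs : rho ^+ 2 <= spec alpha w.
  rewrite leNgt; apply: contraNN wE => ws; rewrite inE /spec_ball/=; split=> //; exact: ltW.
have H : `|G w| <= `|rho `^ (- (2 * b)) * (spec alpha w `^ b * G w)|.
  rewrite mulrA normrM ler_peMl// ger0_norm ?mulr_ge0 ?powR_ge0//.
  rewrite powRN -ler_pdivrMl ?invr_gt0 ?powR_gt0// invrK mulr1 powRrM powR_mulrn ?(ltW rho0)//.
  rewrite ge0_ler_powR ?nnegrE ?sqr_ge0 ?(ltW b0)//.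
  exact: le_trans (sqr_ge0 _) rs.
have := ler_distD (G w) (LBt alpha h w) 0; rewrite !subr0 distrC => /le_trans; apply.
by rewrite lerD2l.
Qed.

Lemma dilated_estimate (p b : R) : 0 < p -> 0 < b -> exists2 C : R, 0 < C &
  forall (f : R * R -> R) (G : R * nat -> R) (r : R), 0 < r ->
  measurable_fun [set: RM * RM] f -> (sqint m f < +oo)%E -> extends_LBt alpha f G ->
  (sqint m f <= C%:E * ((r `^ (- (2 * p)))%:E * sqint m (fun z => hom_norm z `^ p * f z)%R +
     (r `^ (4 * b))%:E * sqint gam (fun w => spec alpha w `^ b * G w)%R))%E.
Proof.
move=> p0 b0; have [K K0 HK] := low_part; have k0 := plancherel_const_gt0 alpha.
(* [th] makes the contribution of the ball and of the spectral ball absorbable in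
   the left-hand side. *)
pose th : R := Num.min 1 (kap / (32 * K)).
have th0 : 0 < th by rewrite lt_min ltr01/= divr_gt0// mulr_gt0.
have th1 : th <= 1 by rewrite ge_min lexx.
have thK : 32 * (K * dil_volume alpha th) <= kap.
  apply: (@le_trans _ _ (32 * (K * th))).
    by rewrite ler_pM2l// ler_pM2l// dil_volume_le.
  by rewrite mulrA mulrC -ler_pdivlMr ?mulr_gt0// /th ge_min lexx orbT.
pose c2 : R := 64 / kap * th `^ (- (4 * b)).
have c20 : 0 <= c2 by rewrite mulr_ge0 ?powR_ge0// divr_ge0// ltW.
exists (256 + c2); first by rewrite ltr_pwDl.
move=> f G r r0 mf foo [mG HG].
set A := sqint m (fun z => hom_norm z `^ p * f z).
set B := sqint gam (fun w => spec alpha w `^ b * G w).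
have A0 : (0 <= A)%E by exact: sqint_ge0.
have B0 : (0 <= B)%E by exact: sqint_ge0.
have rp : 0 < r `^ (- (2 * p)) by exact: powR_gt0.
have rb : 0 < r `^ (4 * b) by exact: powR_gt0.
have C0 : 0 < 256 + c2 by rewrite ltr_pwDl.
case EA : A A0 => [Ar| |]// A0; last first.
  rewrite gt0_muley ?lte_fin// addye; last first.
    by rewrite gt_eqF// (@lt_le_trans _ _ 0%E)// mule_ge0 ?lee_fin// ltW.
  by rewrite gt0_muley ?lte_fin ?leey.
case EB : B B0 => [Br| |]// B0; last first.
  rewrite gt0_muley ?lte_fin// addey//.
  by rewrite gt0_muley ?lte_fin ?leey.
rewrite lee_fin in A0; rewrite lee_fin in B0.
have := sqint_ge0 m f; case Ef : (sqint m f) foo => [Sf| |]// foo; rewrite lee_fin => Sf0.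
rewrite -!(EFinM, EFinD) lee_fin; apply/ler_addgt0Pr => eps eps0.
(* The truncation error; the estimates below add up to 1090 d, less than eps = 2048 d. *)
pose d := eps / 64 / 32; have d0 : 0 < d by rewrite !divr_gt0.
have foo' : (sqint m f < +oo)%E by rewrite Ef.
have [N _ /(_ N (leqnn N)) HN] := trunc_cvg mf foo' d0.
set h := trunc f N in HN.
have mh : measurable_fun [set: RM * RM] h by exact: measurable_trunc.
have hoo : (mass12 m h < +oo)%E by exact: mass12_trunc.
have mL := measurable_LBt mh hoo.
have hSf : (sqint m h <= Sf%:E)%E by rewrite -Ef; exact: le_sqint_trunc.
have := sqint_ge0 m h; case Eh : (sqint m h) hSf => [Sh| |]// hSf; rewrite lee_fin => Sh0.
(* The frequency radius is tied to r so that rho r is the fixed small number [th]. *)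
pose rho := th / r; have rho0 : 0 < rho by rewrite divr_gt0.
have rhor : rho * r = th by rewrite divfK// gt_eqF.
set E := spec_ball alpha rho; pose hB z := h z * \1_(hom_ball r) z.
have mE : measurable_fun [set: RM * nat] (\1_E : R * nat -> R).
  by apply: measurable_indic; exact: measurable_spec_ball.
have mhB : measurable_fun [set: RM * RM] hB.
  by apply: measurable_funM => //; apply: measurable_indic; exact: measurable_hom_ball.
have hB_le z : `|hB z| <= `|h z|.
  by rewrite /hB normrM indicE; case: (_ \in _); rewrite ?normr1 ?normr0 ?mulr1 ?mulr0.
have hC_le z : `|h z - hB z| <= `|h z|.
  by rewrite /hB indicE; case: (_ \in _); rewrite ?mulr1 ?mulr0 ?subrr ?subr0 ?normr0.
have hBoo : (mass12 m hB < +oo)%E by exact: le_lt_trans (le_mass12 m mhB mh hB_le) hoo.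
have mhC : measurable_fun [set: RM * RM] (fun z => h z - hB z) by exact: measurable_funB.
have hCoo : (mass12 m (fun z => h z - hB z)%R < +oo)%E by exact: le_lt_trans (le_mass12 m mhC mh hC_le) hoo.
have mLB := measurable_LBt mhB hBoo; have mLC := measurable_LBt mhC hCoo.
(* [Sh + d] instead of [Sh], because the bound asks for a strictly positive number and h may be
   null. *)
have S1 : (sqint gam (fun w => LBt alpha hB w * \1_E w)%R <= (K * dil_volume alpha th * (Sh + d))%:E)%E.
  rewrite -rhor; apply: HK => //; rewrite ?rhor//; first by rewrite ltr_wpDl.
  by rewrite Eh lee_fin lerDl ltW.
have S2 : (sqint gam (LBt alpha (fun z => h z - hB z)%R) <= (4 * kap * (r `^ (- (2 * p)) * Ar))%:E)%E.
  apply: (le_trans (plancherel_le mhC hCoo)).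
  rewrite [leRHS]EFinM lee_wpmul2l ?lee_fin ?(mulr_ge0 _ (ltW k0))//.
  rewrite EFinM -EA; apply: high_space => // z.
  by rewrite /h normrM indicE; case: (_ \in _); rewrite ?normr1 ?normr0 ?mulr1 ?mulr0.
have S3 : (sqint gam (fun w => LBt alpha h w - LBt alpha h w * \1_E w)%R <=
    (2 * (16 * kap * d + rho `^ (- (4 * b)) * Br))%:E)%E.
  apply: (le_trans (high_spec rho0 b0 mh hoo mG)).
  rewrite -/B EB EFinM lee_wpmul2l ?lee_fin// EFinD; apply: leeD => //.
  apply: (le_trans (HG h mh hoo)).
  by rewrite [leRHS]EFinM lee_wpmul2l ?lee_fin ?(mulr_ge0 _ (ltW k0)).
have S4 : (sqint gam (fun w => LBt alpha h w * \1_E w)%R <=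
   (2 * (K * dil_volume alpha th * (Sh + d) + 4 * kap * (r `^ (- (2 * p)) * Ar)))%:E)%E.
  apply: (@le_trans _ _ (2%:E * (sqint gam (fun w => LBt alpha hB w * \1_E w)%R +
      sqint gam (LBt alpha (fun z => h z - hB z)%R)))%E); last first.
    by rewrite EFinM lee_wpmul2l ?lee_fin// EFinD leeD.
  apply: le_sqintD => //; [exact: measurable_funM|exact: measurable_funM|].
  move=> w; rewrite (LBtB mh mhB (mass12_integrable mh hoo) (mass12_integrable mhB hBoo)).
  rewrite indicE; case: (_ \in _); rewrite ?mulr1 ?mulr0 ?normr0 ?addr_ge0//.
  by have := ler_normD (LBt alpha hB w) (LBt alpha h w - LBt alpha hB w); rewrite addrC subrK.
have S5 : (sqint gam (LBt alpha h) <= (2 * (2 * (K * dil_volume alpha th * (Sh + d) +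
     4 * kap * (r `^ (- (2 * p)) * Ar)) + 2 * (16 * kap * d + rho `^ (- (4 * b)) * Br)))%:E)%E.
  apply: (@le_trans _ _ (2%:E * (sqint gam (fun w => LBt alpha h w * \1_E w)%R +
      sqint gam (fun w => LBt alpha h w - LBt alpha h w * \1_E w)%R))%E); last first.
    by rewrite EFinM lee_wpmul2l ?lee_fin// EFinD leeD.
  apply: le_sqintD => //; [exact: measurable_funM|by apply: measurable_funB => //; exact: measurable_funM|].
  move=> w; rewrite indicE; case: (_ \in _); first by rewrite mulr1 subrr normr0 addr0.
  by rewrite mulr0 subr0 normr0 add0r.
have S6 := plancherel_ge mh hoo; rewrite Eh in S6.
have e4 : (0%:E <= 4%:E :> \bar R)%E by rewrite lee_fin.
have {}S6 := le_trans S6 (lee_wpmul2l e4 S5).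
rewrite -!EFinM lee_fin in S6.
have S7 : Sf <= 2 * (d + Sh).
  rewrite -lee_fin (_ : (2 * (d + Sh))%:E = 2%:E * (d%:E + Sh%:E))%E//.
  rewrite -Eh -Ef.
  apply: (@le_trans _ _ (2%:E * (sqint m (fun z => f z - h z)%R + sqint m h))%E).
    apply: le_sqintD => //; first exact: measurable_funB.
    by move=> z; have := ler_normD (f z - h z) (h z); rewrite subrK.
  by rewrite lee_wpmul2l ?lee_fin// leeD.
have rhoE : rho `^ (- (4 * b)) = th `^ (- (4 * b)) * r `^ (4 * b).
  rewrite /rho powRM ?invr_ge0 ?(ltW th0) ?(ltW r0)//; congr (_ * _).
  by rewrite -powR_inv1 ?(ltW r0)// -powRrM mulN1r opprK.
rewrite rhoE in S6.
set X := r `^ (- (2 * p)) * Ar in S6 *; set Y := r `^ (4 * b) in S6 rb *.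
set t := th `^ (- (4 * b)) in S6 c2 c20 C0 *.
have t0 : 0 <= t by exact: powR_ge0.
have X0 : 0 <= X by rewrite mulr_ge0// ltW.
have YB0 : 0 <= Y * Br by rewrite mulr_ge0// ltW.
set V := K * dil_volume alpha th in S6 thK.
(* The absorption: the low part enters [S6] as 16 V (Sh + d), at most half of kap (Sh + d) by [thK].
   Moving it to the left gives 513 d, rounded up to 32 * 17 d. *)
have S8 : Sh <= (32 * 17) * d + 128 * X + 32 / kap * t * (Y * Br).
  rewrite -(ler_pM2l k0).
  have -> : kap * ((32 * 17) * d + 128 * X + 32 / kap * t * (Y * Br)) =
     (32 * 17) * (kap * d) + 128 * (kap * X) + 32 * (t * (Y * Br)) by field; rewrite gt_eqF.
  have : 32 * V * (Sh + d) <= kap * (Sh + d) by rewrite ler_wpM2r// addr_ge0// ltW.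
  move: S6; rewrite -!(mulrA t) => S6 S9. 
  have : 0 <= kap * d by rewrite mulr_ge0// ltW.
  have : 0 <= kap * X by rewrite mulr_ge0// ltW.
  lra.
have -> : (256 + c2) * (X + Y * Br) + eps = 256 * X + 64 / kap * t * (Y * Br) + 64 * 32 * d +
    (c2 * X + 256 * (Y * Br)).
  by rewrite /d /c2; field; rewrite gt_eqF.
have : 0 <= c2 * X by rewrite mulr_ge0.
lra.
Qed.

End dilated_estimate.

(** * Complex-valued functions and choice of the scale *)

Section complex_norms.
Context d (T : measurableType d) (R : realType).
Variable mu : {measure set T -> \bar R}.
Implicit Types F : T -> R[i].

Definition csqint F : \bar R :=
  (sqint mu (fun x => complex.Re (F x)) + sqint mu (fun x => complex.Im (F x)))%E.

Lemma csqint_ge0 F : (0 <= csqint F)%E.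
Proof. by rewrite adde_ge0 ?sqint_ge0. Qed.

Lemma cLnorm2E F : measurable_fun [set: T] (fun x => complex.Re (F x)) ->
  measurable_fun [set: T] (fun x => complex.Im (F x)) ->
  cLnorm mu 2%:E F = (csqint F `^ 2^-1)%E.
Proof.
move=> mr mi; rewrite /cLnorm unlock /csqint /sqint -ge0_integralD//; last 4 first.
- by move=> x _; rewrite lee_fin sqr_ge0.
- exact: measurable_sqr.
- by move=> x _; rewrite lee_fin sqr_ge0.
- exact: measurable_sqr.
congr (_ `^ _)%E; apply: eq_integral => x _.
rewrite abse_EFin poweR_EFin -EFinD; congr EFin.
case: (F x) => u v /=; have uv : 0 <= u ^+ 2 + v ^+ 2 by rewrite addr_ge0 ?sqr_ge0.
by rewrite ger0_norm ?sqrtr_ge0// powR_mulrn ?sqrtr_ge0// sqr_sqrtr.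
Qed.

Lemma cLnorm2_lt F (e : R) : 0 < e -> measurable_fun [set: T] (fun x => complex.Re (F x)) ->
  measurable_fun [set: T] (fun x => complex.Im (F x)) ->
  (cLnorm mu 2%:E F < e%:E)%E = (csqint F < (e ^+ 2)%:E)%E.
Proof.
move=> e0 mr mi; rewrite cLnorm2E//.
have := csqint_ge0 F; case: (csqint F) => [s| |]//.
  rewrite lee_fin => s0; rewrite poweR_EFin !lte_fin powR12_sqrt//.
  by rewrite -{1}(ger0_norm (ltW e0)) -sqrtr_sqr ltr_sqrt// exprn_gt0.
by move=> _; rewrite poweRyr// ?ltNge ?leey// invr_neq0.
Qed.

Lemma cLfun2P F : cLfun mu 2%:E F <->
  [/\ measurable_fun [set: T] (fun x => complex.Re (F x)),
      measurable_fun [set: T] (fun x => complex.Im (F x)),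
      (sqint mu (fun x => complex.Re (F x)) < +oo)%E &
      (sqint mu (fun x => complex.Im (F x)) < +oo)%E].
Proof.
split.
  move=> [mr mi]; rewrite cLnorm2E// => /lty_poweRy; rewrite invr_neq0// => /(_ isT) H.
  split=> //; apply: le_lt_trans H; rewrite /csqint; first by rewrite leeDl ?sqint_ge0.
  by rewrite leeDr ?sqint_ge0.
move=> [mr mi sr si]; split=> //; rewrite cLnorm2E//; apply: poweR_lty.
exact: lte_add_pinfty.
Qed.

Lemma cLnorm1_lt F : measurable_fun [set: T] (fun x => complex.Re (F x)) ->
  measurable_fun [set: T] (fun x => complex.Im (F x)) ->
  (cLnorm mu 1%:E F < +oo)%E <->
  (\int[mu]_x `|(complex.Re (F x))%:E| < +oo)%E /\ (\int[mu]_x `|(complex.Im (F x))%:E| < +oo)%E.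
Proof.
move=> mr mi; rewrite /cLnorm Lnorm1.
have mN : measurable_fun [set: T] (fun x => `|(Normc.normc (F x))%:E|%E).
  apply: measurableT_comp => //; apply/measurable_EFinP.
  rewrite (_ : (fun x => _) = (fun x => (complex.Re (F x) ^+ 2 + complex.Im (F x) ^+ 2) `^ 2^-1)).
    apply: (measurableT_comp (measurable_powR _)) => //.
    by apply: measurable_funD; exact: measurable_funX.
  by apply/funext => x; case: (F x) => u v/=; rewrite powR12_sqrt// addr_ge0 ?sqr_ge0.
have mr' : measurable_fun [set: T] (fun x => `|(complex.Re (F x))%:E|%E).
  by apply: measurableT_comp => //; exact/measurable_EFinP.
have mi' : measurable_fun [set: T] (fun x => `|(complex.Im (F x))%:E|%E).
  by apply: measurableT_comp => //; exact/measurable_EFinP.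
split=> [H|[Hr Hi]].
  split; apply: le_lt_trans H; apply: ge0_le_integral => // x _; rewrite !abse_EFin lee_fin;
  rewrite [leRHS]ger0_norm; case: (F x) => u v/=; rewrite ?sqrtr_ge0// -sqrtr_sqr ler_sqrt//;
  by rewrite ?addr_ge0 ?sqr_ge0// ?lerDl ?lerDr ?sqr_ge0.
apply: (@le_lt_trans _ _ (\int[mu]_x (`|(complex.Re (F x))%:E| + `|(complex.Im (F x))%:E|))%E).
  apply: ge0_le_integral => //; first by apply: emeasurable_funD.
  move=> x _; rewrite !abse_EFin -EFinD lee_fin; case: (F x) => u v/=.
  rewrite ger0_norm ?sqrtr_ge0// -[leRHS]ger0_norm ?addr_ge0// -sqrtr_sqr ler_sqrt ?sqr_ge0//.
  rewrite -[u ^+ 2]real_normK ?num_real// -[v ^+ 2]real_normK ?num_real// sqrrD.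
  by rewrite [leRHS]addrAC lerDl mulrn_wge0// mulr_ge0.
rewrite ge0_integralD//; exact: lte_add_pinfty.
Qed.

Lemma mass12_lty (h : T -> R) : measurable_fun [set: T] h ->
  (\int[mu]_x `|(h x)%:E| < +oo)%E -> (sqint mu h < +oo)%E -> (mass12 mu h < +oo)%E.
Proof.
move=> mh H1 H2; rewrite /mass12; under eq_integral do rewrite EFinD.
rewrite ge0_integralD//; last 3 first.
- by apply/measurable_EFinP; exact: measurableT_comp.
- by move=> x _; rewrite lee_fin sqr_ge0.
- exact: measurable_sqr.
exact: lte_add_pinfty.
Qed.

Variables (w : T -> R) (w0 : forall x, 0 <= w x) (mw : measurable_fun [set: T] w).

(** The set where the density vanishes has weighted measure 0. *)
Lemma ae_mweighted_neq0 : {ae mweighted mu w0 mw, forall x, w x != 0}.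
Proof.
exists (setT `&` w @^-1` [set 0]); split.
- exact: mw.
- rewrite /mweighted; apply: integral0_eq => x [_ /= ->] //.
- by move=> x /negP; rewrite negbK => /eqP.
Qed.

End complex_norms.

(** * Optimisation over the scale *)

Section optimisation.
Context {R : realType}.

(** The two terms balance at r^(2a + 4b) = A / B. The two implications cover A = 0 or B = 0, where
    the product on the right is 0 even if the other factor is infinite. *)
Lemma optimise_dilation (a b C : R) (S A B : \bar R) : 0 < a -> 0 < b -> 0 < C ->
  (0 <= A)%E -> (0 <= B)%E -> (A = 0%E -> S = 0%E) -> (B = 0%E -> S = 0%E) ->
  (forall r : R, 0 < r -> (S <= C%:E * ((r `^ (- (2 * a)))%:E * A + (r `^ (4 * b))%:E * B))%E) ->
  (S <= (2 * C)%:E * (A `^ (2 * b / (a + 2 * b)) * B `^ (a / (a + 2 * b))))%E.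
Proof.
move=> a0 b0 C0 A0 B0 SA SB H.
have ab0 : 0 < a + 2 * b by rewrite addr_gt0// mulr_gt0.
have t1 : 0 < 2 * b / (a + 2 * b) by rewrite divr_gt0// mulr_gt0.
have t2 : 0 < a / (a + 2 * b) by rewrite divr_gt0.
set u1 := 2 * b / (a + 2 * b) in t1 *; set u2 := a / (a + 2 * b) in t2 *.
have rhs0 : (0 <= (2 * C)%:E * (A `^ u1 * B `^ u2))%E.
  by rewrite !mule_ge0 ?poweR_ge0// lee_fin mulr_ge0// ltW.
have [A00|A00] := eqVneq A 0%E; first by rewrite (SA A00).
have [B00|B00] := eqVneq B 0%E; first by rewrite (SB B00).
have C20 : 0 < 2 * C by rewrite mulr_gt0.
have pos (X : \bar R) u : 0 < u -> (0 <= X)%E -> X != 0%E -> (0 < X `^ u)%E.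
  move=> u0; case: X => [x| |]//; last by rewrite poweRyr ?gt_eqF.
  rewrite lee_fin => x0 xn; rewrite poweR_EFin lte_fin powR_gt0//.
  by rewrite lt_neqAle x0 andbT eq_sym; apply: contraNN xn => /eqP ->.
have pA := pos _ _ t1 A0 A00; have pB := pos _ _ t2 B0 B00.
case: A A0 A00 pA H {SA rhs0} => [x| |]// A0 A00 pA H; last first.
  by rewrite poweRyr ?gt_eqF// gt0_mulye// gt0_muley ?leey// lte_fin.
case: B B0 B00 pB H {SB} => [y| |]// B0 B00 pB H; last first.
  by rewrite [(+oo `^ _)%E]poweRyr ?gt_eqF// gt0_muley// gt0_muley ?leey// lte_fin.
have x0 : 0 < x by rewrite lt_neqAle -!lee_fin A0 andbT eq_sym; apply: contraNN A00 => /eqP ->.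
have y0 : 0 < y by rewrite lt_neqAle -!lee_fin B0 andbT eq_sym; apply: contraNN B00 => /eqP ->.
have xy0 : 0 < x / y by rewrite divr_gt0.
pose s := (2 * a + 4 * b)^-1.
(* this radius makes the two terms of the hypothesis equal *)
have r0 : 0 < (x / y) `^ s by exact: powR_gt0.
apply: (le_trans (H _ r0)).
rewrite !poweR_EFin -!EFinM lee_fin -!powRrM.
have yi : y^-1 = y `^ (- 1) by rewrite powR_inv1// ltW.
have E (v : R) : (x / y) `^ v = x `^ v * y `^ (- v).
  by rewrite powRM ?invr_ge0 ?(ltW x0) ?(ltW y0)// yi -powRrM mulN1r.
have e1 : x `^ (s * - (2 * a)) * x = x `^ u1.
  rewrite -{2}(powRr1 (ltW x0)) -powRD; last by apply/implyP => _; rewrite gt_eqF.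
  congr (_ `^ _); rewrite /s /u1; field; apply/andP; split; rewrite gt_eqF//.
  by rewrite addr_gt0// mulr_gt0.
have e2 : y `^ (- (s * (4 * b))) * y = y `^ u2.
  rewrite -{2}(powRr1 (ltW y0)) -powRD; last by apply/implyP => _; rewrite gt_eqF.
  congr (_ `^ _); rewrite /s /u2; field; apply/andP; split; rewrite gt_eqF//.
  by rewrite addr_gt0// mulr_gt0.
have e3 : y `^ (- (s * - (2 * a))) = y `^ u2.
  congr (_ `^ _); rewrite /s /u2; field; apply/andP; split; rewrite gt_eqF//.
  by rewrite addr_gt0// mulr_gt0.
have e4 : x `^ (s * (4 * b)) = x `^ u1.
  congr (_ `^ _); rewrite /s /u1; field; apply/andP; split; rewrite gt_eqF//.
  by rewrite addr_gt0// mulr_gt0.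
rewrite !E [X in C * (X + _)]mulrAC e1 e3 e4 -[X in C * (_ + X)]mulrA e2.
by rewrite le_eqVlt; apply/orP; left; apply/eqP; ring.
Qed.

End optimisation.

(** * The chosen transform of complex functions *)

Section complex_transform.
Context {R : realType} (alpha : {nonneg R}).
Local Notation a := (alpha%:num).
Local Notation RM := (measurableTypeR R).
Local Notation m := (m_alpha alpha).
Local Notation gam := (gamma_alpha alpha).
Local Notation kap := (plancherel_const alpha).
Local Notation re f := (fun x => complex.Re (f x)).
Local Notation im f := (fun x => complex.Im (f x)).

#[local] Instance ae_m_filter : Filter (nbhs (almost_everywhere m)) :=
  ae_filter_ringOfSetsType m.

#[local] Instance ae_gamma_filter : Filter (nbhs (almost_everywhere gam)) :=
  ae_filter_ringOfSetsType gam.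

Let powR_neq0 (x e : R) : e != 0 -> x `^ e != 0 -> x != 0.
Proof. by move=> e0; apply: contraNN => /eqP ->; rewrite powR0. Qed.

(** The density contains x^(2 alpha + 1) with a positive exponent, so x = 0 is a null set. *)
Lemma ae_m_hom_norm_gt0 : {ae m, forall z, 0 < hom_norm z}.
Proof.
have H : {ae m, forall z, m_weight alpha z != 0} by exact: ae_mweighted_neq0.
apply: filterS H => z.
rewrite /m_weight !mulf_eq0 !negb_or => /andP[/andP[/andP[_ z1] _] _].
have {}z1 : z.1 != 0.
  by apply: powR_neq0 z1; rewrite gt_eqF// ltr_wpDl// mulr_ge0.
rewrite lt_neqAle hom_norm_ge0 andbT eq_sym; apply: contraNN z1 => /eqP z0.
have := hom_normX4 z; rewrite z0 expr0n/= => /esym/eqP.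
rewrite paddr_eq0; [|exact: exprn_even_ge0|by rewrite mulr_ge0 ?sqr_ge0].
by rewrite expf_eq0/= => /andP[].
Qed.

Lemma ae_gamma_gt0 : {ae gam, forall w, 0 < w.1}.
Proof.
have H : {ae gam, forall w, gamma_weight alpha w != 0} by exact: ae_mweighted_neq0.
apply: filterS H => w.
rewrite /gamma_weight indicE !mulf_eq0 !negb_or => /andP[/andP[_ w1] wK].
have {}w1 : w.1 != 0.
  by apply: powR_neq0 w1; rewrite gt_eqF// ltr_wpDl// mulr_ge0.
rewrite lt_neqAle eq_sym w1/=; move: wK; have [/set_mem[/= + _] _|] := boolP (w \in _).
  by rewrite in_itv/= andbT.
by rewrite eqxx.
Qed.

Lemma LB_transform1E f w : 0 <= w.1 ->
  LB_transform1 alpha f w = Complex (LBt alpha (re f) w) (LBt alpha (im f) w).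
Proof.
move=> w0; rewrite /LB_transform1 /cintegral /LBt w0; congr Complex;
  apply: eq_Rintegral => z _; case: (f z) => u v /=.
  by rewrite mulr0 subr0.
by rewrite mulr0 add0r.
Qed.

Lemma ae_LB_transform1 f : {ae gam, forall w,
  LB_transform1 alpha f w = Complex (LBt alpha (re f) w) (LBt alpha (im f) w)}.
Proof. by apply: filterS ae_gamma_gt0 => w w0; apply: LB_transform1E; exact: ltW. Qed.

Let csqintB d (T : measurableType d) (mu : {measure set T -> \bar R}) (F G : T -> R[i]) :
  csqint mu (fun x => F x - G x)%R =
  (sqint mu (fun x => complex.Re (F x) - complex.Re (G x))%R +
   sqint mu (fun x => complex.Im (F x) - complex.Im (G x))%R)%E.
Proof.
by rewrite /csqint; congr (_ + _)%E; congr sqint; apply/funext => x;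
  case: (F x) => ? ?; case: (G x).
Qed.

Let measurable_reB d (T : measurableType d) (F G : T -> R[i]) :
  measurable_fun [set: T] (re F) -> measurable_fun [set: T] (re G) ->
  measurable_fun [set: T] (fun x => complex.Re (F x - G x)).
Proof.
move=> mF mG; rewrite (_ : (fun x => _) = (fun x => complex.Re (F x) - complex.Re (G x))).
  exact: measurable_funB.
by apply/funext => x; case: (F x) => ? ?; case: (G x).
Qed.

Let measurable_imB d (T : measurableType d) (F G : T -> R[i]) :
  measurable_fun [set: T] (im F) -> measurable_fun [set: T] (im G) ->
  measurable_fun [set: T] (fun x => complex.Im (F x - G x)).
Proof.
move=> mF mG; rewrite (_ : (fun x => _) = (fun x => complex.Im (F x) - complex.Im (G x))).
  exact: measurable_funB.
by apply/funext => x; case: (F x) => ? ?; case: (G x).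
Qed.

Let mass12_0 : (mass12 m (cst 0%R) < +oo)%E.
Proof.
rewrite /mass12; under eq_integral do rewrite normr0 expr0n addr0.
by rewrite integral0.
Qed.

Let extends_LBt_lty f G : (sqint m f < +oo)%E -> extends_LBt alpha f G -> (sqint gam G < +oo)%E.
Proof.
have m0 : measurable_fun [set: RM * RM] (cst 0 : R * R -> R) by exact: measurable_cst.
move=> foo [mG /(_ _ m0 mass12_0) H].
have L0 w : LBt alpha (cst 0) w = 0.
  rewrite /LBt; case: ifP => // _; rewrite /Rintegral.
  by under eq_integral do rewrite mul0r; rewrite integral0.
have -> : G = (fun w => G w - LBt alpha (cst 0) w).
  by apply/funext => w; rewrite L0 subr0.
apply: (le_lt_trans H); rewrite (_ : (fun z => _) = f); last first.
  by apply/funext => z; rewrite subr0.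
apply: lte_mul_pinfty => //; rewrite lee_fin mulr_ge0// ltW//.
exact: plancherel_const_gt0.
Qed.

(** Extensions of the real and imaginary parts are chosen for each f. Continuity is the Lipschitz
    estimate, and agreement with the integral on L^1 /\ L^2 follows by comparing f with itself. *)
Lemma exists_LB_extension : exists T, is_LB_extension alpha T.
Proof.
have k0 := plancherel_const_gt0 alpha.
have H (f : R * R -> R[i]) : exists G : R * nat -> R[i], cLfun m 2%:E f ->
    extends_LBt alpha (re f) (re G) /\ extends_LBt alpha (im f) (im G).
  have [/cLfun2P[mr mi sr si]|nf] := pselect (cLfun m 2%:E f); last by exists (cst 0).
  have [G1 H1] := exists_extends_LBt mr sr; have [G2 H2] := exists_extends_LBt mi si.
  by exists (fun w => Complex (G1 w) (G2 w)).
have [T HT] := choice H; exists T; split.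
- move=> f ff; have [H1 H2] := HT f ff; have /cLfun2P[mr mi sr si] := ff.
  apply/cLfun2P; split; [exact: H1.1|exact: H2.1|exact: extends_LBt_lty H1|exact: extends_LBt_lty H2].
- move=> f ff e e0; have [F1 F2] := HT f ff; have /cLfun2P[mr mi sr si] := ff.
  pose c := 64 * kap; have c0 : 0 < c by rewrite mulr_gt0.
  have c1 : 0 < c + 1 by rewrite addr_gt0.
  (* This radius works because c / (c + 1)^2 <= 1. *)
  exists (e / (c + 1)); first by rewrite divr_gt0.
  move=> g gg; have [G1 G2] := HT g gg; have /cLfun2P[mr' mi' sr' si'] := gg.
  rewrite cLnorm2_lt ?divr_gt0//; [|exact: measurable_reB|exact: measurable_imB].
  rewrite cLnorm2_lt//; [|apply: measurable_reB; [exact: G1.1|exact: F1.1]|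
    apply: measurable_imB; [exact: G2.1|exact: F2.1]].
  rewrite !csqintB => D.
  apply: (@le_lt_trans _ _ (c%:E * (sqint m (fun x => complex.Re (g x) - complex.Re (f x))%R +
    sqint m (fun x => complex.Im (g x) - complex.Im (f x))%R))%E).
    rewrite ge0_muleDr ?sqint_ge0//; apply: leeD; exact: extends_LBt_lip.
  move: D; have := adde_ge0 (sqint_ge0 m (fun x => complex.Re (g x) - complex.Re (f x)))
    (sqint_ge0 m (fun x => complex.Im (g x) - complex.Im (f x))).
  case: (_ + _)%E => [D| |]//; rewrite lee_fin -EFinM !lte_fin => D0 De.
  apply: (@lt_le_trans _ _ (c * (e / (c + 1)) ^+ 2)); first by rewrite ltr_pM2l.
  rewrite exprMn exprVn mulrA ler_pdivrMr ?exprn_gt0// mulrC ler_wpM2l ?sqr_ge0//.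
  by rewrite sqrrD1 expr2; have := ltW c0; nra.
- move=> f f1 f2; have [F1 F2] := HT f f2; have /cLfun2P[mr mi sr si] := f2.
  have [_ _ /(cLnorm1_lt m mr mi)[r1 i1]] := f1.
  have ae0 (h : R * R -> R) G : measurable_fun [set: RM * RM] h -> (mass12 m h < +oo)%E ->
      extends_LBt alpha h G -> {ae gam, forall w, G w = LBt alpha h w}.
    move=> mh hoo [mG HG].
    have /sqint_eq0 : measurable_fun [set: RM * nat] (fun w => G w - LBt alpha h w).
      by apply: measurable_funB => //; exact: measurable_LBt.
    move=> /(_ gam) E; apply: filterS (E _) => [w /eqP|]; first by rewrite subr_eq0 => /eqP.
    apply/eqP; rewrite eq_le sqint_ge0 andbT; apply: (le_trans (HG h mh hoo)).
    rewrite (_ : (fun z => _) = cst 0); last by apply/funext => z; rewrite subrr.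
    by rewrite /sqint; under eq_integral do rewrite expr0n; rewrite integral0 mule0.
  have A1 := ae0 _ _ mr (mass12_lty mr r1 sr) F1; have A2 := ae0 _ _ mi (mass12_lty mi i1 si) F2.
  apply: filterS3 A1 A2 (ae_LB_transform1 f) => w /= e1 e2 ->.
  by rewrite -e1 -e2; case: (T f w).
Qed.

Lemma LB_transform_extension : is_LB_extension alpha (LB_transform alpha).
Proof. exact: (xgetPex (fun _ _ => 0) exists_LB_extension). Qed.

(** With approximation error d, two comparisons give 2 (d + 8 kap (d + S)) = 16 kap S + (2 + 16 kap)
    d, the origin of the constant 16 in [extends_LBt]. *)
Let extends_LBt_approx (f : R * R -> R) (G : R * nat -> R) :
  measurable_fun [set: RM * RM] f -> measurable_fun [set: RM * nat] G ->
  (forall e : R, 0 < e -> exists h, [/\ measurable_fun [set: RM * RM] h, (mass12 m h < +oo)%E,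
    (sqint m (fun z => f z - h z)%R <= e%:E)%E &
    (sqint gam (fun w => LBt alpha h w - G w)%R <= e%:E)%E]) ->
  extends_LBt alpha f G.
Proof.
move=> mf mG H; split=> // g mg goo; have k0 := plancherel_const_gt0 alpha.
have := sqint_ge0 m (fun z => f z - g z).
case E : (sqint m (fun z => f z - g z)) => [S| |]// S0; last first.
  by rewrite gt0_muley ?leey// lte_fin mulr_gt0.
apply/lee_addgt0Pr => e e0.
have c0 : 0 < 2 + 16 * kap by rewrite addr_gt0// mulr_gt0.
have [h [mh hoo fh hG]] := H (e / (2 + 16 * kap)) (divr_gt0 e0 c0).
set d := e / (2 + 16 * kap) in fh hG.
have mLh := measurable_LBt mh hoo; have mLg := measurable_LBt mg goo.
apply: (le_trans (le_sqint_dist gam mG mLh mLg)).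
apply: (@le_trans _ _ (2%:E * (d%:E + (4 * kap)%:E * (2%:E * (d%:E + S%:E)))))%E.
  rewrite lee_wpmul2l ?lee_fin//; apply: leeD; first by rewrite sqint_distC.
  apply: (le_trans (plancherel_leB mh hoo mg goo)).
  rewrite lee_wpmul2l ?lee_fin ?(mulr_ge0 _ (ltW k0))//.
  apply: (le_trans (le_sqint_dist m mh mf mg)).
  by rewrite lee_wpmul2l ?lee_fin// E leeD// sqint_distC.
rewrite -!(EFinD, EFinM) lee_fin le_eqVlt /d; apply/orP; left; apply/eqP; field.
by rewrite gt_eqF.
Qed.

(** Truncations of f lie in L^1 /\ L^2, where the transform is the integral, and converge to f in
    L^2; continuity at f transfers the estimate. *)
Lemma LB_transform_extends f : cLfun m 2%:E f ->
  extends_LBt alpha (re f) (re (LB_transform alpha f)) /\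
  extends_LBt alpha (im f) (im (LB_transform alpha f)).
Proof.
move=> ff; have [T1 T2 T3] := LB_transform_extension.
set T := LB_transform alpha in T1 T2 T3 *.
have /cLfun2P[mr mi sr si] := ff; have /cLfun2P[mTr mTi _ _] := T1 f ff.
have H (e : R) : 0 < e -> exists n,
   [/\ (sqint m (fun z => complex.Re (f z) - trunc (re f) n z)%R <= e%:E)%E,
       (sqint m (fun z => complex.Im (f z) - trunc (im f) n z)%R <= e%:E)%E,
       (sqint gam (fun w => LBt alpha (trunc (re f) n) w - complex.Re (T f w))%R <= e%:E)%E &
       (sqint gam (fun w => LBt alpha (trunc (im f) n) w - complex.Im (T f w))%R <= e%:E)%E].
  move=> e0; have s0 : 0 < Num.sqrt e by rewrite sqrtr_gt0.
  have [r r0 Hr] := T2 f ff _ s0.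
  (* A quarter for each of the two parts keeps the squared distance strictly below r^2. *)
  have r2 : 0 < r ^+ 2 / 4 by rewrite divr_gt0 ?exprn_gt0.
  have [N1 _ H1] := trunc_cvg mr sr r2; have [N2 _ H2] := trunc_cvg mi si r2.
  have [N3 _ H3] := trunc_cvg mr sr e0; have [N4 _ H4] := trunc_cvg mi si e0.
  pose n := maxn (maxn N1 N2) (maxn N3 N4); exists n.
  have {}H1 : (sqint m (fun z => complex.Re (f z) - trunc (re f) n z)%R <= (r ^+ 2 / 4)%:E)%E.
    by apply: H1; rewrite /= /n !leq_max leqnn.
  have {}H2 : (sqint m (fun z => complex.Im (f z) - trunc (im f) n z)%R <= (r ^+ 2 / 4)%:E)%E.
    by apply: H2; rewrite /= /n !leq_max leqnn orbT.
  have {}H3 : (sqint m (fun z => complex.Re (f z) - trunc (re f) n z)%R <= e%:E)%E.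
    by apply: H3; rewrite /= /n !leq_max leqnn !orbT.
  have {}H4 : (sqint m (fun z => complex.Im (f z) - trunc (im f) n z)%R <= e%:E)%E.
    by apply: H4; rewrite /= /n !leq_max leqnn !orbT.
  have mtr := measurable_trunc n mr; have mti := measurable_trunc n mi.
  have tr := mass12_trunc n mr sr; have ti := mass12_trunc n mi si.
  pose g z := Complex (trunc (re f) n z) (trunc (im f) n z).
  have g2 : cLfun m 2%:E g.
    apply/cLfun2P; split; [exact: mtr|exact: mti| |].
      exact: le_lt_trans (le_sqint_trunc alpha n mr) sr.
    exact: le_lt_trans (le_sqint_trunc alpha n mi) si.
  have g1 : cLfun m 1%:E g.
    split=> //; apply/cLnorm1_lt => //; split.
      exact: le_lt_trans (normr_le_mass12 m mtr) tr.
    exact: le_lt_trans (normr_le_mass12 m mti) ti.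
  have /cLfun2P[mgr mgi _ _] := T1 g g2.
  have := Hr g g2; rewrite cLnorm2_lt//; [|exact: measurable_reB|exact: measurable_imB].
  rewrite cLnorm2_lt//; [|exact: measurable_reB|exact: measurable_imB].
  have D0 : (sqint m (fun z => trunc (re f) n z - complex.Re (f z))%R +
      sqint m (fun z => trunc (im f) n z - complex.Im (f z))%R < (r ^+ 2)%:E)%E.
    apply: (@le_lt_trans _ _ ((r ^+ 2 / 4)%:E + (r ^+ 2 / 4)%:E)%E).
      by apply: leeD; rewrite sqint_distC.
    by rewrite -EFinD lte_fin; have := exprn_gt0 2 r0; lra.
  rewrite !csqintB sqr_sqrtr ?(ltW e0)// => /(_ D0) D; have Tg := T3 g g1 g2.
  have mLr := measurable_LBt mtr tr; have mLi := measurable_LBt mti ti.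
  split=> //.
    rewrite (@ae_eq_sqint _ _ _ gam _ (fun w => complex.Re (T g w) - complex.Re (T f w))).
    - by apply: le_trans (ltW D); rewrite leeDl ?sqint_ge0.
    - exact: measurable_funB.
    - exact: measurable_funB.
    by apply: filterS2 Tg (ae_LB_transform1 g) => w -> ->.
  rewrite (@ae_eq_sqint _ _ _ gam _ (fun w => complex.Im (T g w) - complex.Im (T f w))).
  - by apply: le_trans (ltW D); rewrite leeDr ?sqint_ge0.
  - exact: measurable_funB.
  - exact: measurable_funB.
  by apply: filterS2 Tg (ae_LB_transform1 g) => w -> ->.
split; apply: extends_LBt_approx => // e /H[n [? ? ? ?]].
  by exists (trunc (re f) n); split=> //; [exact: measurable_trunc|exact: mass12_trunc].
by exists (trunc (im f) n); split=> //; [exact: measurable_trunc|exact: mass12_trunc].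
Qed.

(** Injectivity from the lower Plancherel bound: if G is null, the transforms of truncations are
    small, hence so are the truncations and f. *)
Lemma extends_LBt_eq0 f G : measurable_fun [set: RM * RM] f -> (sqint m f < +oo)%E ->
  extends_LBt alpha f G -> sqint gam G = 0%E -> sqint m f = 0%E.
Proof.
move=> mf foo [mG HG] G0; have k0 := plancherel_const_gt0 alpha.
apply/eqP; rewrite eq_le sqint_ge0 andbT; apply/lee_addgt0Pr => e e0; rewrite add0e.
(* The errors add up to 2 (d + 128 d) = 258 d, below e = 512 d. *)
pose d := e / 16 / 32; have d0 : 0 < d by rewrite !divr_gt0.
have [N _ /(_ N (leqnn N)) HN] := trunc_cvg mf foo d0.
have mh := measurable_trunc N mf; have hoo := mass12_trunc N mf foo.
set h := trunc f N in HN mh hoo.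
have mL := measurable_LBt mh hoo.
have S1 : (sqint gam (LBt alpha h) <= (32 * kap * d)%:E)%E.
  apply: (@le_trans _ _ (2%:E * (sqint gam (fun w => G w - LBt alpha h w)%R + sqint gam G))%E).
    apply: le_sqintD => //; first exact: measurable_funB.
    move=> w; have := ler_normB (G w) (G w - LBt alpha h w).
    by rewrite opprB addrC subrK addrC.
  rewrite G0 adde0; apply: (@le_trans _ _ (2%:E * ((16 * kap)%:E * d%:E))%E).
    rewrite lee_wpmul2l ?lee_fin//; apply: (le_trans (HG h mh hoo)).
    by rewrite lee_wpmul2l ?lee_fin ?(mulr_ge0 _ (ltW k0)).
  by rewrite -!EFinM lee_fin le_eqVlt; apply/orP; left; apply/eqP; ring.
have S2 : (sqint m h <= (128 * d)%:E)%E.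
  rewrite -(@lee_pmul2l _ kap%:E) ?lte_fin//; apply: (le_trans (plancherel_ge mh hoo)).
  apply: (@le_trans _ _ (4%:E * (32 * kap * d)%:E)%E); first by rewrite lee_wpmul2l ?lee_fin.
  by rewrite -!EFinM lee_fin le_eqVlt; apply/orP; left; apply/eqP; ring.
apply: (@le_trans _ _ (2%:E * (sqint m (fun z => f z - h z)%R + sqint m h))%E).
  apply: le_sqintD => //; first exact: measurable_funB.
  by move=> z; have := ler_normD (f z - h z) (h z); rewrite subrK.
apply: (@le_trans _ _ (2%:E * (d%:E + (128 * d)%:E))%E).
  by rewrite lee_wpmul2l ?lee_fin// leeD.
by rewrite -EFinD -EFinM lee_fin /d; lra.
Qed.

Lemma sqint_hom_norm_eq0 (f : R * R -> R) (p : R) : measurable_fun [set: RM * RM] f ->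
  sqint m (fun z => hom_norm z `^ p * f z)%R = 0%E -> sqint m f = 0%E.
Proof.
move=> mf /sqint_eq0 H.
have {}H : {ae m, forall z, hom_norm z `^ p * f z = 0}.
  apply: H; apply: measurable_funM => //; apply: (measurableT_comp (measurable_powR _)) => //.
  exact: measurable_hom_norm.
rewrite (@ae_eq_sqint _ _ _ m f (cst 0))//.
  by rewrite /sqint; under eq_integral do rewrite expr0n; rewrite integral0.
apply: filterS2 H ae_m_hom_norm_gt0 => z /eqP + z0.
by rewrite mulf_eq0 (gt_eqF (powR_gt0 _ z0))/= => /eqP.
Qed.

Lemma sqint_spec_eq0 (G : R * nat -> R) (p : R) : measurable_fun [set: RM * nat] G ->
  sqint gam (fun w => spec alpha w `^ p * G w)%R = 0%E -> sqint gam G = 0%E.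
Proof.
move=> mG /sqint_eq0 H.
have {}H : {ae gam, forall w, spec alpha w `^ p * G w = 0}.
  apply: H; apply: measurable_funM => //; apply: (measurableT_comp (measurable_powR _)) => //.
  exact: measurable_spec.
rewrite (@ae_eq_sqint _ _ _ gam G (cst 0))//.
  by rewrite /sqint; under eq_integral do rewrite expr0n; rewrite integral0.
apply: filterS2 H ae_gamma_gt0 => w /eqP + w0.
have sw : 0 < spec alpha w.
  by rewrite mulr_gt0// mulr_gt0// ltr_wpDl// addr_ge0// mulr_ge0.
by rewrite mulf_eq0 (gt_eqF (powR_gt0 _ sw))/= => /eqP.
Qed.

End complex_transform.

Theorem theorem3p1 (R : realType) (alpha : {nonneg R}) (a b : R)
    (ha : 0 < a) (hb : 0 < b) :
  exists2 C : R, 0 < C &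
    forall f : R * R -> R[i], cLfun (m_alpha alpha) 2%:E f ->
    (cLnorm (m_alpha alpha) 2%:E
         (fun z : R * R => (hom_norm z `^ a)%:C%C * f z)%R
       `^ (2 * b / (a + 2 * b))%R *
     cLnorm (gamma_alpha alpha) 2%:E
         (fun w : R * nat =>
            ((2 * (2 * w.2%:R + alpha%:num + 1) * w.1) `^ b)%:C%C
            * LB_transform alpha f w)%R
       `^ (a / (a + 2 * b))%R
     >= C%:E * cLnorm (m_alpha alpha) 2%:E f)%E.
Proof.
have [K K0 HK] := dilated_estimate alpha ha hb.
have K20 : 0 < 2 * K by rewrite mulr_gt0.
(* The estimate is proved for squared norms with constant 2 K; taking square roots and inverting
   gives this constant. *)
exists ((2 * K) `^ (- 2^-1)); first exact: powR_gt0.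
move=> f ff; have [E1 E2] := LB_transform_extends ff.
have /cLfun2P[mr mi sr si] := ff.
set G := LB_transform alpha f in E1 E2 *.
have [mGr _] := E1; have [mGi _] := E2.
pose hf z := (hom_norm z `^ a)%:C%C * f z.
pose hG w := ((2 * (2 * w.2%:R + alpha%:num + 1) * w.1) `^ b)%:C%C * G w.
have ReM (x : R) y : complex.Re (x%:C%C * y) = x * complex.Re y.
  by case: y => u v /=; rewrite mul0r subr0.
have ImM (x : R) y : complex.Im (x%:C%C * y) = x * complex.Im y.
  by case: y => u v /=; rewrite mul0r addr0.
have mh : measurable_fun [set: measurableTypeR R * measurableTypeR R] (fun z => @hom_norm R z `^ a).
  by apply: (measurableT_comp (measurable_powR _)) => //; exact: measurable_hom_norm.
have ms : measurable_fun [set: measurableTypeR R * nat] (fun w => spec alpha w `^ b).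
  by apply: (measurableT_comp (measurable_powR _)) => //; exact: measurable_spec.
have Rhf : (fun z => complex.Re (hf z)) = (fun z => hom_norm z `^ a * complex.Re (f z)).
  by apply/funext => z; exact: ReM.
have Ihf : (fun z => complex.Im (hf z)) = (fun z => hom_norm z `^ a * complex.Im (f z)).
  by apply/funext => z; exact: ImM.
have RhG : (fun w => complex.Re (hG w)) = (fun w => spec alpha w `^ b * complex.Re (G w)).
  by apply/funext => w; exact: ReM.
have IhG : (fun w => complex.Im (hG w)) = (fun w => spec alpha w `^ b * complex.Im (G w)).
  by apply/funext => w; exact: ImM.
have mRhf : measurable_fun [set: measurableTypeR R * measurableTypeR R] (fun z => complex.Re (hf z)).
  by rewrite Rhf; exact: measurable_funM.
have mIhf : measurable_fun [set: measurableTypeR R * measurableTypeR R] (fun z => complex.Im (hf z)).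
  by rewrite Ihf; exact: measurable_funM.
have mRhG : measurable_fun [set: measurableTypeR R * nat] (fun w => complex.Re (hG w)).
  by rewrite RhG; exact: measurable_funM.
have mIhG : measurable_fun [set: measurableTypeR R * nat] (fun w => complex.Im (hG w)).
  by rewrite IhG; exact: measurable_funM.
rewrite (cLnorm2E (m_alpha alpha) mr mi) (cLnorm2E (m_alpha alpha) mRhf mIhf).
rewrite (cLnorm2E (gamma_alpha alpha) mRhG mIhG).
have A0 := csqint_ge0 (m_alpha alpha) hf; have B0 := csqint_ge0 (gamma_alpha alpha) hG.
have AE : csqint (m_alpha alpha) hf =
  (sqint (m_alpha alpha) (fun z => hom_norm z `^ a * complex.Re (f z))%R +
   sqint (m_alpha alpha) (fun z => hom_norm z `^ a * complex.Im (f z))%R)%E.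
  by rewrite /csqint Rhf Ihf.
have BE : csqint (gamma_alpha alpha) hG =
  (sqint (gamma_alpha alpha) (fun w => spec alpha w `^ b * complex.Re (G w))%R +
   sqint (gamma_alpha alpha) (fun w => spec alpha w `^ b * complex.Im (G w))%R)%E.
  by rewrite /csqint RhG IhG.
have H : (csqint (m_alpha alpha) f <= (2 * K)%:E * (csqint (m_alpha alpha) hf `^ (2 * b / (a + 2 * b)) *
    csqint (gamma_alpha alpha) hG `^ (a / (a + 2 * b))))%E.
  apply: optimise_dilation => //.
  - rewrite AE => /eqP; rewrite padde_eq0 ?sqint_ge0// => /andP[/eqP H1 /eqP H2].
    by rewrite /csqint (sqint_hom_norm_eq0 mr H1) (sqint_hom_norm_eq0 mi H2) adde0.
  - rewrite BE => /eqP; rewrite padde_eq0 ?sqint_ge0// => /andP[/eqP H1 /eqP H2].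
    rewrite /csqint (extends_LBt_eq0 mr sr E1 (sqint_spec_eq0 mGr H1)).
    by rewrite (extends_LBt_eq0 mi si E2 (sqint_spec_eq0 mGi H2)) adde0.
  (* At a common scale r the estimates for the real and imaginary parts add up; only then is r
     optimised. *)
  move=> r r0; rewrite AE BE.
  rewrite (ge0_muleDr _ (sqint_ge0 _ _) (sqint_ge0 _ _)).
  rewrite [X in (K%:E * (_ + X))%E](ge0_muleDr _ (sqint_ge0 _ _) (sqint_ge0 _ _)) addeACA.
  rewrite ge0_muleDr ?adde_ge0 ?mule_ge0 ?sqint_ge0 ?lee_fin ?powR_ge0//.
  by apply: leeD; exact: HK.
have M0 : (0 <= csqint (m_alpha alpha) hf `^ (2 * b / (a + 2 * b)) *
    csqint (gamma_alpha alpha) hG `^ (a / (a + 2 * b)))%E by rewrite mule_ge0 ?poweR_ge0.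
(* The square roots are moved outside the two exponents and merged into a root of the product, so
   that [H] applies under it. *)
rewrite ![((_ `^ 2^-1) `^ _)%E]poweRAC -poweRM ?poweR_ge0//.
have := @gt0_ler_poweR R 2^-1 ltac:(by []) _ _ _ _ H.
rewrite !in_itv/= !leey !andbT csqint_ge0 mule_ge0 ?lee_fin ?(ltW K20)// => /(_ isT isT) H'.
rewrite powRN.
apply: (@le_trans _ _ (((2 * K) `^ 2^-1)^-1%:E * ((2 * K)%:E `^ 2^-1 *
  (csqint (m_alpha alpha) hf `^ (2 * b / (a + 2 * b)) *
    csqint (gamma_alpha alpha) hG `^ (a / (a + 2 * b))) `^ 2^-1)))%E.
  rewrite lee_wpmul2l ?lee_fin ?invr_ge0 ?powR_ge0//.
  by rewrite -poweRM ?lee_fin ?(ltW K20).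
by rewrite poweR_EFin muleA -EFinM mulVf ?mul1e// gt_eqF// powR_gt0.
Qed.
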